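(* Let $f:X\to Y$ be a globular subdivision of multipointed $d$-spaces. Let $\alpha,\beta\in Y^0$. Then either there exists a directed path $\gamma$ of $Y$ from $\alpha$ to $\beta$ such that $\gamma([0,1])\subset|X|\setminus X^0$, and there is a homeomorphism $$\vec{T}(Y)(\alpha,\beta)\cong\{\tau_{\alpha,\beta}\}\sqcup\vec{T}(X)(\alpha^+,\beta^-),$$ or there is no such directed path and there is a homeomorphism $$\vec{T}(Y)(\alpha,\beta)\cong\vec{T}(X)(\alpha^+,\beta^-).$$
   Context: **Multipointed $d$-spaces.** $\mathbf{Top}$ denotes either the category of $\Delta$-generated spaces or that of $\Delta$-Hausdorff $\Delta$-generated spaces (either choice); it is bicomplete and cartesian closed with internal hom $\mathbf{TOP}(-,-)$, and $\Delta$-kelleyfication is the right adjoint of the inclusion of $\Delta$-generated spaces into topological spaces. $\mathcal{M}$ is the set of nondecreasing surjective maps $[0,1]\to[0,1]$. The normalized composition $\gamma_1*_N\gamma_2$ of paths with $\gamma_1(1)=\gamma_2(0)$ is $\gamma_1(2t)$ for $t\le 1/2$ and $\gamma_2(2t-1)$ for $t\ge 1/2$. A multipointed $d$-space is a triple $X=(|X|,X^0,\mathbb{P}^{top}X)$ with $|X|$ a space (the underlying space), $X^0\subset|X|$ a set (the states) and $\mathbb{P}^{top}X$ a set of continuous maps $[0,1]\to|X|$ (the execution paths) such that $\gamma(0),\gamma(1)\in X^0$ for every execution path $\gamma$, and $\mathbb{P}^{top}X$ is closed under $\gamma\mapsto\gamma\phi$ for $\phi\in\mathcal{M}$ and under normalized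 composition. A map $f:X\to Y$ is a continuous map $|X|\to|Y|$ taking $X^0$ to $Y^0$ and execution paths to execution paths. A set $S$ is viewed as $(S,S,\varnothing)$. The topological globe $\mathrm{Glob}^{top}(Z)$ of a space $Z$ has underlying space the quotient of $\{0,1\}\sqcup(Z\times[0,1])$ by $(z,0)=0$, $(z,1)=1$ for all $z$, states $\{0,1\}$, and execution paths $t\mapsto(z,\phi(t))$ with $z\in Z$, $\phi\in\mathcal{M}$. $\mathbf{D}^n$ is the closed unit disk of $\mathbb{R}^n$, $\mathbf{S}^{n-1}$ its boundary sphere, $\mathbf{D}^0=\{0\}$, $\mathbf{S}^{-1}=\varnothing$. **Cellular multipointed $d$-spaces.** A cellular decomposition of a multipointed $d$-space $X$ is a colimit-preserving functor $\widetilde{X}$ from an ordinal $\lambda$ to multipointed $d$-spaces, with colimit $X$, such that $\widetilde{X}_0=(X^0,X^0,\varnothing)$ with $X^0$ discrete and such that for all $\nu<\lambda$, $\widetilde{X}_{\nu+1}$ is a pushout of $\mathrm{Glob}^{top}(\mathbf{S}^{n_\nu-1})\subset\mathrm{Glob}^{top}(\mathbf{D}^{n_\nu})$ ($n_\nu\ge0$) along a map $g_\nu:\mathrm{Glob}^{top}(\mathbf{S}^{n_\nu-1})\to\widetilde{X}_\nu$; the resulting map $\widehat{g_\nu}:\mathrm{Glob}^{top}(\mathbf{D}^{n_\nu})\to X$ is the attaching map. $X$ is cellular if it has a cellular decomposition. The globular cells of $X$ are the cells $c_\nu=|\mathrm{Glob}^{top}(\mathbf{D}^{n_\nu})|\setminus|\mathrm{Glob}^{top}(\mathbf{S}^{n_\nu-1})|$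 (identified with their homeomorphic images in $|X|$), of dimension $n_\nu+1$, with initial state $c_\nu^-=\widehat{g_\nu}(0)\in X^0$ and final state $c_\nu^+=\widehat{g_\nu}(1)\in X^0$, together with the points $\alpha\in X^0$, of dimension $0$, with $\alpha^-=\alpha^+=\alpha$. As a set $|X|$ is the disjoint union of the globular cells. **Globular subdivision and connection maps.** A map of multipointed $d$-spaces $f:X\to Y$ is a globular subdivision if $X$ and $Y$ are cellular and $f$ induces a homeomorphism $|X|\cong|Y|$; one identifies $|X|=|Y|$, so $X^0\subset Y^0$. Choose a cellular decomposition of $X$; each $\alpha\in Y^0$ lies in a unique globular cell $c_\alpha$ of $X$, and one sets $\alpha^-=c_\alpha^-$, $\alpha^+=c_\alpha^+$. The maps $\alpha\mapsto\alpha^\pm$ from $Y^0$ to $X^0$ (which do not depend on the chosen decomposition) are the connection maps of $f$; $\alpha^-=\alpha^+=\alpha$ if $\alpha\in X^0$. **Directed paths and traces.** Let $\mathcal{I}$ be the set of nondecreasing continuous maps $[0,1]\to[0,1]$. The directed paths of a multipointed $d$-space $X$ are the constant paths and the paths $[0,1]\to|X|$ of the form $(\gamma_1\phi_1\mu_{\ell_1})*\dots*(\gamma_n\phi_n\mu_{\ell_n})$ (Moore composition, $\ell_i>0$, $\sum\ell_i=1$) with $\gamma_i$ execution paths of $X$, $\phi_i\in\mathcal{I}$, $\mu_\ell:[0,\ell]\to[0,1]$, $\mu_\ell(t)=t/\ell$. For $u,v\in|X|$, $\vec{P}(X)(u,v)$ is the space of directed paths from $u$ to $v$ with the $\Delta$-kelleyfication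 of the compact-open topology, and $\vec{T}(X)(u,v)$ (the space of traces) is its quotient by the equivalence relation generated by reparametrization by maps of $\mathcal{M}$. When $f:X\to Y$ is a globular subdivision, $X$ and $Y$ have the same directed paths. **The trace $\tau_{\alpha,\beta}$.** When there is a directed path from $\alpha$ to $\beta$ with image contained in $|X|\setminus X^0$, all such directed paths have the same class in $\vec{T}(Y)(\alpha,\beta)$, and $\tau_{\alpha,\beta}$ denotes that class. *)

(* Defs.v *)
From HB Require Import structures.
From Stdlib Require Import Relation_Operators.
From mathcomp Require Import all_boot all_order all_algebra generic_quotient.
From mathcomp Require Import all_classical reals topology normedtype.
Import numFieldNormedType.Exports.
Import Order.TTheory GRing.Theory Num.Theory.

Set Implicit Arguments.
Unset Strict Implicit.
Unset Printing Implicit Defensive.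

Local Open Scope classical_set_scope.
Local Open Scope ring_scope.
Local Open Scope quotient_scope.

Definition unitI (R : realType) : topologicalType :=
  set_type (`[0%R, 1%R]%classic : set R).

Lemma clampI_subproof (R : realType) (x : R) :
  Num.max 0 (Num.min 1 x) \in (`[0%R, 1%R]%classic : set R).
Proof.
by rewrite inE /= in_itv /= le_max lexx /= ge_max ler01 /= ge_min lexx.
Qed.

Definition clampI (R : realType) (x : R) : unitI R :=
  exist (fun y => y \in (`[0%R, 1%R]%classic : set R)) _ (clampI_subproof x).

Definition I0 (R : realType) : unitI R := clampI 0.
Definition I1 (R : realType) : unitI R := clampI 1.

Definition nondecreasingI (R : realType) (phi : unitI R -> unitI R) : Prop :=
  forall s t : unitI R, val s <= val t -> val (phi s) <= val (phi t).

(** [calM R] is the set written M, [calI R] the set written I. *)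
Definition calM (R : realType) : set (unitI R -> unitI R) :=
  [set phi | nondecreasingI phi /\ forall t, exists s, phi s = t].

Definition calI (R : realType) : set (unitI R -> unitI R) :=
  [set phi | nondecreasingI phi /\ continuous phi].

(** Normalized composition; meaningful when [g1 (I1 R) = g2 (I0 R)]. *)
Definition ncomp (R : realType) (T : Type) (g1 g2 : unitI R -> T) :
    unitI R -> T :=
  fun t => if val t <= 2^-1 then g1 (clampI (2 * val t))
           else g2 (clampI (2 * val t - 1)).

Definition stdsimplex (R : realType) (n : nat) : topologicalType :=
  set_type ([set x : 'rV[R]_n.+1 |
              (forall i, 0 <= x ord0 i) /\ \sum_i x ord0 i = 1]).

Definition kelley_open (R : realType) (T : topologicalType) (U : set T) :=
  forall (n : nat) (p : stdsimplex R n -> T), continuous p -> open (p @^-1` U).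

Definition delta_generated (R : realType) (T : topologicalType) : Prop :=
  forall U : set T, kelley_open R U -> open U.

(** On Delta-generated spaces this is equivalent to the closedness of the
    diagonal in the product taken in the category of Delta-generated spaces. *)
Definition delta_Hausdorff (R : realType) (T : topologicalType) : Prop :=
  forall p : unitI R -> T, continuous p -> closed (range p).

(** The category Top is either that of Delta-generated spaces or that of
    Delta-Hausdorff Delta-generated spaces. *)
Inductive top_choice := DeltaGenerated | DeltaHausdorffDeltaGenerated.

Definition in_Top (R : realType) (c : top_choice) (T : topologicalType) : Prop :=
  match c with
  | DeltaGenerated => delta_generated R T
  | DeltaHausdorffDeltaGenerated => delta_generated R T /\ delta_Hausdorff R T
  end.

(** [kelley R T] is the Delta-kelleyfication of [T]: the same points, with the
    final topology with respect to the singular simplices of [T]. *)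
Definition kelley (R : realType) (T : topologicalType) : Type := T.

HB.instance Definition _ (R : realType) (T : topologicalType) :=
  Choice.on (kelley R T).

Lemma kelley_openT (R : realType) (T : topologicalType) :
  @kelley_open R T setT.
Proof. by move=> n p _; rewrite preimage_setT; exact: openT. Qed.

Lemma kelley_openI (R : realType) (T : topologicalType) :
  setI_closed (@kelley_open R T).
Proof.
by move=> A B oA oB n p cp; rewrite preimage_setI; apply: openI;
  [exact: oA|exact: oB].
Qed.

Lemma kelley_open_bigU (R : realType) (T : topologicalType) (J : Type)
    (F : J -> set T) :
  (forall i, kelley_open R (F i)) -> kelley_open R (\bigcup_i F i).
Proof.
move=> oF n p cp; rewrite preimage_bigcup; apply: bigcup_open => i _.
exact: oF.
Qed.

HB.instance Definition _ (R : realType) (T : topologicalType) :=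
  isOpenTopological.Build (kelley R T) (@kelley_openT R T) (@kelley_openI R T)
    (@kelley_open_bigU R T).

Lemma kelley_openE (R : realType) (T : topologicalType) (U : set (kelley R T)) :
  open U = @kelley_open R T U.
Proof. by []. Qed.

Definition topsum (A B : topologicalType) : topologicalType :=
  {b : bool & (if b then A else B)}.

Definition homeomorphic (A B : topologicalType) : Prop :=
  exists (h : A -> B) (k : B -> A),
    [/\ cancel h k, cancel k h, continuous h & continuous k].

Record mpdspace (R : realType) := MPDSpace {
  us :> topologicalType;
  states : set us;
  exec : set (unitI R -> us);
  exec_continuous : forall g, exec g -> continuous g;
  exec_states : forall g, exec g -> states (g (I0 R)) /\ states (g (I1 R));
  exec_reparam : forall g phi, exec g -> calM phi -> exec (g \o phi);
  exec_ncomp : forall g1 g2, exec g1 -> exec g2 -> g1 (I1 R) = g2 (I0 R) ->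
    exec (ncomp g1 g2)
}.
Arguments us {R}.
Arguments states {R}.
Arguments exec {R}.

Record mpdmap (R : realType) (X Y : mpdspace R) := MPDMap {
  mfun :> X -> Y;
  mfun_continuous : continuous mfun;
  mfun_states : forall x, states X x -> states Y (mfun x);
  mfun_exec : forall g, exec X g -> exec Y (mfun \o g)
}.
Arguments mfun {R X Y}.

Lemma into_subtype_continuous (S T : topologicalType) (A : set T)
    (f : S -> set_type A) : continuous (val \o f) -> continuous f.
Proof. exact: continuous_comp_initial. Qed.

Lemma subtype_val_continuous (T : topologicalType) (A : set T) :
  continuous (val : set_type A -> T).
Proof. exact: initial_continuous. Qed.

Lemma unitI_ge0 (R : realType) (t : unitI R) : 0 <= val t.
Proof. by have := set_valP t; rewrite /= in_itv /= => /andP[]. Qed.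

Lemma unitI_le1 (R : realType) (t : unitI R) : val t <= 1.
Proof. by have := set_valP t; rewrite /= in_itv /= => /andP[]. Qed.

Lemma clampIK (R : realType) (x : R) : 0 <= x -> x <= 1 -> val (clampI x) = x.
Proof. by move=> x0 x1; rewrite /= min_r// max_r. Qed.

Lemma val_I0 (R : realType) : val (I0 R) = 0.
Proof. by rewrite clampIK. Qed.

Lemma val_I1 (R : realType) : val (I1 R) = 1.
Proof. by rewrite clampIK. Qed.

Lemma I1_neq_I0 (R : realType) : (I1 R == I0 R) = false.
Proof.
apply/eqP => /(congr1 val); rewrite val_I0 val_I1 => /eqP.
by rewrite oner_eq0.
Qed.

Lemma calM_I0 (R : realType) (phi : unitI R -> unitI R) :
  calM phi -> phi (I0 R) = I0 R.
Proof.
move=> [mphi /(_ (I0 R)) [s sE]]; apply: val_inj; apply/le_anti/andP; split.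
  by rewrite -[X in _ <= val X]sE; apply: mphi; rewrite val_I0 unitI_ge0.
by rewrite val_I0 unitI_ge0.
Qed.

Lemma calM_I1 (R : realType) (phi : unitI R -> unitI R) :
  calM phi -> phi (I1 R) = I1 R.
Proof.
move=> [mphi /(_ (I1 R)) [s sE]]; apply: val_inj; apply/le_anti/andP; split.
  by rewrite val_I1 unitI_le1.
by rewrite -[X in val X <= _]sE; apply: mphi; rewrite val_I1 unitI_le1.
Qed.

Lemma calM_comp (R : realType) (phi psi : unitI R -> unitI R) :
  calM phi -> calM psi -> calM (phi \o psi).
Proof.
move=> [mphi sphi] [mpsi spsi]; split=> [s t st|t].
  exact/mphi/mpsi.
by have [u <-] := sphi t; have [s <-] := spsi u; exists s.
Qed.

Lemma calM_continuous (R : realType) (phi : unitI R -> unitI R) :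
  calM phi -> continuous phi.
Proof.
move=> [mphi sphi]; apply: into_subtype_continuous => t.
have Ft : Filter (nbhs t) := nbhs_filter t.
apply/cvgrPdist_lt => e e0; have e20 : 0 < e / 2 by rewrite divr_gt0.
have cval := @subtype_val_continuous R (`[0%R, 1%R]%classic : set R) t.
have up : \forall s \near t, val (phi s) < val (phi t) + e.
  have [lt1|le1] := ltP (val (phi t) + e / 2) 1; last first.
    apply: filterE => s; apply: le_lt_trans (unitI_le1 _) _; apply: le_lt_trans le1 _.
    by rewrite ltrD2l gtr_pMr// invf_lt1// ltr1n.
  have [c cE] := sphi (clampI (val (phi t) + e / 2)).
  have vc : val (phi c) = val (phi t) + e / 2.
    by rewrite cE clampIK// ?ltW// ltr_wpDl// unitI_ge0.
  have tc : val t < val c.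
    rewrite ltNge; apply/negP => /mphi; rewrite vc.
    by rewrite gerDl leNgt e20.
  have : nbhs t [set s : unitI R | val s < val c].
    exact: (cval [set y | y < val c] (lt_nbhsl tc)).
  apply: filterS => s /ltW /mphi sc; apply: le_lt_trans sc _.
  by rewrite vc ltrD2l gtr_pMr// invf_lt1// ltr1n.
have down : \forall s \near t, val (phi t) - e < val (phi s).
  have [gt0|le0] := ltP 0 (val (phi t) - e / 2); last first.
    apply: filterE => s; apply: lt_le_trans _ (unitI_ge0 _); apply: lt_le_trans _ le0.
    by rewrite ltrD2l ltrN2 gtr_pMr// invf_lt1// ltr1n.
  have [c cE] := sphi (clampI (val (phi t) - e / 2)).
  have vc : val (phi c) = val (phi t) - e / 2.
    rewrite cE clampIK// ?ltW//; apply: lt_le_trans (unitI_le1 (phi t)).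
    by rewrite ltrBlDr ltrDl.
  have tc : val c < val t.
    rewrite ltNge; apply/negP => /mphi; rewrite vc.
    by rewrite lerBrDl gerDr leNgt e20.
  have : nbhs t [set s : unitI R | val c < val s].
    exact: (cval [set y | val c < y]
      (open_nbhs_nbhs (conj (@open_gt _ (val c)) tc))).
  apply: filterS => s /ltW /mphi sc; apply: lt_le_trans _ sc.
  by rewrite vc ltrD2l ltrN2 gtr_pMr// invf_lt1// ltr1n.
by apply: filterS2 up down => s us ds; rewrite /= distrC ltr_distl ds.
Qed.

Lemma kelley_map_continuous (R : realType) (S T : topologicalType) (f : S -> T) :
  continuous f -> continuous (f : kelley R S -> kelley R T).
Proof.
move=> cf; apply/continuousP => U; rewrite !kelley_openE => oU n p cp.
have := oU n (f \o p); apply => x.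
by apply: continuous_comp; [exact: cp|exact: cf].
Qed.

(** [0,1] is a retract of a simplex, so that the paths of [kelley R T] are those
    of [T]. *)
Lemma simplexI_subproof (R : realType) (t : unitI R) :
  (\row_(i < 2) (if i == ord0 then val t else 1 - val t) : 'rV[R]_2) \in
  ([set x : 'rV[R]_2 | (forall i, 0 <= x ord0 i) /\ \sum_i x ord0 i = 1]).
Proof.
rewrite inE /=; split=> [i|].
  by rewrite mxE; case: ifP => _; rewrite ?unitI_ge0// subr_ge0 unitI_le1.
by rewrite !big_ord_recl big_ord0 !mxE /= addr0 addrC subrK.
Qed.

Lemma kelley_path_continuous (R : realType) (T : topologicalType)
    (g : unitI R -> T) :
  continuous g -> continuous (g : unitI R -> kelley R T).
Proof.
move=> cg; apply/continuousP => U; rewrite kelley_openE => oU.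
pose s (t : unitI R) : stdsimplex R 1 := SigSub (simplexI_subproof t).
pose r (x : stdsimplex R 1) : unitI R := clampI ((val x : 'rV[R]_2) ord0 ord0).
have cclamp : continuous (@clampI R).
  apply: into_subtype_continuous => x.
  apply: (@continuous_max R R (cst 0) (fun y => Num.min 1 y)).
    exact: cvg_cst.
  by apply: (@continuous_min R R (cst 1) id); [exact: cvg_cst|exact: cvg_id].
have cr : continuous r.
  move=> x; apply: (@continuous_comp _ _ _
    (fun y : stdsimplex R 1 => (val y : 'rV[R]_2) ord0 ord0) (@clampI R)).
    apply: (@continuous_comp _ _ _ (val : stdsimplex R 1 -> 'rV[R]_2)
      (fun y : 'rV[R]_2 => y ord0 ord0)).
      exact: subtype_val_continuous.
    exact: coord_continuous.
  exact: cclamp.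
have cs : continuous s.
  apply: into_subtype_continuous.
  pose e (i : 'I_2) : 'rV[R]_2 := delta_mx ord0 i.
  have -> : val \o s = (fun t => e ord_max + val t *: (e ord0 - e ord_max)).
    apply/funext => t; apply/rowP => i; rewrite /= !mxE eqxx /=.
    by case: i => -[|[|//]] lti /=; rewrite ?(subr0, mulr1, add0r, sub0r, mulrN).
  move=> t; have Ft : Filter (nbhs t) := nbhs_filter t.
  apply: cvgD; first exact: cvg_cst.
  apply: (@cvgZr_tmp R 'rV[R]_2 (unitI R) _ Ft val (val t)).
  exact: subtype_val_continuous.
have rs t : r (s t) = t.
  have -> : r (s t) = clampI (val t) by rewrite /r /= mxE.
  by apply: val_inj; rewrite clampIK ?unitI_ge0 ?unitI_le1.
have -> : g @^-1` U = s @^-1` ((g \o r) @^-1` U).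
  by apply/seteqP; split=> t /=; rewrite rs.
move/continuousP: cs; apply; apply: oU => x.
by apply: continuous_comp; [exact: cr|exact: cg].
Qed.


Section Globe.
Variables (R : realType) (Z : topologicalType).

(** [false] is the state 0, [true] is the state 1. The product [Z * [0,1]] is
    taken in Top, whence the kelleyfication. *)
Definition preglobe : topologicalType :=
  topsum bool (kelley R (Z * unitI R)%type).

Definition preglobe_state (b : bool) : preglobe := existT _ true b.
Definition preglobe_pt (z : Z) (t : unitI R) : preglobe := existT _ false (z, t).

(** The identifications (z,0) = 0 and (z,1) = 1 are the kernel of [collapse]. *)
Definition collapse (x : preglobe) : preglobe :=
  match x with
  | existT true b => preglobe_state b
  | existT false (z, t) =>
      if t == I0 R then preglobe_state false
      else if t == I1 R then preglobe_state true
      else preglobe_pt z t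
  end.

Definition globe_rel : rel preglobe := fun x y => collapse x == collapse y.

Lemma globe_rel_refl : reflexive globe_rel.
Proof. by move=> x; exact: eqxx. Qed.

Lemma globe_rel_sym : symmetric globe_rel.
Proof. by move=> x y; exact: eq_sym. Qed.

Lemma globe_rel_trans : transitive globe_rel.
Proof. by move=> y x z /eqP xy /eqP yz; apply/eqP; rewrite xy. Qed.

Definition globe_equiv :=
  EquivRel globe_rel globe_rel_refl globe_rel_sym globe_rel_trans.

Definition globe_us : topologicalType :=
  quotient_topology {eq_quot globe_equiv}.

Definition globe_pi (x : preglobe) : globe_us := \pi_({eq_quot globe_equiv}) x.

Definition globe_state (b : bool) : globe_us := globe_pi (preglobe_state b).
Definition globe_pt (z : Z) (t : unitI R) : globe_us := globe_pi (preglobe_pt z t).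

Definition globe_exec : set (unitI R -> globe_us) :=
  [set g | exists z phi, calM phi /\ g = (fun t => globe_pt z (phi t))].

Lemma globe_piE (x y : preglobe) : globe_pi x = globe_pi y <-> globe_rel x y.
Proof. by split=> [/eqmodP|h]; last exact/eqmodP. Qed.

Lemma globe_pi_continuous : continuous globe_pi.
Proof. exact: pi_continuous. Qed.

Lemma globe_pt_I0 (z : Z) : globe_pt z (I0 R) = globe_state false.
Proof. by apply/globe_piE; rewrite /globe_rel /= eqxx. Qed.

Lemma globe_pt_I1 (z : Z) : globe_pt z (I1 R) = globe_state true.
Proof. by apply/globe_piE; rewrite /globe_rel /= I1_neq_I0 eqxx. Qed.

Lemma globe_state_inj : globe_state true <> globe_state false.
Proof.
move/globe_piE => /eqP /(congr1 (fun x : preglobe =>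
  match x with existT true b => b | _ => false end)) //.
Qed.

Lemma globe_exec_continuous (g : unitI R -> globe_us) :
  globe_exec g -> continuous g.
Proof.
move=> [z [phi [Mphi ->]]] t.
apply: (@continuous_comp _ _ _ (fun t => preglobe_pt z (phi t)) globe_pi);
  last exact: globe_pi_continuous.
have ck : continuous (fun t => (z, phi t) : kelley R (Z * unitI R)%type).
  apply: kelley_path_continuous => u.
  have Fu : Filter (nbhs u) := nbhs_filter u.
  have cz : (fun=> z) @ u --> z by exact: cvg_cst.
  exact: (cvg_pair cz (calM_continuous Mphi (x := u))).
apply: (@continuous_comp _ _ _ (fun t => (z, phi t) : kelley R (Z * unitI R)%type)
  (existT (fun b : bool => if b then (bool : topologicalType)
     else (kelley R (Z * unitI R)%type : topologicalType)) false)).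
  exact: ck.
exact: existT_continuous.
Qed.

Lemma globe_exec_states (g : unitI R -> globe_us) :
  globe_exec g -> range globe_state (g (I0 R)) /\ range globe_state (g (I1 R)).
Proof.
move=> [z [phi [Mphi ->]]]; rewrite calM_I0// calM_I1// globe_pt_I0 globe_pt_I1.
by split; [exists false|exists true].
Qed.

Lemma globe_exec_reparam (g : unitI R -> globe_us) (phi : unitI R -> unitI R) :
  globe_exec g -> calM phi -> globe_exec (g \o phi).
Proof.
move=> [z [psi [Mpsi ->]]] Mphi; exists z, (psi \o phi).
by split; first exact: calM_comp.
Qed.

(** No two execution paths of a globe are composable. *)
Lemma globe_exec_ncomp (g1 g2 : unitI R -> globe_us) :
  globe_exec g1 -> globe_exec g2 -> g1 (I1 R) = g2 (I0 R) ->
  globe_exec (ncomp g1 g2).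
Proof.
move=> [z1 [phi1 [M1 ->]]] [z2 [phi2 [M2 ->]]].
by rewrite calM_I0// calM_I1// globe_pt_I0 globe_pt_I1 => /globe_state_inj.
Qed.

Definition globe : mpdspace R :=
  MPDSpace globe_exec_continuous globe_exec_states globe_exec_reparam
    globe_exec_ncomp.

End Globe.

Section GlobeMap.
Variables (R : realType) (Z Z' : topologicalType) (f : Z -> Z').
Hypothesis cf : continuous f.

Definition preglobe_map (x : preglobe R Z) : preglobe R Z' :=
  match x with
  | existT true b => preglobe_state R Z' b
  | existT false zt => preglobe_pt (f (zt : Z * unitI R).1) zt.2
  end.

Definition globe_map_fun (x : globe R Z) : globe R Z' :=
  globe_pi (preglobe_map (repr (x : {eq_quot globe_equiv R Z}))).

Lemma collapse_preglobe_map (x : preglobe R Z) :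
  collapse (preglobe_map x) = collapse (preglobe_map (collapse x)).
Proof.
case: x => -[b|[z t]] //=; case: eqP => [//|/eqP/negbTE t0].
by case: eqP => [//|/eqP/negbTE t1] /=; rewrite t0 t1.
Qed.

Lemma globe_map_funE (x : preglobe R Z) :
  globe_map_fun (globe_pi x) = globe_pi (preglobe_map x).
Proof.
rewrite /globe_map_fun; set y := repr _.
have /globe_piE/eqP xy : globe_pi y = globe_pi x by exact: reprK.
by apply/globe_piE/eqP; rewrite collapse_preglobe_map xy -collapse_preglobe_map.
Qed.

Lemma preglobe_map_continuous : continuous preglobe_map.
Proof.
move=> [[b|[z t]]] A nA.
  by move: nA; rewrite /= /nbhs /= !sigT_nbhsE.
have ck : continuous (fun zt : Z * unitI R => (f zt.1, zt.2) : Z' * unitI R).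
  move=> [z0 t0]; have Fz : Filter (nbhs (z0, t0)) := nbhs_filter (z0, t0).
  have c1 : (fun zt : Z * unitI R => f zt.1) @ (z0, t0) --> f z0.
    by move=> B /(cf (x := z0)) nB; exact: (@cvg_fst _ _ (nbhs z0) (nbhs t0) _ _ nB).
  have c2 : (fun zt : Z * unitI R => zt.2) @ (z0, t0) --> t0 by exact: cvg_snd.
  exact: (cvg_pair c1 c2).
exact: (@kelley_map_continuous R _ _ _ ck (z, t)
  ((fun x => existT _ false x : preglobe R Z') @^-1` A) nA).
Qed.

Lemma globe_map_continuous : continuous globe_map_fun.
Proof.
apply/quotient_continuous => x.
rewrite (_ : _ \o _ = @globe_pi R Z' \o preglobe_map); last first.
  by apply/funext => y; exact: globe_map_funE.
apply: continuous_comp; first exact: preglobe_map_continuous.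
exact: globe_pi_continuous.
Qed.

Lemma globe_map_states (x : globe R Z) :
  states (globe R Z) x -> states (globe R Z') (globe_map_fun x).
Proof. by move=> [b _ <-]; exists b => //; rewrite globe_map_funE. Qed.

Lemma globe_map_exec (g : unitI R -> globe R Z) :
  exec (globe R Z) g -> exec (globe R Z') (globe_map_fun \o g).
Proof.
move=> [z [phi [Mphi ->]]]; exists (f z), phi; split=> //.
by apply/funext => t; rewrite /= globe_map_funE.
Qed.

Definition globe_map : mpdmap (globe R Z) (globe R Z') :=
  MPDMap globe_map_continuous globe_map_states globe_map_exec.

End GlobeMap.

Definition disk_set (R : realType) (n : nat) : set 'rV[R]_n :=
  [set x | \sum_i x ord0 i ^+ 2 <= 1].

Definition sphere_set (R : realType) (n : nat) : set 'rV[R]_n :=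
  [set x | \sum_i x ord0 i ^+ 2 = 1].

Definition disk (R : realType) (n : nat) : topologicalType :=
  set_type (@disk_set R n).

(** [bsphere R n] is the sphere of dimension n - 1; it is empty for [n = 0]. *)
Definition bsphere (R : realType) (n : nat) : topologicalType :=
  set_type (@sphere_set R n).

Lemma sphere_sub_disk (R : realType) (n : nat) (x : bsphere R n) :
  val x \in @disk_set R n.
Proof. by have := set_valP x; rewrite inE /disk_set /sphere_set /= => ->. Qed.

Definition sphere_incl (R : realType) (n : nat) (x : bsphere R n) : disk R n :=
  SigSub (sphere_sub_disk x).

Lemma sphere_incl_continuous (R : realType) (n : nat) :
  continuous (@sphere_incl R n).
Proof.
by apply: into_subtype_continuous; exact: subtype_val_continuous.
Qed.

Definition globe_incl (R : realType) (n : nat) :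
    mpdmap (globe R (bsphere R n)) (globe R (disk R n)) :=
  globe_map R (@sphere_incl_continuous R n).

Definition is_pushout (R : realType) (c : top_choice) (S D A B : mpdspace R)
    (i : mpdmap S D) (g : mpdmap S A) (h : mpdmap D B) (j : mpdmap A B) : Prop :=
  (forall x, h (i x) = j (g x)) /\
  forall (Z : mpdspace R), in_Top R c Z ->
  forall (u : mpdmap D Z) (v : mpdmap A Z), (forall x, u (i x) = v (g x)) ->
  exists w : mpdmap B Z,
    [/\ forall x, w (h x) = u x, forall x, w (j x) = v x &
        forall w' : mpdmap B Z, (forall x, w' (h x) = u x) ->
          (forall x, w' (j x) = v x) -> w' =1 w].

Record diagram (R : realType) (d : Order.disp_t) (L : orderType d) := Diagram {
  dobj :> L -> mpdspace R;
  dmap : forall i j : L, (i <= j)%O -> mpdmap (dobj i) (dobj j);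
  dmap_id : forall i (ii : (i <= i)%O), dmap ii =1 id;
  dmap_comp : forall i j k (ij : (i <= j)%O) (jk : (j <= k)%O) (ik : (i <= k)%O),
    dmap jk \o dmap ij =1 dmap ik
}.
Arguments dmap {R d L} _ {i j}.

Section Colimit.
Variables (R : realType) (c : top_choice) (d : Order.disp_t) (L : orderType d).
Variables (F : diagram R L) (P : set L).

Definition is_cocone (X : mpdspace R) (l : forall i, P i -> mpdmap (F i) X) :=
  forall i j (Pi : P i) (Pj : P j) (ij : (i <= j)%O) x,
    l j Pj (dmap F ij x) = l i Pi x.

(** [l] exhibits [X] as the colimit of the restriction of [F] to [P]. *)
Definition is_colimit (X : mpdspace R) (l : forall i, P i -> mpdmap (F i) X) :=
  is_cocone l /\
  forall (Z : mpdspace R), in_Top R c Z ->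
  forall k : (forall i, P i -> mpdmap (F i) Z), is_cocone k ->
  exists w : mpdmap X Z,
    (forall i (Pi : P i) x, w (l i Pi x) = k i Pi x) /\
    forall w' : mpdmap X Z, (forall i (Pi : P i) x, w' (l i Pi x) = k i Pi x) ->
      w' =1 w.

End Colimit.

Definition is_succ (d : Order.disp_t) (L : orderType d) (i j : L) : Prop :=
  (i < j)%O /\ forall k : L, (i < k)%O -> (j <= k)%O.

Definition is_limit (d : Order.disp_t) (L : orderType d) (i : L) : Prop :=
  (exists j : L, (j < i)%O) /\
  forall j : L, (j < i)%O -> exists2 k : L, (j < k)%O & (k < i)%O.

Record attachment (R : realType) (c : top_choice) (A B : mpdspace R)
    (j : mpdmap A B) := Attachment {
  att_dim : nat;
  att_map : mpdmap (globe R (bsphere R att_dim)) A;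
  att_hat : mpdmap (globe R (disk R att_dim)) B;
  att_pushout : is_pushout c (globe_incl R att_dim) att_map att_hat j
}.

(** The ordinal is a nonempty well-ordered type [cd_index], whose elements are
    the ordinals below it. It need not be a limit ordinal: with k + 1 elements
    exactly k cells are attached. Preservation of colimits is required for
    nonempty colimits only, [cd_bot] being sent to the set of states. *)
Record cellular_decomposition (R : realType) (c : top_choice) (X : mpdspace R) :=
  CellularDecomposition {
  cd_disp : Order.disp_t;
  cd_index : orderType cd_disp;
  cd_wf : well_founded (fun i j : cd_index => (i < j)%O);
  cd_bot : cd_index;
  cd_bot_le : forall i : cd_index, (cd_bot <= i)%O;
  cd_diag :> diagram R cd_index;
  cd_in_Top : forall i, in_Top R c (cd_diag i);
  cd_limit : forall i : cd_index, is_limit i ->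
    @is_colimit R c _ _ cd_diag [set k | (k < i)%O] (cd_diag i)
      (fun k (ki : (k < i)%O) => dmap cd_diag (ltW ki));
  cd_leg : forall i, mpdmap (cd_diag i) X;
  cd_colimit : @is_colimit R c _ _ cd_diag setT X (fun i _ => cd_leg i);
  cd_bot_states : states (cd_diag cd_bot) = setT;
  cd_bot_exec : exec (cd_diag cd_bot) = set0;
  cd_bot_discrete : forall A : set (cd_diag cd_bot), open A;
  cd_bot_bij : set_bij setT (states X) (cd_leg cd_bot);
  cd_attach : forall (i j : cd_index) (ij : is_succ i j),
    attachment c (dmap cd_diag (ltW ij.1))
}.
Arguments cd_leg {R c X}.
Arguments cd_attach {R c X} _ {i j}.

Definition cellular (R : realType) (c : top_choice) (X : mpdspace R) : Prop :=
  inhabited (cellular_decomposition c X).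

Section Cells.
Variables (R : realType) (c : top_choice) (X : mpdspace R).
Variable D : cellular_decomposition c X.

Definition attaching (i j : cd_index D) (ij : is_succ i j)
    (x : globe R (disk R (att_dim (cd_attach D ij)))) : X :=
  cd_leg D j (att_hat (cd_attach D ij) x).

Inductive cell : Type :=
| Vertex (a : X) of states X a
| GlobularCell (i j : cd_index D) of is_succ i j.

Definition cell_set (e : cell) : set X :=
  match e with
  | Vertex a _ => [set a]
  | GlobularCell i j ij =>
      @attaching i j ij @` (~` range (globe_incl R (att_dim (cd_attach D ij))))
  end.

Definition cell_init (e : cell) : X :=
  match e with
  | Vertex a _ => a
  | GlobularCell i j ij => @attaching i j ij (globe_state R _ false)
  end.

Definition cell_final (e : cell) : X :=
  match e with
  | Vertex a _ => a
  | GlobularCell i j ij => @attaching i j ij (globe_state R _ true)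
  end.

(** The initial and final states of the unique cell containing [x]; the default
    value of [xget] is never used. *)
Definition point_init (x : X) : X :=
  xget x [set a | exists2 e, cell_set e x & a = cell_init e].

Definition point_final (x : X) : X :=
  xget x [set a | exists2 e, cell_set e x & a = cell_final e].

End Cells.

Record globular_subdivision (R : realType) (c : top_choice) (X Y : mpdspace R) :=
  GlobularSubdivision {
  gs_map :> mpdmap X Y;
  gs_inv : Y -> X;
  gs_mapK : cancel gs_map gs_inv;
  gs_invK : cancel gs_inv gs_map;
  gs_inv_continuous : continuous gs_inv;
  gs_cellular_source : cellular c X;
  gs_cellular_target : cellular c Y
}.

(** The connection maps, computed with a cellular decomposition of [X]. *)
Definition conn_minus (R : realType) (c : top_choice) (X Y : mpdspace R)
    (f : globular_subdivision c X Y) (D : cellular_decomposition c X) (a : Y) : X :=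
  point_init D (gs_inv f a).

Definition conn_plus (R : realType) (c : top_choice) (X Y : mpdspace R)
    (f : globular_subdivision c X Y) (D : cellular_decomposition c X) (a : Y) : X :=
  point_final D (gs_inv f a).

Section DirectedPaths.
Variables (R : realType) (X : mpdspace R).

(** Moore paths of length [l] are represented by functions on [R], of which only
    the restriction to [0, l] is meaningful. *)
Definition moore_comp (l : R) (p q : R -> X) : R -> X :=
  fun t => if t <= l then p t else q (t - l).

Definition mu (l : R) (t : R) : unitI R := clampI (t / l).

Inductive moore_dpath : R -> (R -> X) -> Prop :=
| MooreExec l g phi : 0 < l -> exec X g -> calI phi ->
    moore_dpath l (g \o phi \o mu l)
| MooreComp l1 l2 p1 p2 : moore_dpath l1 p1 -> moore_dpath l2 p2 ->
    p1 l1 = p2 0 -> moore_dpath (l1 + l2) (moore_comp l1 p1 p2).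

Definition dpath (g : unitI R -> X) : Prop :=
  (exists x, g = cst x) \/
  exists2 p, moore_dpath 1 p & forall t : unitI R, g t = p (val t).

Definition dpath_set (u v : X) : set {compact-open, unitI R -> X} :=
  [set g | [/\ dpath g, g (I0 R) = u & g (I1 R) = v]].

Definition dpath_space (u v : X) : topologicalType :=
  kelley R (set_type (dpath_set u v)).

Definition dpath_fun (u v : X) (g : dpath_space u v) : unitI R -> X :=
  val (g : set_type (dpath_set u v)).

Definition reparam (u v : X) (g h : dpath_space u v) : Prop :=
  exists2 phi, calM phi & dpath_fun h = dpath_fun g \o phi.

Definition trace_rel (u v : X) : rel (dpath_space u v) :=
  fun g h => `[< clos_refl_sym_trans _ (@reparam u v) g h >].

Lemma trace_rel_refl (u v : X) : reflexive (@trace_rel u v).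
Proof. by move=> g; apply/asboolP; exact: rst_refl. Qed.

Lemma trace_rel_sym (u v : X) : symmetric (@trace_rel u v).
Proof.
by move=> g h; apply/idP/idP => /asboolP gh; apply/asboolP; exact: rst_sym.
Qed.

Lemma trace_rel_trans (u v : X) : transitive (@trace_rel u v).
Proof.
move=> h g k /asboolP gh /asboolP hk; apply/asboolP.
exact: (@rst_trans _ _ g h k).
Qed.

Definition trace_equiv (u v : X) :=
  EquivRel (@trace_rel u v) (@trace_rel_refl u v) (@trace_rel_sym u v)
    (@trace_rel_trans u v).

Definition trace_space (u v : X) : topologicalType :=
  quotient_topology {eq_quot (trace_equiv u v)}.

Definition trace (u v : X) (g : dpath_space u v) : trace_space u v :=
  \pi_({eq_quot (trace_equiv u v)}) g.

End DirectedPaths.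

Definition avoids (R : realType) (c : top_choice) (X Y : mpdspace R)
    (f : globular_subdivision c X Y) (a b : Y) (g : dpath_space a b) : Prop :=
  range (dpath_fun g) `<=` ~` (f @` states X).

Definition is_tau (R : realType) (c : top_choice) (X Y : mpdspace R)
    (f : globular_subdivision c X Y) (a b : Y) (tau : trace_space a b) : Prop :=
  (exists g : dpath_space a b, avoids f g) /\
  forall g : dpath_space a b, avoids f g -> trace g = tau.

(* Main.v *)
(* Every execution path of a cellular X is a concatenation of reparametrized arcs,
   an arc being the execution path [t |-> (z, t)] of a globular cell over an
   interior point z of the disk, and X is as a set the disjoint union of its
   states and of its open arcs. Both facts come from the universal properties:
   sub-objects generated by the cells are everything, and continuous functions
   extend from one stage to the next ones, radially over each disk. The latter
   also shows that X is Hausdorff with a closed set of states. A directed path at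
   an interior point of an arc is therefore bound to follow this arc to its end.
   In particular an arc of the subdivision Y lies on an arc of X, so that X and Y
   have the same directed paths.

   Hence a directed path from a to b either avoids the states of X, and then it is
   a reparametrization of a segment of one arc; or it runs along the arc of a to
   a^+, then from a^+ to b^-, then along the arc of b, and replacing the two ends
   by pauses is inverse, up to reparametrization, to adding them. The first case
   is a clopen condition, because the states are closed and a segment is compact.
   Truncation is continuous for the compact-open topology. *)

Require Import Defs.
From Stdlib Require Import Relation_Operators.
From mathcomp Require Import all_boot all_order all_algebra generic_quotient.
From mathcomp Require Import all_classical reals topology normedtype.
From mathcomp Require Import realfun derive ring lra.
Import numFieldNormedType.Exports.
Import Order.TTheory GRing.Theory Num.Theory.
Set Implicit Arguments.
Unset Strict Implicit.
Unset Printing Implicit Defensive.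

Local Open Scope classical_set_scope.
Local Open Scope ring_scope.
Local Open Scope quotient_scope.

(** * Kelleyfication and continuity *)

(** Pushouts and colimits are given only by a universal property against objects of Top, which says
    nothing directly about points, topology or execution paths. Every fact about a cellular space is
    therefore obtained by mapping it to a test object: a kelleyfied subset with fewer execution
    paths, or the real line with all points as states and all continuous paths as execution paths.

    On the side of paths, the obstacle is that the first meeting time with the states does not
    depend continuously on the path. Truncation keeps the parametrization and freezes the part
    removed, so that a jump of this time is harmless when the path rests in between. The two maps
    between path spaces become inverse to each other only on traces.

    What concerns the end point b is deduced from the case of a by reversing time. Reversed paths
    are not directed, so the lemmas used on both sides speak of families of arcs and not of
    execution paths. The splitting takes place inside X; Y enters at the end, through a
    homeomorphism of trace spaces. *)

Section Kelley.
Variable R : realType.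
Implicit Types S T : topologicalType.

Lemma kelley_id_continuous T : continuous (id : kelley R T -> T).
Proof.
apply/continuousP => U oU; rewrite kelley_openE => n p cp.
by move/continuousP: cp; apply.
Qed.

Lemma kelley_simplex_continuous T n (p : stdsimplex R n -> T) :
  continuous p -> continuous (p : stdsimplex R n -> kelley R T).
Proof. by move=> cp; apply/continuousP => U; rewrite kelley_openE => oU; exact: oU. Qed.

Lemma delta_generated_kelley T : delta_generated R (kelley R T).
Proof.
move=> U oU; rewrite kelley_openE => n p cp; apply: oU.
exact: kelley_simplex_continuous.
Qed.

Lemma delta_generated_continuous S T (f : S -> T) : delta_generated R S ->
  (forall n (p : stdsimplex R n -> S), continuous p -> continuous (f \o p)) ->
  continuous f.
Proof.
move=> dS fp; apply/continuousP => U oU; apply: dS => n p cp.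
by have /continuousP := fp n p cp; apply.
Qed.

Lemma continuous_to_kelley S T (f : S -> T) : delta_generated R S ->
  continuous f -> continuous (f : S -> kelley R T).
Proof.
move=> dS cf; apply: delta_generated_continuous => // n p cp.
apply: kelley_simplex_continuous => x.
by apply: continuous_comp; [exact: cp|exact: cf].
Qed.

Lemma delta_Hausdorff_inj S T (f : S -> T) : injective f -> continuous f ->
  delta_Hausdorff R T -> delta_Hausdorff R S.
Proof.
move=> fi cf hT p cp.
have -> : range p = f @^-1` (range (f \o p)).
  apply/seteqP; split=> [_ [t _ <-]|x [t _ /fi <-]]; last by exists t.
  by exists t.
apply: preimage_closed; first by move=> x _; exact: cf.
by apply: hT => x; apply: continuous_comp; [exact: cp|exact: cf].
Qed.

(** Delta-Hausdorffness is pulled back along an injection and Delta-generation is restored by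
    kelleyfication, so that both choices of Top are treated at once. This keeps sub-objects in
    Top. *)
Lemma in_Top_kelley_inj c S T (f : S -> T) : injective f -> continuous f ->
  in_Top R c T -> in_Top R c (kelley R S).
Proof.
case: c => fi cf; first by move=> _; exact: delta_generated_kelley.
move=> [_ hT]; split; first exact: delta_generated_kelley.
apply: (@delta_Hausdorff_inj (kelley R S) T f) => // x.
by apply: (@continuous_comp (kelley R S) S T id f); [exact: kelley_id_continuous|exact: cf].
Qed.

Lemma clampI_continuous : continuous (@clampI R).
Proof.
apply: into_subtype_continuous => x.
apply: (@continuous_max R R (cst 0) (fun y => Num.min 1 y)).
  exact: cvg_cst.
by apply: (@continuous_min R R (cst 1) id); [exact: cvg_cst|exact: cvg_id].
Qed.

Lemma clampI_val (t : unitI R) : clampI (val t) = t.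
Proof. by apply: val_inj; rewrite clampIK ?unitI_ge0 ?unitI_le1. Qed.

Lemma unitI_compact : compact [set: unitI R].
Proof.
have -> : [set: unitI R] = @clampI R @` `[0, 1]%classic.
  apply/seteqP; split=> // t _; exists (val t); last exact: clampI_val.
  by rewrite /= in_itv /= unitI_ge0 unitI_le1.
apply: continuous_compact; last exact: segment_compact.
by apply: continuous_subspaceT; exact: clampI_continuous.
Qed.

Lemma hausdorff_delta_Hausdorff T : hausdorff_space T -> delta_Hausdorff R T.
Proof.
move=> hT p cp; apply: compact_closed => //; apply: continuous_compact.
  exact: continuous_subspaceT.
exact: unitI_compact.
Qed.

Lemma in_Top_kelley_hausdorff c T : hausdorff_space T -> in_Top R c (kelley R T).
Proof.
move=> hT; case: c => /=; first exact: delta_generated_kelley.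
split; first exact: delta_generated_kelley.
apply: (@delta_Hausdorff_inj (kelley R T) T id) => //; first exact: kelley_id_continuous.
exact: hausdorff_delta_Hausdorff.
Qed.

Lemma in_Top_delta_generated c T : in_Top R c T -> delta_generated R T.
Proof. by case: c => // -[]. Qed.

(** Openness in a globe is tested on the two summands of the preglobe: one is discrete, and the
    other is itself a kelleyfication, whose open sets are tested on simplices. *)
Lemma globe_to_kelley (Z : topologicalType) T (f : globe R Z -> T) :
  continuous f -> continuous (f : globe R Z -> kelley R T).
Proof.
move=> cf; apply/continuousP => U oU.
have cfp : continuous (f \o @globe_pi R Z).
  by move=> x; apply: continuous_comp; [exact: globe_pi_continuous|exact: cf].
apply/(@sigT_openP bool (fun b => if b then bool : topologicalType else kelley R (Z * unitI R)%type)).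
case=> /=; first exact: discrete_open.
rewrite kelley_openE => n p cp.
have : continuous (fun x => f (globe_pi (existT _ false (p x) : preglobe R Z))).
  move=> x; apply: (@continuous_comp _ _ _ (fun x => (existT _ false (p x) : preglobe R Z)) (f \o @globe_pi R Z)); last exact: cfp.
  apply: (@continuous_comp _ (kelley R (Z * unitI R)%type) _ p (fun y => (existT _ false y : preglobe R Z))).
    exact: kelley_simplex_continuous.
  exact: (@existT_continuous _ (fun b : bool => if b then (bool : topologicalType) else kelley R (Z * unitI R)%type) false).
by move=> /kelley_simplex_continuous/continuousP/(_ U oU).
Qed.

Lemma continuous_closed S T (f : S -> T) (D : set T) :
  continuous f -> closed D -> closed (f @^-1` D).
Proof. by move=> cf; apply: preimage_closed => x _; exact: cf. Qed.

Lemma unitI_val_continuous : continuous (val : unitI R -> R).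
Proof. exact: subtype_val_continuous. Qed.

End Kelley.

Lemma continuous_glue (R : realType) (S T : topologicalType) (v : S -> R) (m : R)
    (f f1 f2 : S -> T) : continuous v -> continuous f1 -> continuous f2 ->
  (forall x, v x <= m -> f x = f1 x) -> (forall x, m <= v x -> f x = f2 x) ->
  continuous f.
Proof.
move=> cv c1 c2 E1 E2.
pose A := [set x | v x <= m]; pose B := [set x | m <= v x].
have cA : closed A := continuous_closed cv (@closed_le R m).
have cB : closed B := continuous_closed cv (@closed_ge R m).
have cA' : {within A, continuous f}.
  apply: (@subspace_eq_continuous S A T f1 f) => [x|]; first by rewrite inE => /E1.
  exact: continuous_subspaceT.
have cB' : {within B, continuous f}.
  apply: (@subspace_eq_continuous S B T f2 f) => [x|]; first by rewrite inE => /E2.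
  exact: continuous_subspaceT.
have := withinU_continuous cA cB cA' cB'.
rewrite (_ : A `|` B = setT); first by rewrite continuous_subspace_setT.
by apply/seteqP; split=> // x _; have [?|/ltW ?] := leP (v x) m; [left|right].
Qed.

Section RealContinuity.
Variables (R : realType) (T : topologicalType).
Implicit Types f g : T -> R.

Lemma contC (c : R) : continuous (fun _ : T => c).
Proof. by move=> x; exact: cvg_cst. Qed.

Lemma contD f g : continuous f -> continuous g -> continuous (fun x => f x + g x).
Proof. by move=> cf cg x; have Fx : Filter (nbhs x) := nbhs_filter x; apply: cvgD; [exact: cf|exact: cg]. Qed.

Lemma contB f g : continuous f -> continuous g -> continuous (fun x => f x - g x).
Proof. by move=> cf cg x; have Fx : Filter (nbhs x) := nbhs_filter x; apply: cvgB; [exact: cf|exact: cg]. Qed.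

Lemma contM f g : continuous f -> continuous g -> continuous (fun x => f x * g x).
Proof. by move=> cf cg x; have Fx : Filter (nbhs x) := nbhs_filter x; apply: cvgM; [exact: cf|exact: cg]. Qed.

Lemma contmax f g : continuous f -> continuous g ->
  continuous (fun x => Num.max (f x) (g x)).
Proof. by move=> cf cg x; apply: (@continuous_max R T f g); [exact: cf|exact: cg]. Qed.

Lemma contmin f g : continuous f -> continuous g ->
  continuous (fun x => Num.min (f x) (g x)).
Proof. by move=> cf cg x; apply: (@continuous_min R T f g); [exact: cf|exact: cg]. Qed.

Lemma contsum (I : Type) (s : seq I) (f : I -> T -> R) :
  (forall i, continuous (f i)) -> continuous (fun x => \sum_(i <- s) f i x).
Proof.
move=> cf; elim: s => [|i s IHs].
  by rewrite (_ : (fun _ => _) = fun=> 0); [exact: contC|apply/funext => x; rewrite big_nil].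
rewrite (_ : (fun _ => _) = fun x => f i x + \sum_(i <- s) f i x).
  exact: contD.
by apply/funext => x; rewrite big_cons.
Qed.

End RealContinuity.

Lemma contcomp (S T U : topologicalType) (f : S -> T) (g : T -> U) :
  continuous f -> continuous g -> continuous (fun x => g (f x)).
Proof. by move=> cf cg x; apply: continuous_comp; [exact: cf|exact: cg]. Qed.

Lemma contpair (S T U : topologicalType) (f : S -> T) (g : S -> U) :
  continuous f -> continuous g -> continuous (fun x => (f x, g x)).
Proof.
move=> cf cg x; have Fx : Filter (nbhs x) := nbhs_filter x.
exact: (cvg_pair (cf x) (cg x)).
Qed.

Lemma contfst (S T : topologicalType) : continuous (fst : S * T -> S).
Proof. by move=> [x y]; exact: cvg_fst. Qed.

Lemma contsnd (S T : topologicalType) : continuous (snd : S * T -> T).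
Proof. by move=> [x y]; exact: cvg_snd. Qed.

(** * Consequences of the universal properties *)

(** Equivalent to being Delta-generated, as the identity map shows, but in the form needed to map
    into kelleyfied test objects. For a globe this form is checked directly. *)
Definition lifts_to_kelley (R : realType) (S : topologicalType) :=
  forall (T : topologicalType) (f : S -> T), continuous f ->
    continuous (f : S -> kelley R T).

Lemma ncomp_comp (R : realType) (S T : Type) (f : S -> T) (g1 g2 : unitI R -> S) :
  f \o ncomp g1 g2 = ncomp (f \o g1) (f \o g2).
Proof. by apply/funext => t; rewrite /ncomp /=; case: ifP. Qed.

Definition mpd_id (R : realType) (B : mpdspace R) : mpdmap B B.
Proof. by refine (@MPDMap R B B id _ _ _) => // x. Defined.

Definition mpd_comp (R : realType) (A C D : mpdspace R) (g : mpdmap C D)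
    (f : mpdmap A C) : mpdmap A D.
Proof.
refine (@MPDMap R A D (g \o f) _ _ _).
- by move=> x; apply: continuous_comp; exact: mfun_continuous.
- by move=> x /(mfun_states f) /(mfun_states g).
- by move=> p /(mfun_exec f) /(mfun_exec g).
Defined.

Lemma ncomp_continuous (R : realType) (T : topologicalType) (g1 g2 : unitI R -> T) :
  continuous g1 -> continuous g2 -> g1 (I1 R) = g2 (I0 R) ->
  continuous (ncomp g1 g2).
Proof.
move=> c1 c2 g12; have cv := @unitI_val_continuous R.
have c2v : continuous (fun t : unitI R => 2 * val t) by apply: contM => //; exact: contC.
have c2v1 : continuous (fun t : unitI R => 2 * val t - 1) by apply: contB => //; exact: contC.
apply: (continuous_glue cv (contcomp (contcomp c2v (@clampI_continuous R)) c1)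
  (contcomp (contcomp c2v1 (@clampI_continuous R)) c2) (m := 2^-1)) => t t2.
  by rewrite /ncomp t2.
rewrite /ncomp; case: ifPn => // t2'.
have -> : val t = 2^-1 by apply/le_anti/andP.
by rewrite mulfV ?pnatr_eq0// subrr -/(I0 R) -/(I1 R).
Qed.

Section SubObject.
Variables (R : realType) (B : mpdspace R) (S : set B) (Q : set (unitI R -> B)).
Hypothesis Qexec : Q `<=` exec B.
Hypothesis Qreparam : forall g phi, Q g -> calM phi -> Q (g \o phi).
Hypothesis Qncomp : forall g1 g2, Q g1 -> Q g2 -> g1 (I1 R) = g2 (I0 R) ->
  Q (ncomp g1 g2).

Let Z : topologicalType := kelley R (set_type S).
Let vl (z : Z) : B := val (z : set_type S).

Let vl_continuous : continuous vl.
Proof.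
move=> x; apply: (@continuous_comp Z (set_type S) B id val).
  exact: kelley_id_continuous.
exact: subtype_val_continuous.
Qed.

(** The subspace topology is kelleyfied to stay in Top; this does not change which paths are
    continuous. *)
Definition sub_object : mpdspace R.
Proof.
refine (@MPDSpace R Z [set z | states B (vl z)] [set g : unitI R -> Z | Q (vl \o g)] _ _ _ _).
- move=> g /Qexec/exec_continuous cg; apply: kelley_path_continuous.
  exact: into_subtype_continuous.
- by move=> g /Qexec/exec_states.
- by move=> g phi Qg Mphi; exact: (Qreparam Qg Mphi).
- by move=> g1 g2 Q1 Q2 /(congr1 vl) g12; rewrite /= ncomp_comp; exact: Qncomp.
Defined.

Definition sub_object_val : mpdmap sub_object B.
Proof. by refine (@MPDMap R sub_object B vl _ _ _) => // g /Qexec. Defined.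

Lemma sub_object_in_Top c : in_Top R c B -> in_Top R c sub_object.
Proof.
apply: (@in_Top_kelley_inj R c (set_type S) B val); first exact: val_inj.
exact: subtype_val_continuous.
Qed.

Lemma sub_object_lift (A : mpdspace R) (u : mpdmap A B) : lifts_to_kelley R A ->
  (forall x, S (u x)) -> (forall g, exec A g -> Q (u \o g)) ->
  exists v : mpdmap A sub_object, forall x, sub_object_val (v x) = u x.
Proof.
move=> kA uS uQ.
pose v0 (x : A) : set_type S := SigSub (mem_set (uS x)).
have cv : continuous (v0 : A -> Z).
  by apply: kA; apply: into_subtype_continuous; exact: mfun_continuous.
have vs x : states A x -> states sub_object (v0 x) by exact: mfun_states.
by exists (@MPDMap R A sub_object v0 cv vs uQ).
Qed.

Lemma sub_object_section (w : mpdmap B sub_object) :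
  (forall x, sub_object_val (w x) = x) -> (forall x, S x) /\ exec B `<=` Q.
Proof.
move=> wK; split=> [x|g /(mfun_exec w)]; first by rewrite -(wK x); exact: set_valP.
by rewrite /= -[X in Q X -> _](_ : g = _)//; apply/funext => t; exact/esym/wK.
Qed.

(* A pushout, or a colimit, has no proper sub-object through which the legs of
   its cocone factor: the factorization followed by the inclusion is the
   identity by uniqueness. *)
Lemma pushout_generated c (S0 D A : mpdspace R) (i : mpdmap S0 D)
    (g : mpdmap S0 A) (h : mpdmap D B) (j : mpdmap A B) :
  in_Top R c B -> lifts_to_kelley R D -> lifts_to_kelley R A ->
  is_pushout c i g h j ->
  (forall x, S (h x)) -> (forall p, exec D p -> Q (h \o p)) ->
  (forall x, S (j x)) -> (forall p, exec A p -> Q (j \o p)) ->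
  (forall x, S x) /\ exec B `<=` Q.
Proof.
move=> BT kD kA [hj univ] hS hQ jS jQ.
have [h' h'E] := sub_object_lift kD hS hQ.
have [j' j'E] := sub_object_lift kA jS jQ.
have hj' x : h' (i x) = j' (g x).
  by apply: val_inj; rewrite [LHS](h'E _) [RHS](j'E _) hj.
have [w [wh wj _]] := univ _ (sub_object_in_Top BT) h' j' hj'.
apply: (sub_object_section (w := w)).
have [w0 [_ _ wU]] := univ B BT h j hj.
have E1 := wU (mpd_id B) (fun=> erefl) (fun=> erefl).
have E2 : mpd_comp sub_object_val w =1 w0.
  by apply: wU => x /=; rewrite ?wh ?wj; [exact: h'E|exact: j'E].
by move=> x; rewrite -[RHS]/(mpd_id B x) E1 -E2.
Qed.

Lemma colimit_generated c d (L : orderType d) (F : diagram R L) (P : set L)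
    (l : forall i, P i -> mpdmap (F i) B) :
  in_Top R c B -> (forall i, lifts_to_kelley R (F i)) -> is_colimit c l ->
  (forall i (Pi : P i) x, S (l i Pi x)) ->
  (forall i (Pi : P i) p, exec (F i) p -> Q (l i Pi \o p)) ->
  (forall x, S x) /\ exec B `<=` Q.
Proof.
move=> BT kF [lC univ] lS lQ.
(* A lift is a family indexed by the proofs of [P i], which is empty outside [P]; this form allows a
   choice over all indices. *)
have kex : forall i : L, exists v : forall Pi : P i, mpdmap (F i) sub_object,
    forall Pi x, sub_object_val (v Pi x) = l i Pi x.
  move=> i; have [Pi|nPi] := pselect (P i); last first.
    by exists (fun Pi => False_rect _ (nPi Pi)) => Pi; case: (nPi Pi).
  have [v vE] := sub_object_lift (kF i) (lS i Pi) (lQ i Pi).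
  by exists (fun=> v) => Pi'; rewrite (Prop_irrelevance Pi' Pi).
pose k' i := projT1 (cid (kex i)).
have k'E i Pi x : sub_object_val (k' i Pi x) = l i Pi x.
  exact: (projT2 (cid (kex i))).
have kC : is_cocone (X := sub_object) k'.
  move=> a b Pa Pb ab x; apply: val_inj.
  by rewrite [LHS](k'E _ _ _) [RHS](k'E _ _ _); exact: lC.
have [w [wl _]] := univ _ (sub_object_in_Top BT) k' kC.
apply: (sub_object_section (w := w)).
have [w0 [_ wU]] := univ B BT l lC.
have E1 := wU (mpd_id B) (fun _ _ _ => erefl).
have E2 : mpd_comp sub_object_val w =1 w0.
  by apply: wU => a Pa x /=; rewrite wl; exact: k'E.
by move=> x; rewrite -[RHS]/(mpd_id B x) E1 -E2.
Qed.

End SubObject.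

Section TestLine.
Variable R : realType.

Let RI : topologicalType := kelley R R.

(** Maps from an object of Top to this one are just continuous real functions, so that universal
    properties of multipointed d-spaces become statements on the extension of functions. *)
Definition test_line : mpdspace R.
Proof.
refine (@MPDSpace R RI setT [set g : unitI R -> RI | continuous g] _ _ _ _) => //.
- move=> g phi cg Mphi t; apply: continuous_comp; first exact: calM_continuous.
  exact: cg.
- by move=> g1 g2; exact: ncomp_continuous.
Defined.

Lemma test_line_in_Top c : in_Top R c test_line.
Proof. by apply: in_Top_kelley_hausdorff; exact: Rhausdorff. Qed.

Lemma to_test_line (A : mpdspace R) (f : A -> R) : lifts_to_kelley R A ->
  continuous f -> exists v : mpdmap A test_line, forall x, v x = f x.
Proof.
move=> kA cf; have cf' : continuous (f : A -> RI) by exact: kA.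
have vs x : states A x -> states test_line (f x) by [].
have ve g : exec A g -> exec test_line (f \o g : unitI R -> RI).
  move=> /exec_continuous cg; change (continuous (f \o g : unitI R -> RI)) => t; apply: continuous_comp; first exact: cg.
  exact: cf'.
by exists (@MPDMap R A test_line f cf' vs ve).
Qed.

Lemma of_test_line (B : mpdspace R) (w : mpdmap B test_line) :
  continuous (w : B -> R).
Proof.
move=> x; apply: (@continuous_comp B RI R w id); first exact: (@mfun_continuous _ _ _ w x).
exact: kelley_id_continuous.
Qed.

Lemma pushout_extend c (S0 D A B : mpdspace R) (i : mpdmap S0 D)
    (g : mpdmap S0 A) (h : mpdmap D B) (j : mpdmap A B) (u : D -> R) (v : A -> R) :
  lifts_to_kelley R D -> lifts_to_kelley R A -> is_pushout c i g h j ->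
  continuous u -> continuous v -> (forall x, u (i x) = v (g x)) ->
  exists w : B -> R, [/\ continuous w, forall x, w (h x) = u x &
    forall x, w (j x) = v x].
Proof.
move=> kD kA [hj univ] cu cv uv.
have [u' u'E] := to_test_line kD cu; have [v' v'E] := to_test_line kA cv.
have [|w [wh wj _]] := univ _ (test_line_in_Top c) u' v'.
  by move=> x; rewrite u'E v'E.
exists w; split=> [|x|x]; first exact: of_test_line.
  by rewrite wh u'E.
by rewrite wj v'E.
Qed.

Lemma colimit_extend c d (L : orderType d) (F : diagram R L) (P : set L)
    (B : mpdspace R) (l : forall i, P i -> mpdmap (F i) B) (k : forall i, F i -> R) :
  (forall i, lifts_to_kelley R (F i)) -> is_colimit c l ->
  (forall i, P i -> continuous (k i)) ->
  (forall i j (ij : (i <= j)%O), P i -> P j -> forall x, k j (dmap F ij x) = k i x) ->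
  exists w : B -> R, continuous w /\ forall i (Pi : P i) x, w (l i Pi x) = k i x.
Proof.
move=> kF [lC univ] ck kC.
have kex : forall i : L, exists v : forall Pi : P i, mpdmap (F i) test_line,
    forall Pi x, v Pi x = k i x.
  move=> i; have [Pi|nPi] := pselect (P i); last first.
    by exists (fun Pi => False_rect _ (nPi Pi)) => Pi; case: (nPi Pi).
  by have [v vE] := to_test_line (kF i) (ck i Pi); exists (fun=> v).
pose k' i := projT1 (cid (kex i)).
have k'E i Pi x : k' i Pi x = k i x.
  exact: (projT2 (cid (kex i))).
have k'C : is_cocone (X := test_line) k'.
  by move=> a b Pa Pb ab x; rewrite !k'E kC.
have [w [wl _]] := univ _ (test_line_in_Top c) k' k'C.
by exists w; split=> [|i Pi x]; [exact: of_test_line|rewrite wl k'E].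
Qed.

End TestLine.

Lemma continuous_near_eq (S T : topologicalType) (f g : S -> T) (x : S) :
  (\forall y \near x, g y = f y) -> continuous g -> {for x, continuous f}.
Proof.
move=> fg cg A; rewrite /= -(nbhs_singleton fg) => /cg nA.
by apply: filterS2 fg nA => y /= <-.
Qed.

Section GlobeFun.
Variables (R : realType) (Z T : topologicalType).
Variables (s : bool -> T) (p : Z -> unitI R -> T).
Hypothesis p0 : forall z, p z (I0 R) = s false.
Hypothesis p1 : forall z, p z (I1 R) = s true.

Definition preglobe_fun (x : preglobe R Z) : T :=
  match x with
  | existT true b => s b
  | existT false zt => p (zt : Z * unitI R).1 zt.2
  end.

Definition globe_fun (x : globe R Z) : T :=
  preglobe_fun (repr (x : {eq_quot globe_equiv R Z})).

Lemma globe_funE x : globe_fun (globe_pi x) = preglobe_fun x.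
Proof.
have collE y : preglobe_fun (collapse y) = preglobe_fun y.
  case: y => -[b|[z t]] //=; case: eqP => [->|_] /=; first by rewrite p0.
  by case: eqP => [->|_] /=; rewrite ?p1.
have /globe_piE/eqP xE : globe_pi (repr (globe_pi x : {eq_quot globe_equiv R Z})) = globe_pi x.
  exact: reprK.
by rewrite /globe_fun -collE xE collE.
Qed.

Lemma globe_fun_state b : globe_fun (globe_state R Z b) = s b.
Proof. by rewrite globe_funE. Qed.

Lemma globe_fun_pt z t : globe_fun (globe_pt z t) = p z t.
Proof. by rewrite globe_funE. Qed.

Lemma globe_fun_continuous :
  continuous (fun zt : kelley R (Z * unitI R)%type => p (zt : Z * unitI R).1 (zt : Z * unitI R).2) ->
  continuous globe_fun.
Proof.
move=> cp; apply/quotient_continuous.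
rewrite (_ : _ \o _ = preglobe_fun); last by apply/funext => x; exact: globe_funE.
move=> [[b|zt]] A nA; rewrite /= /nbhs /= !sigT_nbhsE /=.
  by apply: open_nbhs_nbhs; split; [exact: discrete_open|exact: nbhs_singleton nA].
exact: cp.
Qed.

End GlobeFun.

Lemma globe_pt_continuous (R : realType) (Z : topologicalType) :
  continuous (fun zt : kelley R (Z * unitI R)%type => globe_pt (zt : Z * unitI R).1 (zt : Z * unitI R).2).
Proof.
move=> zt; rewrite (_ : (fun _ => _) = @globe_pi R Z \o (fun y : kelley R (Z * unitI R)%type => existT _ false y : preglobe R Z)).
  apply: continuous_comp; last exact: globe_pi_continuous.
  exact: (@existT_continuous _ (fun b : bool => if b then (bool : topologicalType) else kelley R (Z * unitI R)%type) false).
by apply/funext => -[z t].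
Qed.

Lemma globe_ind (R : realType) (Z : topologicalType) (P : globe R Z -> Prop) :
  (forall b, P (globe_state R Z b)) -> (forall z t, P (globe_pt z t)) -> forall x, P x.
Proof.
move=> Ps Pp x; rewrite -[x](@reprK _ ({eq_quot globe_equiv R Z})).
by case: (repr _) => -[b|[z t]]; [exact: (Ps b)|exact: (Pp z t)].
Qed.

(** * Extension of functions over a globe *)

Lemma continuous_mx (R : topologicalType) (S : topologicalType) m n (f : S -> 'M[R]_(m, n)) :
  (forall i j, continuous (fun x => f x i j)) -> continuous f.
Proof.
move=> cf x A [P fxP PA]; have Fx : Filter (nbhs x) := nbhs_filter x.
have : \forall y \near x, forall ij : 'I_m * 'I_n, P ij.1 ij.2 (f y ij.1 ij.2).
  by apply: filter_forall => -[i j]; exact: (cf i j x (P i j) (fxP i j)).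
by apply: filterS => y fP; apply: PA => i j; exact: (fP (i, j)).
Qed.

Section Cell.
Variables (R : realType) (n : nat).
Let D : topologicalType := disk R n.
Let S : topologicalType := bsphere R n.

Definition norm2 (z : 'rV[R]_n) : R := \sum_i z ord0 i ^+ 2.
Definition radius (z : 'rV[R]_n) : R := Num.sqrt (norm2 z).

Lemma norm2_ge0 z : 0 <= norm2 z.
Proof. by apply: sumr_ge0 => i _; exact: sqr_ge0. Qed.

Lemma norm2_disk (z : D) : norm2 (val z) <= 1.
Proof. exact: (set_valP z). Qed.

Lemma norm2_sphere (z : S) : norm2 (val z) = 1.
Proof. exact: (set_valP z). Qed.

Lemma radius_ge0 z : 0 <= radius z.
Proof. exact: sqrtr_ge0. Qed.

Lemma radius_le1 (z : D) : radius (val z) <= 1.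
Proof. by rewrite -[leRHS]sqrtr1 ler_sqrt ?norm2_disk. Qed.

Lemma radius_sphere (z : S) : radius (val z) = 1.
Proof. by rewrite /radius norm2_sphere sqrtr1. Qed.

Lemma radius_eq0 z : radius z = 0 -> z = 0.
Proof.
move=> /eqP; rewrite sqrtr_eq0 => z0; apply/rowP => i; rewrite mxE.
have /eqP/psumr_eq0P : norm2 z == 0 by rewrite eq_le z0 norm2_ge0.
by move=> /(_ (fun i _ => sqr_ge0 _) i isT)/eqP; rewrite sqrf_eq0 => /eqP.
Qed.

Lemma norm2_continuous : continuous norm2.
Proof.
apply: contsum => i; rewrite (_ : (fun _ => _) = fun z : 'rV[R]_n => z ord0 i * z ord0 i) //.
by apply: contM; exact: coord_continuous.
Qed.

Lemma radius_continuous : continuous radius.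
Proof. by apply: (contcomp norm2_continuous); exact: sqrt_continuous. Qed.

Lemma norm2Z (a : R) z : norm2 (a *: z) = a ^+ 2 * norm2 z.
Proof. by rewrite /norm2 mulr_sumr; apply: eq_bigr => i _; rewrite mxE exprMn. Qed.

Lemma normalize_sphere z : radius z != 0 -> (radius z)^-1 *: z \in @sphere_set R n.
Proof.
move=> z0; rewrite inE /sphere_set /= -/(norm2 _) norm2Z.
by rewrite -[norm2 z]sqr_sqrtr ?norm2_ge0// -exprMn mulVf// expr1n.
Qed.

End Cell.

Section Extension.
Variables (R : realType) (n : nat).
Let D : topologicalType := disk R n.
Let S : topologicalType := bsphere R n.
Variable w : globe R S -> R.
Hypotheses (cw : continuous w) (w0 : forall x, 0 <= w x) (w1 : forall x, w x <= 1).

Let ws b := w (globe_state R S b).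

(* Linear interpolation, increased by [t (1 - t)] to be positive for 0 < t < 1:
   the extension of a function vanishing exactly on the states vanishes exactly
   on the states. *)
Definition height (t : unitI R) : R :=
  Num.max ((1 - val t) * ws false + val t * ws true) (val t * (1 - val t)).

Lemma height_I0 : height (I0 R) = ws false.
Proof. by rewrite /height val_I0 subr0 !mul0r mul1r addr0 max_l//; exact: w0. Qed.

Lemma height_I1 : height (I1 R) = ws true.
Proof. by rewrite /height val_I1 subrr mulr0 mul0r mul1r add0r max_l//; exact: w0. Qed.

Lemma height_ge0 t : 0 <= height t.
Proof.
rewrite le_max; apply/orP; right.
by rewrite mulr_ge0 ?unitI_ge0 ?subr_ge0 ?unitI_le1.
Qed.

Lemma height_le1 t : height t <= 1.
Proof.
have t0 := unitI_ge0 t; have t1 := unitI_le1 t.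
have a1 := w1 (globe_state R S false); have b1 := w1 (globe_state R S true).
rewrite ge_max; apply/andP; split; last by nra.
rewrite -/(ws _) in a1 b1.
have A : 0 <= (1 - val t) * (1 - ws false) by rewrite mulr_ge0 ?subr_ge0.
have B : 0 <= val t * (1 - ws true) by rewrite mulr_ge0 ?subr_ge0.
lra.
Qed.

Lemma height_gt0 t : 0 < val t -> val t < 1 -> 0 < height t.
Proof. by move=> t0 t1; rewrite lt_max mulr_gt0 ?orbT ?subr_gt0. Qed.

Lemma height_continuous : continuous height.
Proof.
have cv := @unitI_val_continuous R.
apply: contmax; first apply: contD; apply: contM => //; try exact: contC.
  by apply: contB => //; exact: contC.
by apply: contB => //; exact: contC.
Qed.

(* [w] at the radial projection of [z]; the value 0 is used only at the center,
   where it is multiplied by the radius. *)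
Definition radial (z : D) (t : unitI R) : R :=
  if insub ((radius (val z))^-1 *: val z) is Some s then w (globe_pt (s : S) t) else 0.

Lemma radial_ge0 z t : 0 <= radial z t.
Proof. by rewrite /radial; case: insubP. Qed.

Lemma radial_le1 z t : radial z t <= 1.
Proof. by rewrite /radial; case: insubP => //= _; rewrite ler01. Qed.

(* As [radial] is bounded, this is continuous at the center of the disk. *)
Definition extend_pt (z : D) (t : unitI R) : R :=
  (1 - radius (val z)) * height t + radius (val z) * radial z t.

Lemma extend_pt_I0 z : extend_pt z (I0 R) = ws false.
Proof.
rewrite /extend_pt height_I0 /radial; case: insubP => [s _ _|].
  by rewrite globe_pt_I0 -/(ws _); ring.
move/negP => nS; have -> : radius (val z) = 0.
  by apply/eqP; apply/negPn/negP => z0; apply: nS; exact: normalize_sphere.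
ring.
Qed.

Lemma extend_pt_I1 z : extend_pt z (I1 R) = ws true.
Proof.
rewrite /extend_pt height_I1 /radial; case: insubP => [s _ _|].
  by rewrite globe_pt_I1 -/(ws _); ring.
move/negP => nS; have -> : radius (val z) = 0.
  by apply/eqP; apply/negPn/negP => z0; apply: nS; exact: normalize_sphere.
ring.
Qed.

Lemma extend_pt_sphere (z : S) t : extend_pt (sphere_incl z) t = w (globe_pt z t).
Proof.
rewrite /extend_pt /radial /= -[sval z]/(val z) radius_sphere invr1 scale1r subrr mul0r add0r mul1r.
by rewrite valK.
Qed.

Lemma extend_pt_ge0 z t : 0 <= extend_pt z t.
Proof.
by rewrite addr_ge0// mulr_ge0 ?subr_ge0 ?radius_le1 ?height_ge0 ?radius_ge0 ?radial_ge0.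
Qed.

Lemma extend_pt_le1 z t : extend_pt z t <= 1.
Proof.
have := radius_le1 z; have := radius_ge0 (val z).
move=> r0 r1.
have A : 0 <= (1 - radius (val z)) * (1 - height t) by rewrite mulr_ge0 ?subr_ge0 ?height_le1.
have B : 0 <= radius (val z) * (1 - radial z t) by rewrite mulr_ge0 ?subr_ge0 ?radial_le1.
rewrite /extend_pt; lra.
Qed.

Lemma extend_pt_gt0 z t : radius (val z) < 1 -> 0 < val t -> val t < 1 -> 0 < extend_pt z t.
Proof.
move=> z1 t0 t1; apply: ltr_pwDl; first by rewrite mulr_gt0 ?subr_gt0 ?height_gt0.
by rewrite mulr_ge0 ?radius_ge0 ?radial_ge0.
Qed.

Let K : topologicalType := kelley R (D * unitI R)%type.
Let kz (x : K) : D := (x : D * unitI R).1.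
Let kt (x : K) : unitI R := (x : D * unitI R).2.

Let kz_continuous : continuous kz.
Proof. exact: (@contcomp K (D * unitI R)%type _ id fst (@kelley_id_continuous R _) (@contfst _ _)). Qed.

Let kt_continuous : continuous kt.
Proof. exact: (@contcomp K (D * unitI R)%type _ id snd (@kelley_id_continuous R _) (@contsnd _ _)). Qed.

Let kr_continuous : continuous (fun x : K => radius (val (kz x))).
Proof.
apply: (contcomp (f := fun x : K => val (kz x) : 'rV[R]_n) (g := @radius R n)); last exact: radius_continuous.
by apply: (contcomp kz_continuous); exact: subtype_val_continuous.
Qed.

(* Around a point with nonzero [i]-th coordinate, radial projection is replaced
   by a globally defined continuous map, obtained by moving the [i]-th
   coordinate away from 0 by [m]. *)
Let move_away (i : 'I_n) (m : R -> R) (z : 'rV[R]_n) : 'rV[R]_n :=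
  \row_j (if j == i then m (z ord0 j) else z ord0 j).

Let radial_locally i m : continuous m -> (forall y, m y != 0) ->
  exists2 g : K -> R, continuous g &
    forall x, m ((val (kz x) : 'rV[R]_n) ord0 i) = (val (kz x) : 'rV[R]_n) ord0 i ->
      radial (kz x) (kt x) = g x.
Proof.
move=> cm m0.
have ma0 z : radius (move_away i m z) != 0.
  apply/eqP => /radius_eq0/rowP/(_ i); rewrite !mxE eqxx => /eqP; exact/negP.
have cma : continuous (move_away i m).
  apply: continuous_mx => k j; rewrite (_ : (fun _ => _) = fun z : 'rV[R]_n => if j == i then m (z ord0 j) else z ord0 j).
    by case: (j == i); [apply: contcomp => //; exact: coord_continuous|exact: coord_continuous].
  by apply/funext => z; rewrite mxE.
pose s (z : D) : S := SigSub (normalize_sphere (ma0 (val z))).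
have cs : continuous s.
  apply: into_subtype_continuous; apply: continuous_mx => k j.
  rewrite (_ : (fun _ => _) = fun z : D => (radius (move_away i m (val z)))^-1 * (move_away i m (val z)) k j); last first.
    by apply/funext => z; rewrite /= mxE.
  have cmv : continuous (fun z : D => move_away i m (val z)).
    by apply: (contcomp (f := val : D -> 'rV[R]_n)) => //; exact: subtype_val_continuous.
  apply: contM; last exact: (@contcomp D 'rV[R]_n R _ (fun M => M k j) cmv (@coord_continuous R 1 n k j)).
  move=> z; have Fz : Filter (nbhs z) := nbhs_filter z.
  apply: cvgV; first exact: ma0.
  exact: (contcomp cmv (@radius_continuous R n)).
have csk : continuous (fun x : K => (s (kz x), kt x) : kelley R (S * unitI R)%type).
  apply: (@kelley_map_continuous R (D * unitI R)%type (S * unitI R)%type (fun x => (s x.1, x.2))).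
  by apply: contpair; [apply: (contcomp (@contfst _ _))|exact: contsnd].
exists (fun x : K => w (globe_pt (s (kz x)) (kt x))).
  exact: (contcomp (contcomp csk (@globe_pt_continuous R S)) cw).
move=> x mx; have ME : move_away i m (val (kz x)) = val (kz x).
  by apply/rowP => j; rewrite mxE; case: eqP => // ->.
rewrite /radial; case: insubP => [s' _ s'E|].
  congr (w (globe_pt _ _)); apply: val_inj; rewrite s'E /=.
  by rewrite -[sval (kz x)]/(val (kz x)) ME.
by rewrite normalize_sphere// -ME.
Qed.

Lemma extend_pt_continuous : continuous (fun x : K => extend_pt (kz x) (kt x)).
Proof.
move=> x; have ch : continuous (fun x => height (kt x)) := contcomp kt_continuous height_continuous.
have [r0|r0] := eqVneq (radius (val (kz x))) 0; last first.
  have [i zi] : exists i, (val (kz x) : 'rV[R]_n) ord0 i != 0.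
    apply/not_existsP => H; move/eqP: r0; apply; rewrite /radius /norm2 big1 ?sqrtr0// => i _.
    by move/negP/negPn/eqP: (H i) => ->; rewrite expr0n.
  (* [m] cuts off at half of the nonzero coordinate [a], from above or from below according to its
     sign: it avoids 0 and is the identity near [a]. *)
  have [m [cm m0 mE]] : exists m : R -> R, [/\ continuous m, forall y, m y != 0 &
      \forall y \near (val (kz x) : 'rV[R]_n) ord0 i, m y = y].
    set a := (val (kz x) : 'rV[R]_n) ord0 i; have [a0|a0|a0] := ltgtP a 0.
    - exists (fun y => Num.min y (a / 2)); split.
      + by apply: contmin; [move=> y; exact: cvg_id|exact: contC].
      + by move=> y; rewrite lt_eqF// gt_min; apply/orP; right; lra.
      + have : nbhs a [set y | y < a / 2].
          by apply: open_nbhs_nbhs; split; [exact: open_lt|rewrite /=; lra].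
        by apply: filterS => y /ltW ya; rewrite min_l.
    - exists (fun y => Num.max y (a / 2)); split.
      + by apply: contmax; [move=> y; exact: cvg_id|exact: contC].
      + by move=> y; rewrite gt_eqF// lt_max; apply/orP; right; lra.
      + have : nbhs a [set y | a / 2 < y].
          by apply: open_nbhs_nbhs; split; [exact: open_gt|rewrite /=; lra].
        by apply: filterS => y /ltW ya; rewrite max_l.
    - by move: zi; rewrite -/a a0 eqxx.
  have [g cg gE] := radial_locally i cm m0.
  apply: (@continuous_near_eq _ _ _ (fun x => (1 - radius (val (kz x))) * height (kt x) + radius (val (kz x)) * g x)).
    have ci : continuous (fun y : K => (val (kz y) : 'rV[R]_n) ord0 i).
      apply: (@contcomp K 'rV[R]_n R (fun x => val (kz x)) (fun M => M ord0 i)); last exact: coord_continuous.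
      by apply: (contcomp kz_continuous); exact: subtype_val_continuous.
    have mEx : nbhs x [set y | m ((val (kz y) : 'rV[R]_n) ord0 i) = (val (kz y) : 'rV[R]_n) ord0 i].
      exact: (ci x _ mE).
    by apply: filterS mEx => y /= /gE yE; rewrite /extend_pt yE.
  by apply: contD; apply: contM => //; apply: contB => //; exact: contC.
have Fx : Filter (nbhs x) := nbhs_filter x.
have low : (fun y => (1 - radius (val (kz y))) * height (kt y)) @ x --> height (kt x).
  have /(_ x) : continuous (fun y : K => (1 - radius (val (kz y))) * height (kt y)).
    by apply: contM => //; apply: contB => //; exact: contC.
  by rewrite /continuous_at r0 subr0 mul1r.
have up : (fun y => (1 - radius (val (kz y))) * height (kt y) + radius (val (kz y))) @ x --> height (kt x).
  have hr : (fun y => radius (val (kz y))) @ x --> (0 : R).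
    by rewrite -r0; exact: (kr_continuous (x := x)).
  by have := cvgD low hr; rewrite addr0; exact.
rewrite /continuous_at {2}/extend_pt r0 subr0 mul1r mul0r addr0.
apply: squeeze_cvgr low up; apply: nearW => y; rewrite /extend_pt.
by rewrite lerDl mulr_ge0 ?radius_ge0 ?radial_ge0//= lerD2l ler_piMr ?radius_ge0 ?radial_le1.
Qed.

Definition extend_globe : globe R D -> R := globe_fun ws extend_pt.

Lemma extend_globe_continuous : continuous extend_globe.
Proof.
apply: globe_fun_continuous; [exact: extend_pt_I0|exact: extend_pt_I1|].
exact: extend_pt_continuous.
Qed.

Lemma extend_globe_pt z t : extend_globe (globe_pt z t) = extend_pt z t.
Proof. by rewrite /extend_globe globe_fun_pt//; [exact: extend_pt_I0|exact: extend_pt_I1]. Qed.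

Lemma extend_globe_state b : extend_globe (globe_state R D b) = ws b.
Proof. by rewrite /extend_globe globe_fun_state//; [exact: extend_pt_I0|exact: extend_pt_I1]. Qed.

Lemma extend_globe_incl x : extend_globe (globe_incl R n x) = w x.
Proof.
elim/globe_ind: x => [b|z t] /=; rewrite globe_map_funE /=.
  exact: extend_globe_state.
by rewrite extend_globe_pt extend_pt_sphere.
Qed.

Lemma extend_globe_ge0 x : 0 <= extend_globe x.
Proof.
elim/globe_ind: x => [b|z t]; first by rewrite extend_globe_state; exact: w0.
by rewrite extend_globe_pt; exact: extend_pt_ge0.
Qed.

Lemma extend_globe_le1 x : extend_globe x <= 1.
Proof.
elim/globe_ind: x => [b|z t]; first by rewrite extend_globe_state; exact: w1.
by rewrite extend_globe_pt; exact: extend_pt_le1.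
Qed.

End Extension.

Section Bump.
Variables (R : realType) (n : nat).
Let D : topologicalType := disk R n.

(** One factor vanishes on the sphere, the other at the two ends: the multiples of [bump] extend by
    0 to the stage to which the cell is attached. *)
Definition bump (z : D) (t : unitI R) : R :=
  (1 - norm2 (val z)) * (val t * (1 - val t)).

Lemma bump_ge0 z t : 0 <= bump z t.
Proof. by rewrite !mulr_ge0 ?subr_ge0 ?norm2_disk ?unitI_ge0 ?unitI_le1. Qed.

Lemma bump_le1 z t : bump z t <= 1.
Proof.
have z1 : 1 - norm2 (val z) <= 1 by rewrite lerBlDr lerDl norm2_ge0.
rewrite -[leRHS]mulr1; apply: ler_pM => //.
- by rewrite subr_ge0 norm2_disk.
- by rewrite mulr_ge0 ?subr_ge0 ?unitI_ge0 ?unitI_le1.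
- have := unitI_ge0 t; have := unitI_le1 t; nra.
Qed.

Lemma bump_extend (q : D * unitI R -> R) : continuous q ->
  (forall x, 0 <= q x <= 1) ->
  exists u : globe R D -> R, [/\ continuous u, forall x, 0 <= u x <= 1,
    forall x, u (globe_incl R n x) = 0 &
    forall z t, u (globe_pt z t) = bump z t * q (z, t)].
Proof.
move=> cq q01; pose p z t := bump z t * q (z, t).
have p0 z : p z (I0 R) = 0 by rewrite /p /bump val_I0 !(mul0r, mulr0).
have p1 z : p z (I1 R) = 0 by rewrite /p /bump val_I1 subrr !(mul0r, mulr0).
have p01 z t : 0 <= p z t <= 1.
  have /andP[q0 q1] := q01 (z, t); rewrite mulr_ge0 ?bump_ge0//=.
  by rewrite -[leRHS]mulr1; apply: ler_pM => //; [exact: bump_ge0|exact: bump_le1].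
have cp : continuous (fun x : D * unitI R => p x.1 x.2).
  have ct : continuous (fun x : D * unitI R => val x.2 : R).
    by apply: (contcomp (@contsnd _ _)); exact: unitI_val_continuous.
  have cz : continuous (fun x : D * unitI R => norm2 (val x.1)).
    apply: (@contcomp _ 'rV[R]_n R (fun x : D * unitI R => val x.1)); last exact: norm2_continuous.
    by apply: (contcomp (@contfst _ _)); exact: subtype_val_continuous.
  apply: contM; last by rewrite (_ : (fun _ => _) = q)//; apply/funext => -[].
  by apply: contM; [apply: contB => //; exact: contC|apply: contM => //; apply: contB => //; exact: contC].
exists (globe_fun (fun=> 0) p); split.
- apply: globe_fun_continuous => //.
  exact: (@contcomp (kelley R (D * unitI R)%type) (D * unitI R)%type R id _ (@kelley_id_continuous R _) cp).
- by move=> x; elim/globe_ind: x => [b|z t]; rewrite ?globe_fun_state ?globe_fun_pt// lexx ler01.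
- move=> x; elim/globe_ind: x => [b|z t]; rewrite /= globe_map_funE /=.
    exact: globe_fun_state.
  by rewrite -/(globe_pt _ _) globe_fun_pt// /p /bump norm2_sphere subrr !mul0r.
- by move=> z t; rewrite globe_fun_pt.
Qed.

Lemma bump_gt0 z t : norm2 (val z) < 1 -> 0 < val t < 1 -> 0 < bump z t.
Proof. by move=> z1 /andP[t0 t1]; rewrite !mulr_gt0 ?subr_gt0. Qed.

(** Testing with [bump] itself shows that its two values are equal, and they are nonzero. Cancelling
    them from the tests with its multiples leaves the time and the coordinates of the base point. *)
Lemma bump_separate (z : D) t (z' : D) t' : norm2 (val z) < 1 -> 0 < val t < 1 ->
  (forall u : globe R D -> R, continuous u -> (forall x, 0 <= u x <= 1) ->
    (forall x, u (globe_incl R n x) = 0) -> u (globe_pt z t) = u (globe_pt z' t')) ->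
  z = z' /\ t = t'.
Proof.
move=> z1 t01 H.
have E (q : D * unitI R -> R) : continuous q -> (forall x, 0 <= q x <= 1) ->
    bump z t * q (z, t) = bump z' t' * q (z', t').
  by move=> cq q01; have [u [cu u01 u0 uE]] := bump_extend cq q01; rewrite -!uE; exact: H.
have b0 : bump z t != 0 by rewrite gt_eqF ?bump_gt0.
have bE : bump z t = bump z' t'.
  by have := E (fun=> 1) (@contC _ _ _); rewrite !mulr1; apply => _; rewrite ler01 lexx.
have E' (q : D * unitI R -> R) : continuous q -> (forall x, 0 <= q x <= 1) ->
    q (z, t) = q (z', t').
  by move=> cq q01; apply: (mulfI b0); rewrite [in RHS]bE; exact: E.
split; last first.
  apply: val_inj; apply: (E' (fun x => val x.2)).
    by apply: (contcomp (@contsnd _ _)); exact: unitI_val_continuous.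
  by move=> x; rewrite unitI_ge0 unitI_le1.
apply: val_inj; apply/rowP => i.
(* Coordinates on the disk lie in [-1,1], whereas test functions take values in [0,1]. *)
pose q (x : D * unitI R) : R := (1 + (val x.1 : 'rV[R]_n) ord0 i) / 2.
suff : q (z, t) = q (z', t') by rewrite /q /=; lra.
apply: E'; last first.
  move=> [y s]; rewrite /q /=; have := norm2_disk y; rewrite /norm2 (bigD1 i)//= -[sval y]/(val y).
  have : 0 <= \sum_(j < n | j != i) (val y : 'rV[R]_n) ord0 j ^+ 2.
    by apply: sumr_ge0 => j _; exact: sqr_ge0.
  move: (\sum_(j < n | _) _) ((val y : 'rV[R]_n) ord0 i) => a b a0 ab.
  have : `|b| <= 1 by rewrite -(expr_le1 (n := 2))// real_normK ?num_real//; lra.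
  by rewrite ler_norml => /andP[? ?]; lra.
  apply: contM; last exact: contC.
  apply: contD; first exact: contC.
  apply: (@contcomp _ 'rV[R]_n R (fun x : D * unitI R => val x.1) (fun M => M ord0 i)); last exact: coord_continuous.
  by apply: (contcomp (@contfst _ _)); exact: subtype_val_continuous.
Qed.

End Bump.

(** * Transfinite extension of functions *)

Lemma in_Top_lifts (R : realType) c (S : topologicalType) :
  in_Top R c S -> lifts_to_kelley R S.
Proof.
by move=> ST T f cf; apply: continuous_to_kelley => //; exact: in_Top_delta_generated ST.
Qed.

Lemma globe_lifts (R : realType) (Z : topologicalType) : lifts_to_kelley R (globe R Z).
Proof. by move=> T f; exact: globe_to_kelley. Qed.

(* A version of [leP] which does not rewrite the goal, where proofs of
   inequalities occur. *)
Lemma le_or_lt d (L : orderType d) (i j : L) : (i <= j)%O \/ (j < i)%O.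
Proof. by case: leP => _; [left|right]. Qed.

Section Surjectivity.
Variables (R : realType) (B : mpdspace R) (S : set B) (c : top_choice).
Hypothesis BT : in_Top R c B.

Let Q : set (unitI R -> B) := [set g | exec B g /\ forall t, S (g t)].

Let Qexec : Q `<=` exec B. Proof. by move=> g []. Qed.

Let Qreparam g phi : Q g -> calM phi -> Q (g \o phi).
Proof. by move=> [eg Sg] Mphi; split; [exact: exec_reparam|move=> t; exact: Sg]. Qed.

Let Qncomp g1 g2 : Q g1 -> Q g2 -> g1 (I1 R) = g2 (I0 R) -> Q (ncomp g1 g2).
Proof.
move=> [e1 S1] [e2 S2] g12; split; first exact: exec_ncomp.
by move=> t; rewrite /ncomp; case: ifP => _; [exact: S1|exact: S2].
Qed.

(** Generation is applied with the execution paths contained in [S], a class stable under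
    reparametrization and composition. A property of points is thus checked on the legs only. *)
Lemma pushout_surj (S0 D A : mpdspace R) (i : mpdmap S0 D)
    (g : mpdmap S0 A) (h : mpdmap D B) (j : mpdmap A B) :
  lifts_to_kelley R D -> lifts_to_kelley R A -> is_pushout c i g h j ->
  (forall x, S (h x)) -> (forall x, S (j x)) -> forall x, S x.
Proof.
move=> kD kA po hS jS.
have hQ p : exec D p -> Q (h \o p).
  by split; [exact: mfun_exec|move=> t; exact: hS].
have jQ p : exec A p -> Q (j \o p).
  by split; [exact: mfun_exec|move=> t; exact: jS].
exact: (pushout_generated Qexec Qreparam Qncomp BT kD kA po hS hQ jS jQ).1.
Qed.

Lemma colimit_surj d (L : orderType d) (F : diagram R L) (P : set L)
    (l : forall i, P i -> mpdmap (F i) B) :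
  (forall i, lifts_to_kelley R (F i)) -> is_colimit c l ->
  (forall i (Pi : P i) x, S (l i Pi x)) -> forall x, S x.
Proof.
move=> kF co lS.
have lQ i (Pi : P i) p : exec (F i) p -> Q (l i Pi \o p).
  by split; [exact: mfun_exec|move=> t; exact: lS].
exact: (colimit_generated Qexec Qreparam Qncomp BT kF co lS lQ).1.
Qed.

End Surjectivity.

Section Decomposition.
Variables (R : realType) (c : top_choice) (X : mpdspace R).
Hypothesis hX : in_Top R c X.
Variable D : cellular_decomposition c X.

Notation L := (cd_index D).
Notation F := (cd_diag D).
Notation leg := (cd_leg D).
Notation hat := (fun i j (ij : is_succ i j) => att_hat (cd_attach D ij)).
Notation att := (fun i j (ij : is_succ i j) => att_map (cd_attach D ij)).

Let kF i : lifts_to_kelley R (F i).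
Proof. exact: (in_Top_lifts (@cd_in_Top _ _ _ D i)). Qed.

Lemma dmap_dmap (i j k : L) (ij : (i <= j)%O) (jk : (j <= k)%O) (ik : (i <= k)%O) x :
  dmap F jk (dmap F ij x) = dmap F ik x.
Proof. exact: (@dmap_comp _ _ _ F _ _ _ ij jk ik x). Qed.

Lemma leg_dmap (i j : L) (ij : (i <= j)%O) x : leg j (dmap F ij x) = leg i x.
Proof. exact: ((cd_colimit D).1 i j I I ij x). Qed.

Lemma index_cases (i : L) :
  [\/ i = cd_bot D, exists k, is_succ k i | is_limit i].
Proof.
have [->|ib] := eqVneq i (cd_bot D); first exact: Or31.
have bi : (cd_bot D < i)%O by rewrite lt_def ib cd_bot_le.
have [lim|/not_andP[|/existsNP[k /not_implyP[ki nk]]]] := pselect (is_limit i).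
- exact: Or33.
- by case; exists (cd_bot D).
- apply: Or32; exists k; split=> // m km; rewrite leNgt; apply/negP => mi.
  by apply: nk; exists m.
Qed.

Lemma succ_le (i j k : L) : is_succ i j -> (k < j)%O -> (k <= i)%O.
Proof.
move=> [_ ij] kj; rewrite leNgt; apply/negP => /ij jk.
by have := le_lt_trans jk kj; rewrite ltxx.
Qed.

Lemma succ_inj (i i' j : L) : is_succ i j -> is_succ i' j -> i = i'.
Proof.
move=> ij i'j; apply/le_anti/andP; split.
  exact: succ_le i'j ij.1.
exact: succ_le ij i'j.1.
Qed.

Section Extend.
Variables (nu : L) (h : F nu -> R).
Hypotheses (ch : continuous h) (h01 : forall x, 0 <= h x <= 1).

(* [H] extends [h] by [extend_globe] on every cell attached after stage [nu]; this
   determines [H], so that the extensions fit together at the limit stages. *)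
Definition canon (mu : L) (H : F mu -> R) : Prop :=
  [/\ continuous H, forall x, 0 <= H x <= 1,
    forall (num : (nu <= mu)%O) x, H (dmap F num x) = h x &
    forall (i j : L) (ij : is_succ i j) (jmu : (j <= mu)%O), (nu <= i)%O ->
      forall y, H (dmap F jmu (hat _ _ ij y)) =
        extend_globe (fun x => H (dmap F jmu (dmap F (ltW ij.1) (att _ _ ij x)))) y].

(** Induction on the stages between [nu] and [mu]: on a new cell both functions are extended in the
    same way from boundary values that already agree, and a limit stage has no new points. This
    makes the extensions chosen at different stages compatible. *)
Lemma canon_unique mu H H' : (nu <= mu)%O -> @canon mu H -> canon H' -> H =1 H'.
Proof.
move=> num [_ _ Hh Hc] [_ _ H'h H'c].
suff E : forall k, (nu <= k)%O -> forall (km : (k <= mu)%O) x,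
    H (dmap F km x) = H' (dmap F km x).
  by move=> x; have := E mu num (lexx mu) x; rewrite !(@dmap_id _ _ _ F).
elim/(well_founded_induction (@cd_wf _ _ _ D)) => k IH nuk km.
have [kb|[i ik]|kl] := index_cases k.
- have ? : k = nu by apply/le_anti; rewrite nuk andbT kb cd_bot_le.
  by clear kb; subst k => x; rewrite Hh H'h.
- have [?|nuNk] := eqVneq k nu; first by subst k => x; rewrite Hh H'h.
  have nui : (nu <= i)%O by apply: (succ_le ik); rewrite lt_def nuNk nuk.
  have Ei y : H (dmap F km (dmap F (ltW ik.1) y)) = H' (dmap F km (dmap F (ltW ik.1) y)).
    by rewrite !(dmap_dmap _ _ (le_trans (ltW ik.1) km)) IH// ik.1.
  apply: (pushout_surj (S := [set x | H (dmap F km x) = H' (dmap F km x)])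
    (@cd_in_Top _ _ _ D k) _ _ (att_pushout (cd_attach D ik))) => //.
  + exact: globe_lifts.
  + by move=> y /=; rewrite Hc// H'c//; congr (extend_globe _ y); apply/funext => x; exact: Ei.
- have [?|nuNk] := eqVneq k nu; first by subst k => x; rewrite Hh H'h.
  apply: (colimit_surj (S := [set x | H (dmap F km x) = H' (dmap F km x)])
    (@cd_in_Top _ _ _ D k) (@kF) (cd_limit kl)) => a ak x /=.
  rewrite !(dmap_dmap _ _ (le_trans (ltW ak) km)).
  have [nua|/ltW anu] := le_or_lt nu a; first by rewrite IH.
  by rewrite -!(dmap_dmap anu num) Hh H'h.
Qed.

Lemma canon_restrict (a b : L) (ab : (a <= b)%O) (H : F b -> R) :
  (nu <= a)%O -> canon H -> canon (fun x => H (dmap F ab x)).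
Proof.
move=> nua [cH H01 Hh Hc]; split=> //.
- by apply: contcomp => //; exact: mfun_continuous.
- by move=> num x; rewrite (dmap_dmap _ _ (le_trans num ab)) Hh.
- move=> i j ij ja nui y; rewrite (dmap_dmap _ _ (le_trans ja ab)) Hc//.
  by congr (extend_globe _ y); apply/funext => x; rewrite (dmap_dmap ja ab (le_trans ja ab)).
Qed.

(** Stated for any colimit cocone because it serves both at the limit stages and for the passage to
    X. *)
Lemma canon_colimit (B : mpdspace R) (P : set L) (l : forall i, P i -> mpdmap (F i) B) :
  in_Top R c B -> is_colimit c l -> P nu ->
  (forall a, P a -> (nu <= a)%O -> exists H : F a -> R, canon H) ->
  exists H : B -> R, [/\ continuous H, forall x, 0 <= H x <= 1 &
    forall a (Pa : P a), (nu <= a)%O -> canon (fun x => H (l a Pa x))].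
Proof.
move=> BT co Pnu ex.
(* A cocone needs a function at every index of [P], including those before [nu], where [h] is pulled
   back. The zero function, used after [nu] and outside [P], is a placeholder. *)
have kex a : exists k : F a -> R, [/\ P a -> continuous k, P a -> forall x, 0 <= k x <= 1,
    P a -> (nu <= a)%O -> canon k &
    forall (anu : (a <= nu)%O) x, k x = h (dmap F anu x)].
  have [anu|nua] := le_or_lt a nu.
    exists (fun x => h (dmap F anu x)); split=> //.
    - by move=> _; apply: contcomp => //; exact: mfun_continuous.
    - move=> Pa nua; have ? : a = nu by apply/le_anti; rewrite anu nua.
      subst a; split=> //.
      + by apply: contcomp => //; exact: mfun_continuous.
      + by move=> num x; rewrite !(@dmap_id _ _ _ F).
      + move=> i j ij jn nui; have := lt_le_trans ij.1 (le_trans jn nui).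
        by rewrite ltxx.
    - by move=> anu' x; congr h; rewrite (bool_irrelevance anu anu').
  have [Pa|nPa] := pselect (P a); last first.
    by exists (fun=> 0); split=> // anu; have := lt_le_trans nua anu; rewrite ltxx.
  have [H HC] := ex a Pa (ltW nua); exists H; split=> //.
  - by case: HC.
  - by case: HC.
  - by move=> anu; have := lt_le_trans nua anu; rewrite ltxx.
pose k a := projT1 (cid (kex a)).
have kE a : [/\ P a -> continuous (k a), P a -> forall x, 0 <= k a x <= 1,
    P a -> (nu <= a)%O -> canon (k a) &
    forall (anu : (a <= nu)%O) x, k a x = h (dmap F anu x)] := projT2 (cid (kex a)).
have kC (a b : L) (ab : (a <= b)%O) : P a -> P b -> forall x, k b (dmap F ab x) = k a x.
  move=> Pa Pb x; have [nua|/ltW anu] := le_or_lt nu a.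
    have [_ _ ca _] := kE a; have [_ _ cb _] := kE b.
    by apply: (canon_unique nua (canon_restrict ab nua (cb Pb (le_trans nua ab)))); exact: ca.
  have [_ _ _ /(_ anu) ->] := kE a; have [_ _ cb hb] := kE b.
  have [bnu|/ltW nub] := le_or_lt b nu; first by rewrite (hb bnu) (dmap_dmap ab bnu anu).
  have [_ _ Hh _] := cb Pb nub.
  by rewrite -(dmap_dmap anu nub ab) Hh.
have [H [cH HE]] := colimit_extend (@kF) co (fun a Pa => let: And4 ck _ _ _ := kE a in ck Pa) kC.
exists H; split=> //.
- apply: (colimit_surj (S := [set x | 0 <= H x <= 1]) BT (@kF) co) => a Pa x /=.
  by rewrite HE; have [_ + _ _] := kE a; apply.
- move=> a Pa nua; rewrite (_ : (fun _ => _) = k a).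
    by have [_ _ + _] := kE a; apply.
  by apply/funext => x; rewrite HE.
Qed.

Lemma canon_exists mu : (nu <= mu)%O -> exists H : F mu -> R, canon H.
Proof.
elim/(well_founded_induction (@cd_wf _ _ _ D)): mu => mu IH num.
have nuP : exists H : F nu -> R, canon H.
  exists h; split=> //.
  - by move=> nn x; rewrite (@dmap_id _ _ _ F).
  - move=> i j ij jn nui; have := lt_le_trans ij.1 (le_trans jn nui).
    by rewrite ltxx.
have [?|muNnu] := eqVneq mu nu; first by subst mu.
have ltnm : (nu < mu)%O by rewrite lt_def muNnu.
have [mb|[k km]|ml] := index_cases mu.
- by move: ltnm; rewrite mb ltNge cd_bot_le.
- have nuk := succ_le km ltnm.
  have [H [cH H01 Hh Hc]] := IH k km.1 nuk.
  pose w x := H (att _ _ km x).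
  have cw : continuous w by apply: contcomp => //; exact: mfun_continuous.
  have w0 x : 0 <= w x by case/andP: (H01 (att _ _ km x)).
  have w1 x : w x <= 1 by case/andP: (H01 (att _ _ km x)).
  have [G [cG Ghat Gj]] := pushout_extend (@globe_lifts R _) (@kF k) (att_pushout (cd_attach D km))
     (extend_globe_continuous cw w0 w1) cH (extend_globe_incl w0).
  exists G; split=> //.
  + apply: (pushout_surj (S := [set x | 0 <= G x <= 1])
      (@cd_in_Top _ _ _ D mu) _ _ (att_pushout (cd_attach D km))) => //.
    * exact: globe_lifts.
    * by move=> y /=; rewrite Ghat extend_globe_ge0// extend_globe_le1.
    * by move=> y /=; rewrite Gj.
  + by move=> num' x; rewrite -(dmap_dmap nuk (ltW km.1) num') Gj Hh.
  + move=> i j ij jmu nui y; have [?|jNmu] := eqVneq j mu.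
      subst j; have ? := succ_inj ij km; subst i.
      have ? : ij = km by exact: Prop_irrelevance. subst ij.
      rewrite (@dmap_id _ _ _ F) Ghat; congr (extend_globe _ y); apply/funext => x.
      by rewrite (@dmap_id _ _ _ F) Gj.
    have jk : (j <= k)%O by apply: (succ_le km); rewrite lt_def eq_sym jNmu.
    rewrite -(dmap_dmap jk (ltW km.1) jmu) Gj Hc//.
    by congr (extend_globe _ y); apply/funext => x; rewrite -(dmap_dmap jk (ltW km.1) jmu) Gj.
- have [H [cH H01 HC]] := canon_colimit (@cd_in_Top _ _ _ D mu) (cd_limit ml) ltnm
    (fun a am nua => IH a am nua).
  exists H; split=> //.
  + move=> num' x; have [_ _ /(_ (lexx nu) x) + _] := HC nu ltnm (lexx nu).
    by rewrite (@dmap_id _ _ _ F) (bool_irrelevance num' (ltW ltnm)).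
  (* A limit stage is not a successor, so the cell was attached strictly before [mu], where the
     formula is already known. *)
  + move=> i j ij jmu nui y; have jm : (j < mu)%O.
      rewrite lt_neqAle jmu andbT; apply/eqP => ?; subst j.
      by have [k ik km] := ml.2 i ij.1; have := lt_le_trans km (ij.2 k ik); rewrite ltxx.
    have nuj : (nu <= j)%O by exact: le_trans nui (ltW ij.1).
    have [_ _ _ /(_ i j ij (lexx j) nui y)] := HC j jm nuj.
    rewrite (@dmap_id _ _ _ F) (bool_irrelevance jmu (ltW jm)) => ->.
    by congr (extend_globe _ y); apply/funext => x; rewrite (@dmap_id _ _ _ F).
Qed.

(** The formula on the later cells is kept in the conclusion, since positivity on the open arcs,
    hence closedness of the states, is read off from it. *)
Lemma extend_function : exists H : X -> R,
  [/\ continuous H, forall x, H (leg nu x) = h x &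
    forall (i j : L) (ij : is_succ i j), (nu <= i)%O -> forall y,
      H (leg j (hat _ _ ij y)) = extend_globe (fun x => H (leg i (att _ _ ij x))) y] /\
    forall x, 0 <= H x <= 1.
Proof.
have [H [cH H01 HC]] := canon_colimit hX (cd_colimit D) I (fun a _ nua => canon_exists nua).
exists H; split=> //; split=> //.
- move=> x; have [_ _ /(_ (lexx nu) x) + _] := HC nu I (lexx nu).
  by rewrite (@dmap_id _ _ _ F).
- move=> i j ij nui y; have nuj : (nu <= j)%O by exact: le_trans nui (ltW ij.1).
  have [_ _ _ /(_ i j ij (lexx j) nui y)] := HC j I nuj.
  rewrite (@dmap_id _ _ _ F) => ->; congr (extend_globe _ y); apply/funext => x.
  by rewrite (@dmap_id _ _ _ F) leg_dmap.
Qed.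

End Extend.

End Decomposition.

(** * Arcs of a cellular space *)

(* The set-theoretic content of a cellular decomposition: the space is the
   disjoint union of its states and of open arcs, the interiors of the execution
   paths [h e], which generate all the execution paths. *)
Record arc_structure (R : realType) (X : mpdspace R) (E : Type)
    (h : E -> unitI R -> X) : Prop := ArcStructure {
  arc_exec : forall e, exec X (h e);
  arc_cover : forall x, states X x \/ exists e t, 0 < val t < 1 /\ x = h e t;
  arc_interior : forall e t, 0 < val t < 1 -> ~ states X (h e t);
  arc_inj : forall e t e' t', 0 < val t < 1 -> 0 < val t' < 1 ->
    h e t = h e' t' -> e = e' /\ t = t';
  arc_ind : forall Q : set (unitI R -> X), (forall e, Q (h e)) ->
    (forall g phi, Q g -> calM phi -> Q (g \o phi)) ->
    (forall g1 g2, Q g1 -> Q g2 -> g1 (I1 R) = g2 (I0 R) -> Q (ncomp g1 g2)) ->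
    exec X `<=` Q
}.

Lemma calM_id (R : realType) : calM (@id (unitI R)).
Proof. by split=> // t; exists t. Qed.

Lemma unitI_cases (R : realType) (t : unitI R) :
  [\/ t = I0 R, t = I1 R | 0 < val t < 1].
Proof.
have [t0|t0] := eqVneq t (I0 R); first exact: Or31.
have [t1|t1] := eqVneq t (I1 R); first exact: Or32.
apply: Or33; rewrite !lt_neqAle unitI_ge0 unitI_le1 !andbT.
apply/andP; split; last by apply: contra t1 => /eqP tE; apply/eqP/val_inj; rewrite val_I1.
by apply: contra t0 => /eqP tE; apply/eqP/val_inj; rewrite val_I0.
Qed.

Section Arcs.
Variables (R : realType) (c : top_choice) (X : mpdspace R).
Hypothesis hX : in_Top R c X.
Variable D : cellular_decomposition c X.

Notation L := (cd_index D).
Notation F := (cd_diag D).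
Notation leg := (cd_leg D).

Let kF i : lifts_to_kelley R (F i).
Proof. exact: (in_Top_lifts (@cd_in_Top _ _ _ D i)). Qed.

Record arc := Arc {
  arc_lo : L;
  arc_hi : L;
  arc_succ : is_succ arc_lo arc_hi;
  arc_base : disk R (att_dim (cd_attach D arc_succ));
  arc_int : norm2 (val arc_base) < 1
}.

Definition arc_path (e : arc) (t : unitI R) : X :=
  attaching (ij := arc_succ e) (globe_pt (arc_base e) t).

Lemma attaching_exec (i j : L) (ij : is_succ i j) z :
  exec X (fun t => attaching (ij := ij) (globe_pt z t)).
Proof.
apply: (mfun_exec (leg j)); apply: (mfun_exec (att_hat (cd_attach D ij))).
by exists z, id; split=> //; exact: calM_id.
Qed.

Lemma arc_path_exec e : exec X (arc_path e).
Proof. exact: attaching_exec. Qed.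

Lemma attaching_state (i j : L) (ij : is_succ i j) b :
  states X (attaching (ij := ij) (globe_state R _ b)).
Proof.
apply: (mfun_states (leg j)); apply: (mfun_states (att_hat (cd_attach D ij))).
by exists b.
Qed.

Lemma attaching_incl (i j : L) (ij : is_succ i j) x :
  attaching (ij := ij) (globe_incl R _ x) = leg i (att_map (cd_attach D ij) x).
Proof. by rewrite /attaching (att_pushout (cd_attach D ij)).1 leg_dmap. Qed.

Lemma sphere_or_interior n (z : disk R n) :
  norm2 (val z) < 1 \/ exists y : bsphere R n, z = sphere_incl y.
Proof.
have [z1|z1|z1] := ltgtP (norm2 (val z)) 1; first by left.
  by have := norm2_disk z; rewrite leNgt z1.
right; have yS : val z \in @sphere_set R n by rewrite inE.
by exists (SigSub yS); apply: val_inj.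
Qed.

Lemma globe_pt_incl n (y : bsphere R n) t :
  globe_pt (sphere_incl y) t = globe_incl R n (globe_pt y t).
Proof. by rewrite /= globe_map_funE. Qed.

Lemma globe_state_incl n b : globe_state R (disk R n) b = globe_incl R n (globe_state R _ b).
Proof. by rewrite /= globe_map_funE. Qed.

(** One induction on the stages treats points and paths together, each stage being seen in X through
    its leg. At a successor stage, a path of the globe over an interior point of the disk is a
    reparametrized arc; over a boundary point it comes from the preceding stage through the
    attaching map. *)
Lemma cells_generate (S : set X) (Q : set (unitI R -> X)) :
  (forall g phi, Q g -> calM phi -> Q (g \o phi)) ->
  (forall g1 g2, Q g1 -> Q g2 -> g1 (I1 R) = g2 (I0 R) -> Q (ncomp g1 g2)) ->
  states X `<=` S -> (forall e t, S (arc_path e t)) -> (forall e, Q (arc_path e)) ->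
  (forall x, S x) /\ exec X `<=` Q.
Proof.
move=> Qr Qn Ss Sa Qa; pose Q' : set (unitI R -> X) := [set g | exec X g /\ Q g].
have Q'r g phi : Q' g -> calM phi -> Q' (g \o phi).
  by move=> [eg Qg] Mphi; split; [exact: exec_reparam|exact: Qr].
have Q'n g1 g2 : Q' g1 -> Q' g2 -> g1 (I1 R) = g2 (I0 R) -> Q' (ncomp g1 g2).
  by move=> [e1 Q1] [e2 Q2] g12; split; [exact: exec_ncomp|exact: Qn].
pose Qi (i : L) : set (unitI R -> F i) := [set g | exec (F i) g /\ Q (leg i \o g)].
have Qie i : Qi i `<=` exec (F i) by move=> g [].
have Qir i g phi : Qi i g -> calM phi -> Qi i (g \o phi).
  by move=> [eg Qg] Mphi; split; [exact: exec_reparam|exact: (Qr _ _ Qg Mphi)].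
have Qin i g1 g2 : Qi i g1 -> Qi i g2 -> g1 (I1 R) = g2 (I0 R) -> Qi i (ncomp g1 g2).
  move=> [e1 Q1] [e2 Q2] g12; split; first exact: exec_ncomp.
  by rewrite ncomp_comp; apply: Qn => //=; rewrite g12.
suff stage : forall i, (forall x, S (leg i x)) /\ exec (F i) `<=` Qi i.
  have Q'e : Q' `<=` exec X by move=> g [].
  have /(_ _ _)[] := colimit_generated (S := S) Q'e Q'r Q'n hX (@kF) (cd_colimit D).
  - by move=> i _ x; have [+ _] := stage i; apply.
  - move=> i _ p ep; have [_ /(_ p ep)[_ Qp]] := stage i.
    by split=> //; exact: mfun_exec.
  - by move=> HS HQ; split=> // g /HQ [].
elim/(well_founded_induction (@cd_wf _ _ _ D)) => j IH.
have [jb|[i ij]|jl] := index_cases j.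
- clear IH; subst j; split=> [x|g].
    by apply/Ss/mfun_states; rewrite cd_bot_states.
  by rewrite cd_bot_exec.
- have [Si Qi'] := IH i ij.1.
  apply: (pushout_generated (S := leg j @^-1` S) (@Qie j) (@Qir j) (@Qin j)
    (@cd_in_Top _ _ _ D j) _ _ (att_pushout (cd_attach D ij))) => //.
  + exact: globe_lifts.
  + move=> x /=; elim/globe_ind: x => [b|z t].
      exact/Ss/attaching_state.
    have [z1|[y ->]] := sphere_or_interior z; first exact: (Sa (Arc z1)).
    by rewrite globe_pt_incl (att_pushout (cd_attach D ij)).1 leg_dmap.
  + move=> p ep; split; first exact: mfun_exec.
    move: ep => [z [phi [Mphi ->]]].
    have [z1|[y ->]] := sphere_or_interior z; first exact: (Qr _ _ (Qa (Arc z1)) Mphi).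
    have [_] : Qi i (att_map (cd_attach D ij) \o (fun t => globe_pt y (phi t))).
      by apply: Qi'; apply: mfun_exec; exists y, phi.
    congr Q; apply/funext => t /=.
    by rewrite globe_pt_incl (att_pushout (cd_attach D ij)).1 leg_dmap.
  + by move=> x /=; rewrite leg_dmap.
  + move=> p ep; split; first exact: mfun_exec.
    have [_] := Qi' p ep; congr Q; apply/funext => t /=.
    by rewrite leg_dmap.
- apply: (colimit_generated (S := leg j @^-1` S) (@Qie j) (@Qir j) (@Qin j)
    (@cd_in_Top _ _ _ D j) (@kF) (cd_limit jl)) => i ij.
    by move=> x /=; rewrite leg_dmap; have [+ _] := IH i ij; apply.
  move=> p ep; split; first exact: mfun_exec.
  have [_ /(_ p ep)[_]] := IH i ij; congr Q; apply/funext => t /=.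
  by rewrite leg_dmap.
Qed.

Lemma arc_path_ind (Q : set (unitI R -> X)) : (forall e, Q (arc_path e)) ->
  (forall g phi, Q g -> calM phi -> Q (g \o phi)) ->
  (forall g1 g2, Q g1 -> Q g2 -> g1 (I1 R) = g2 (I0 R) -> Q (ncomp g1 g2)) ->
  exec X `<=` Q.
Proof. by move=> Qa Qr Qn; have [] := @cells_generate setT Q Qr Qn. Qed.

Lemma arc_path_cover x : states X x \/ exists e t, 0 < val t < 1 /\ x = arc_path e t.
Proof.
pose S : set X := [set x | states X x \/ exists e t, 0 < val t < 1 /\ x = arc_path e t].
have [] := @cells_generate S setT; rewrite /S //=; first by move=> y; left.
move=> e t; have [->|->|t01] := unitI_cases t.
- by left; case: (exec_states (arc_path_exec e)).
- by left; case: (exec_states (arc_path_exec e)).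
- by right; exists e, t.
Qed.

Lemma state_leg x : states X x -> forall i, exists y, x = leg i y.
Proof.
move=> sx i; have [_ _ /(_ x sx)[y _ <-]] := cd_bot_bij D.
by exists (dmap F (cd_bot_le i) y); rewrite leg_dmap.
Qed.

(** The function is extended by 0 to the stage of attachment, then to the later cells. Suitable [u]
    separate the points of the new cell from each other and from all earlier points. *)
Lemma cell_function (i j : L) (ij : is_succ i j)
    (u : globe R (disk R (att_dim (cd_attach D ij))) -> R) : continuous u ->
  (forall x, 0 <= u x <= 1) -> (forall x, u (globe_incl R _ x) = 0) ->
  exists H : X -> R, [/\ continuous H, forall x, H (leg i x) = 0 &
    forall y, H (attaching (ij := ij) y) = u y].
Proof.
move=> cu u01 u0.
have [h [ch hh hi]] := pushout_extend (v := fun=> 0) (@globe_lifts R _) (@kF i)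
  (att_pushout (cd_attach D ij)) cu (@contC _ _ _) u0.
have h01 : forall x, 0 <= h x <= 1.
  apply: (pushout_surj (S := [set x | 0 <= h x <= 1])
    (@cd_in_Top _ _ _ D j) _ _ (att_pushout (cd_attach D ij))) => //.
  - exact: globe_lifts.
  - by move=> y /=; rewrite hh.
  - by move=> y /=; rewrite hi lexx ler01.
have [H [[cH Hh _] _]] := extend_function hX ch h01.
exists H; split=> // [x|y]; last by rewrite Hh hh.
by rewrite -(leg_dmap (ltW ij.1)) Hh hi.
Qed.

Lemma arc_path_function e t : 0 < val t < 1 -> exists H : X -> R,
  [/\ continuous H, forall x, H (leg (arc_lo e) x) = 0 & H (arc_path e t) != 0].
Proof.
move=> t01; have q01 : forall x : disk R (att_dim (cd_attach D (arc_succ e))) * unitI R,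
  0 <= (fun=> 1 : R) x <= 1 by move=> _; rewrite ler01 lexx.
have [u [cu u01 u0 uE]] := bump_extend (@contC _ _ _) q01.
have [H [cH H0 HE]] := cell_function cu u01 u0; exists H; split=> //.
by rewrite HE uE mulr1 gt_eqF// bump_gt0// arc_int.
Qed.

Lemma arc_path_interior e t : 0 < val t < 1 -> ~ states X (arc_path e t).
Proof.
move=> t01 /state_leg/(_ (arc_lo e))[y yE].
by have [H [_ H0 /eqP]] := arc_path_function e t01; rewrite yE.
Qed.

(** For cells attached at different stages, a function of the later cell vanishes at the earlier
    point; on one cell [bump_separate] applies. The hypothesis is on functions rather than an
    equality of points, so that the Hausdorff property follows as well as the injectivity of
    arcs. *)
Lemma arc_path_separated e t e' t' : 0 < val t < 1 -> 0 < val t' < 1 ->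
  (forall H : X -> R, continuous H -> H (arc_path e t) = H (arc_path e' t')) ->
  e = e' /\ t = t'.
Proof.
have lt_hi e1 t1 e2 t2 : 0 < val t1 < 1 -> (arc_hi e2 < arc_hi e1)%O ->
    exists2 H : X -> R, continuous H & H (arc_path e1 t1) <> H (arc_path e2 t2).
  move=> t101 e21; have [H [cH H0 HE]] := arc_path_function e1 t101.
  exists H => //; have hl := succ_le (arc_succ e1) e21.
  rewrite [arc_path e2 t2](_ : _ = leg (arc_lo e1) (dmap F hl
    (att_hat (cd_attach D (arc_succ e2)) (globe_pt (arc_base e2) t2)))).
    by rewrite H0; exact/eqP.
  by rewrite leg_dmap.
move=> t01 t'01 HH; have [ee'|e'e|eE] := ltgtP (arc_hi e) (arc_hi e').
- by have [H cH []] := lt_hi e' t' e t t'01 ee'; rewrite HH.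
- by have [H cH []] := lt_hi e t e' t' t01 e'e; rewrite HH.
move: e e' HH eE => [i j ij z z1] [i' j' ij' z' z'1] HH /= ?; subst j'.
have ? := succ_inj ij ij'; subst i'.
have ? : ij = ij' by exact: Prop_irrelevance.
subst ij'; have [|? ?] := bump_separate (z := z) (t := t) (z' := z') (t' := t') z1 t01.
  move=> u cu u01 u0; have [H [cH _ HE]] := cell_function cu u01 u0.
  by have := HH H cH; rewrite /arc_path /= !HE.
by subst z' t'; rewrite (bool_irrelevance z1 z'1).
Qed.

Lemma function_separated x y :
  (forall H : X -> R, continuous H -> H x = H y) -> x = y.
Proof.
have state_arc x' e t : states X x' -> 0 < val t < 1 ->
    exists2 H : X -> R, continuous H & H x' <> H (arc_path e t).
  move=> /state_leg/(_ (arc_lo e))[y' ->] t01.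
  have [H [cH H0 HE]] := arc_path_function e t01; exists H => //.
  by rewrite H0; apply/eqP; rewrite eq_sym.
move=> HH.
have [sx|[e [t [t01 xE]]]] := arc_path_cover x; have [sy|[e' [t' [t'01 yE]]]] := arc_path_cover y.
- have [x' xE] := state_leg sx (cd_bot D); have [y' yE] := state_leg sy (cd_bot D).
  (* Two states are told apart by an indicator function on the bottom stage, continuous because this
     stage is discrete. *)
  pose h z : R := (z == x')%:R.
  have ch : continuous h by apply/continuousP => U _; exact: cd_bot_discrete.
  have h01 z : 0 <= h z <= 1 by rewrite /h; case: eqP; rewrite ?lexx ?ler01.
  have [H [[cH Hh _] _]] := extend_function hX ch h01.
  have := HH H cH; rewrite xE yE !Hh /h eqxx; case: eqP => [->//|_] /eqP.
  by rewrite oner_eq0.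
- by have [H cH []] := state_arc x e' t' sx t'01; rewrite (HH H cH) -yE.
- by have [H cH []] := state_arc y e t sy t01; rewrite -xE (HH H cH).
- have [|ee' tt'] := @arc_path_separated e t e' t' t01 t'01; last by rewrite xE yE ee' tt'.
  by rewrite -xE -yE.
Qed.

Lemma cellular_hausdorff : hausdorff_space X.
Proof.
move=> x y xy; apply: function_separated => H cH.
apply: (@Rhausdorff R) => A B /cH nA /cH nB.
by have [z [Az Bz]] := xy _ _ nA nB; exists (H z).
Qed.

(** The zero function of the bottom stage extends to a function that is positive on every open arc,
    so that the states are its zero set. *)
Lemma cellular_states_closed : closed (states X).
Proof.
have ch : continuous (fun _ : F (cd_bot D) => 0 : R) by exact: contC.
have [|H [[cH Hh Hc] H01]] := extend_function hX ch; first by move=> _; rewrite lexx ler01.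
suff -> : states X = H @^-1` [set 0] by apply: continuous_closed => //; exact: closed_eq.
apply/seteqP; split=> x /=.
  by move=> /state_leg/(_ (cd_bot D))[y ->].
have [//|[e [t [/andP[t0 t1] ->]]]] := arc_path_cover x.
rewrite /arc_path /attaching Hc ?cd_bot_le//.
set w := fun _ => _; have w01 y : 0 <= w y <= 1 by exact: H01.
have w0 y : 0 <= w y by case/andP: (w01 y).
rewrite extend_globe_pt// => /eqP; rewrite gt_eqF// extend_pt_gt0//.
by rewrite -[ltRHS]sqrtr1 ltr_sqrt// arc_int.
Qed.

Lemma arc_path_arc_structure : arc_structure arc_path.
Proof.
split.
- exact: arc_path_exec.
- exact: arc_path_cover.
- exact: arc_path_interior.
- move=> e t e' t' t01 t'01 ee'; apply: arc_path_separated => // H _.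
  by rewrite ee'.
- exact: arc_path_ind.
Qed.

Lemma cell_point (e : cell D) x : cell_set e x ->
  (states X x /\ cell_init e = x /\ cell_final e = x) \/
  exists e' t, [/\ 0 < val t < 1, x = arc_path e' t,
    cell_init e = arc_path e' (I0 R) & cell_final e = arc_path e' (I1 R)].
Proof.
case: e => [a sa|i j ij] /= => [->|[y ny <-]]; first by left.
right; move: y ny; elim/globe_ind => [b|z t] ny.
  by case: ny; rewrite globe_state_incl; exists (globe_state R _ b).
have [z1|[y yE]] := sphere_or_interior z; last first.
  by case: ny; rewrite yE globe_pt_incl; exists (globe_pt y t).
exists (Arc z1), t; split=> //.
- have [tE|tE|//] := unitI_cases t; case: ny; rewrite tE.
    by rewrite globe_pt_I0 globe_state_incl; exists (globe_state R _ false).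
  by rewrite globe_pt_I1 globe_state_incl; exists (globe_state R _ true).
- by rewrite /arc_path globe_pt_I0.
- by rewrite /arc_path globe_pt_I1.
Qed.

(** [point_init] chooses among the cells containing the point, so all of them have to give the same
    answer. *)
Lemma point_init_state x : states X x -> point_init D x = x.
Proof.
move=> sx; apply: xget_unique; first by exists (Vertex D sx).
move=> y [e /cell_point[[_ [-> _]]//|[e' [t [t01 xE _ _]]]]].
by move: sx; rewrite xE => /(arc_path_interior t01).
Qed.

Lemma point_final_state x : states X x -> point_final D x = x.
Proof.
move=> sx; apply: xget_unique; first by exists (Vertex D sx).
move=> y [e /cell_point[[_ [_ ->]]//|[e' [t [t01 xE _ _]]]]].
by move: sx; rewrite xE => /(arc_path_interior t01).
Qed.

Lemma arc_path_cell e t : 0 < val t < 1 ->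
  cell_set (GlobularCell (D := D) (arc_succ e)) (arc_path e t).
Proof.
move=> t01; exists (globe_pt (arc_base e) t) => // -[y _ yE].
apply: (arc_path_interior (e := e) t01) => //.
have [H [cH H0 /eqP]] := arc_path_function e t01.
by rewrite /arc_path -yE attaching_incl.
Qed.

Lemma point_init_arc e t : 0 < val t < 1 ->
  point_init D (arc_path e t) = arc_path e (I0 R).
Proof.
move=> t01; apply: xget_unique.
  exists (GlobularCell (D := D) (arc_succ e)); first exact: arc_path_cell.
  by rewrite /arc_path globe_pt_I0.
move=> y [e' /cell_point[[/(arc_path_interior t01)//]|[e'' [t' [t'01 ee' iE _]]]]] ->.
by rewrite iE; have [-> _] := arc_inj arc_path_arc_structure t01 t'01 ee'.
Qed.

Lemma point_final_arc e t : 0 < val t < 1 ->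
  point_final D (arc_path e t) = arc_path e (I1 R).
Proof.
move=> t01; apply: xget_unique.
  exists (GlobularCell (D := D) (arc_succ e)); first exact: arc_path_cell.
  by rewrite /arc_path globe_pt_I1.
move=> y [e' /cell_point[[/(arc_path_interior t01)//]|[e'' [t' [t'01 ee' _ iE]]]]] ->.
by rewrite iE; have [-> _] := arc_inj arc_path_arc_structure t01 t'01 ee'.
Qed.

End Arcs.

(** * Following the arcs *)

Section Ramps.
Variable R : realType.
Implicit Types psi phi : R -> R.

Definition mono_cont phi := continuous phi /\ {homo phi : x y / x <= y}.

(** Parametrizations live on the whole real line, with clamping in place of subtypes: affine changes
    of time, gluing and the intermediate value theorem then need no bookkeeping of domains. *)
Definition ramp psi := mono_cont psi /\ forall t, 0 <= psi t <= 1.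

Lemma contid : continuous (fun t : R => t).
Proof. by move=> t; exact: cvg_id. Qed.

Lemma mono_cont_comp phi psi : mono_cont phi -> mono_cont psi ->
  mono_cont (fun t => psi (phi t)).
Proof.
move=> [c1 m1] [c2 m2]; split; first exact: contcomp.
by move=> x y xy; apply/m2/m1.
Qed.

Lemma mono_cont_affine (k b : R) : 0 <= k -> mono_cont (fun t => k * t + b).
Proof.
move=> k0; split; last by move=> x y xy; rewrite lerD2r ler_wpM2l.
by apply: contD; [apply: contM; [exact: contC|exact: contid]|exact: contC].
Qed.

Lemma mono_cont_min (m : R) : mono_cont (fun t => Num.min t m).
Proof.
split; first by apply: contmin; [exact: contid|exact: contC].
by move=> x y xy; rewrite le_min ge_min xy /= ge_min lexx orbT.
Qed.

Lemma mono_cont_max (m : R) : mono_cont (fun t => Num.max t m).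
Proof.
split; first by apply: contmax; [exact: contid|exact: contC].
by move=> x y xy; rewrite ge_max le_max xy /= le_max lexx orbT.
Qed.

Lemma mono_cont_opp phi : mono_cont phi -> mono_cont (fun t => - phi (- t)).
Proof.
move=> [c m]; split; last by move=> x y xy; rewrite lerN2; apply: m; rewrite lerN2.
have co : continuous (fun t : R => - t).
  rewrite (_ : (fun _ => _) = fun t : R => 0 - t); last by apply/funext => t; rewrite sub0r.
  by apply: contB; [exact: contC|exact: contid].
by apply: (contcomp (f := fun t => phi (- t))) => //; exact: contcomp.
Qed.

Lemma ramp_comp phi psi : mono_cont phi -> ramp psi -> ramp (fun t => psi (phi t)).
Proof. by move=> cp [cq q01]; split=> //; exact: mono_cont_comp. Qed.

Lemma ramp_clamp : ramp (fun t => val (clampI t)).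
Proof.
split; last by move=> t; rewrite unitI_ge0 unitI_le1.
split; first exact: (contcomp (@clampI_continuous R) (@unitI_val_continuous R)).
move=> x y xy /=; rewrite ge_max le_max lexx /= le_max; apply/orP; right.
by rewrite le_min ge_min lexx /= ge_min xy orbT.
Qed.

Lemma ramp_clampK psi t : ramp psi -> val (clampI (psi t)) = psi t.
Proof. by move=> [_ /(_ t)/andP[? ?]]; rewrite clampIK. Qed.

Lemma calI_ramp (phi : unitI R -> unitI R) : calI phi ->
  ramp (fun t => val (phi (clampI t))).
Proof.
move=> [mp cp]; split; last by move=> t; rewrite unitI_ge0 unitI_le1.
split; last by move=> x y xy; apply: mp; have [[_ m] _] := ramp_clamp; exact: m.
apply: (contcomp (f := fun t => phi (clampI t))); last exact: unitI_val_continuous.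
by apply: contcomp => //; exact: clampI_continuous.
Qed.

Lemma ramp_calI psi : ramp psi -> calI (fun t => clampI (psi (val t))).
Proof.
move=> rp; have [[cp mp] p01] := rp; split.
  by move=> s t st; rewrite !ramp_clampK//; exact: mp.
apply: contcomp; last exact: clampI_continuous.
by apply: contcomp => //; exact: unitI_val_continuous.
Qed.

Lemma calM_calI (phi : unitI R -> unitI R) : calM phi -> calI phi.
Proof. by move=> Mphi; split; [case: Mphi|exact: calM_continuous]. Qed.

Lemma mono_cont_ivt phi a b v : a <= b -> mono_cont phi -> phi a <= v <= phi b ->
  exists2 t, a <= t <= b & phi t = v.
Proof.
move=> ab [cp mp] /andP[av vb].
have [|t] := @IVT R phi a b v ab (continuous_subspaceT cp).
  by rewrite ge_min le_max av vb orbT.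
by rewrite in_itv /= => tab tv; exists t.
Qed.

Lemma calI_calM (phi : unitI R -> unitI R) : calI phi -> phi (I0 R) = I0 R ->
  phi (I1 R) = I1 R -> calM phi.
Proof.
move=> Iphi p0 p1; split; first by case: Iphi.
move=> t; have [c01 _] := calI_ramp Iphi.
have [||s /andP[s0 s1] sE] := @mono_cont_ivt _ 0 1 (val t) _ c01; first exact: ler01.
  by rewrite -/(I0 R) -/(I1 R) p0 p1 val_I0 val_I1 unitI_ge0 unitI_le1.
by exists (clampI s); apply: val_inj.
Qed.

Lemma ramp_glue psi1 psi2 m : ramp psi1 -> ramp psi2 -> psi1 m = psi2 m ->
  exists psi, [/\ ramp psi, forall t, t <= m -> psi t = psi1 t &
    forall t, m <= t -> psi t = psi2 t].
Proof.
(* On either side of [m] one of the first two terms is frozen at the common value, which is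
   subtracted; continuity and monotonicity need no case distinction. *)
move=> r1 r2 m12; pose psi t := psi1 (Num.min t m) + psi2 (Num.max t m) - psi1 m.
have E1 t : t <= m -> psi t = psi1 t.
  by move=> tm; rewrite /psi min_l// max_r// m12 addrK.
have E2 t : m <= t -> psi t = psi2 t.
  by move=> tm; rewrite /psi min_r// max_l// addrC addKr.
have [[c1 m1] _] := ramp_comp (mono_cont_min m) r1.
have [[c2 m2] _] := ramp_comp (mono_cont_max m) r2.
exists psi; split=> //; split; first split.
- by apply: contB; [exact: contD|exact: contC].
- by move=> x y xy; rewrite lerD2r lerD ?m1 ?m2.
- move=> t; have [tm|/ltW tm] := leP t m; first by rewrite E1//; case: r1.
  by rewrite E2//; case: r2.
Qed.

Definition revI (t : unitI R) : unitI R := clampI (1 - val t).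

Lemma val_revI t : val (revI t) = 1 - val t.
Proof. by rewrite clampIK ?subr_ge0 ?unitI_le1// lerBlDr lerDl unitI_ge0. Qed.

Lemma revIK : involutive revI.
Proof. by move=> t; apply: val_inj; rewrite !val_revI; ring. Qed.

Lemma revI_I0 : revI (I0 R) = I1 R.
Proof. by apply: val_inj; rewrite val_revI val_I0 val_I1 subr0. Qed.

Lemma revI_I1 : revI (I1 R) = I0 R.
Proof. by apply: val_inj; rewrite val_revI val_I0 val_I1 subrr. Qed.

Lemma revI_interior t : 0 < val t < 1 -> 0 < val (revI t) < 1.
Proof. by rewrite val_revI => /andP[? ?]; rewrite subr_gt0 ltrBlDr ltrDl; apply/andP. Qed.

Lemma revI_continuous : continuous revI.
Proof.
apply: contcomp; last exact: clampI_continuous.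
by apply: contB; [exact: contC|exact: unitI_val_continuous].
Qed.

End Ramps.

Section Flows.
Variables (R : realType) (T E : Type) (Sg : set T).
Implicit Types (h : E -> unitI R -> T) (p : R -> T).

(** The part of [arc_structure] that survives time reversal. *)
Definition arc_family h :=
  [/\ forall e, Sg (h e (I0 R)) /\ Sg (h e (I1 R)),
    forall e t, 0 < val t < 1 -> ~ Sg (h e t) &
    forall e t e' t', 0 < val t < 1 -> 0 < val t' < 1 -> h e t = h e' t' ->
      e = e' /\ t = t'].

Definition rev_arc h e t := h e (revI t).

Lemma rev_arc_family h : arc_family h -> arc_family (rev_arc h).
Proof.
move=> [he hi hj]; split.
- by move=> e; rewrite /rev_arc revI_I0 revI_I1; have [] := he e.
- by move=> e t t01; apply: hi; exact: revI_interior.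
- move=> e t e' t' t01 t'01 /(hj _ _ _ _ (revI_interior t01) (revI_interior t'01))[-> tt'].
  by rewrite -[t]revIK tt' revIK.
Qed.

(** An interior point of an arc is not a state, so it is not an end of any arc either. *)
Lemma arc_family_inj h e t e' t' : arc_family h -> 0 < val t < 1 ->
  h e' t' = h e t -> e' = e /\ t' = t.
Proof.
move=> [he hi hj] t01 E'; have [t'E|t'E|t'01] := unitI_cases t'; last exact: hj.
  by case: (hi e t t01); rewrite -E' t'E; case: (he e').
by case: (hi e t t01); rewrite -E' t'E; case: (he e').
Qed.

Lemma arc_family_end h e (psi : R -> R) t : arc_family h -> ramp psi -> 0 < psi t ->
  Sg (h e (clampI (psi t))) -> psi t = 1.
Proof.
move=> [_ hi _] rp p0 st; rewrite -(ramp_clampK t rp).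
have [pE|->|p01] := unitI_cases (clampI (psi t)); last by case: (hi e _ p01 st).
  by move: p0; rewrite -(ramp_clampK t rp) pE val_I0 ltxx.
by rewrite val_I1.
Qed.

(* From any point of an open arc, [p] follows this arc until [p] or the arc
   ends. *)
Definition fflow h (a b : R) p := forall s e r, a <= s -> s <= b -> 0 < val r < 1 ->
  p s = h e r -> exists s' psi, [/\ s <= s', s' <= b, ramp psi,
    forall t, s <= t -> t <= s' -> p t = h e (clampI (psi t)) &
    s' = b \/ psi s' = 1].

(** The second half is the same property backwards in time, written for the reversed path along the
    reversed arcs so that each lemma on [fflow] serves twice. *)
Definition flow h a b p :=
  fflow h a b p /\ fflow (rev_arc h) (- b) (- a) (fun t => p (- t)).

Lemma fflow_ext h a b p q : (forall t, a <= t -> t <= b -> p t = q t) ->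
  fflow h a b p -> fflow h a b q.
Proof.
move=> pq fp s e r as_ sb r01 qs; have [|s' [psi [ss' s'b rp pE pend]]] := fp s e r as_ sb r01.
  by rewrite pq.
exists s', psi; split=> // t st ts'; rewrite -pq ?pE//; first exact: le_trans st.
exact: le_trans s'b.
Qed.

Lemma flow_ext h a b p q : (forall t, a <= t -> t <= b -> p t = q t) ->
  flow h a b p -> flow h a b q.
Proof.
move=> pq [fp bp]; split; first exact: fflow_ext fp.
by apply: fflow_ext bp => t ta tb; apply: pq; [rewrite lerNr|rewrite lerNl].
Qed.

(** The new stopping time is one at which [phi] takes the old value, by the intermediate value
    theorem; if [phi] does not go beyond this value, the arc is followed up to [b']. *)
Lemma fflow_reparam h a b p a' b' phi : mono_cont phi -> a <= phi a' -> phi b' <= b ->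
  fflow h a b p -> fflow h a' b' (fun t => p (phi t)).
Proof.
move=> cp pa pb fp s e r as_ sb r01 ps; have [_ mp] := cp.
have [|s' [psi [ss' s'b rp pE pend]]] := fp _ e r (le_trans pa (mp _ _ as_)) (le_trans (mp _ _ sb) pb) r01 => //.
have [bs'|s'b'] := leP (phi b') s'.
  exists b', (fun t => psi (phi t)); split=> //; first exact: ramp_comp.
    by move=> t st tb; apply: pE; [exact: mp|exact: le_trans (mp _ _ tb) bs'].
  by left.
have [|s'' /andP[ss'' s''b] s''E] := mono_cont_ivt sb cp (v := s'); first by rewrite ss' ltW.
exists s'', (fun t => psi (phi t)); split=> //; first exact: ramp_comp.
  by move=> t st ts''; apply: pE; [exact: mp|rewrite -s''E; exact: mp].
by right; rewrite s''E; case: pend => // s'E; move: s'b'; rewrite s'E ltNge pb.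
Qed.

Lemma flow_reparam h a b p a' b' phi : mono_cont phi -> a <= phi a' -> phi b' <= b ->
  flow h a b p -> flow h a' b' (fun t => p (phi t)).
Proof.
move=> cp pa pb [fp bp]; split; first exact: fflow_reparam fp.
apply: (@fflow_ext _ _ _ (fun t => p (- - phi (- t)))); first by move=> t _ _; rewrite opprK.
by apply: (fflow_reparam (mono_cont_opp cp) _ _ bp); rewrite opprK lerN2.
Qed.

(** If the path is still inside the arc at [m], the second flow takes over from there. The two
    parametrizations agree at [m] by injectivity of the open arcs, and they are glued. *)
Lemma fflow_cat h a m b p : arc_family h -> a <= m -> m <= b ->
  fflow h a m p -> fflow h m b p -> fflow h a b p.
Proof.
move=> hh am mb f1 f2 s e r as_ sb r01 ps.
have [sm|/ltW ms] := leP s m; last first.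
  have [s' [psi [ss' s'b rp pE pend]]] := f2 s e r ms sb r01 ps.
  by exists s', psi.
have [s' [psi [ss' s'm rp pE pend]]] := f1 s e r as_ sm r01 ps.
have s'b := le_trans s'm mb; have [psi1|psi1] := eqVneq (psi s') 1.
  by exists s', psi; split=> //; right.
have {pend} s'E : s' = m by case: pend => // /eqP; rewrite (negbTE psi1).
subst s'; have rE : clampI (psi s) = r.
  by have [] := arc_family_inj hh r01 (esym (etrans (esym ps) (pE s (lexx s) sm))).
have pm01 : 0 < val (clampI (psi m)) < 1.
  rewrite ramp_clampK//; have [[_ mp] p01] := rp; apply/andP; split.
    apply: lt_le_trans (mp _ _ sm); rewrite -(ramp_clampK s rp) rE.
    by case/andP: r01.
  by rewrite lt_neqAle psi1; case/andP: (p01 m).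
have [s'' [psi' [ms'' s''b rp' pE' pend']]] := f2 m e _ (lexx m) mb pm01 (pE m ss' (lexx m)).
have psiE : psi m = psi' m.
  rewrite -(ramp_clampK m rp) -(ramp_clampK m rp'); congr val.
  by have [_ ->] := arc_family_inj hh pm01 (esym (etrans (esym (pE m ss' (lexx m))) (pE' m (lexx m) ms''))).
have [Psi [rP P1 P2]] := ramp_glue rp rp' psiE.
exists s'', Psi; split=> //; first exact: le_trans ms''.
  move=> t st ts''; have [tm|/ltW mt] := leP t m; first by rewrite P1// pE.
  by rewrite P2// pE'.
by rewrite P2.
Qed.

Lemma flow_cat h a m b p : arc_family h -> a <= m -> m <= b ->
  flow h a m p -> flow h m b p -> flow h a b p.
Proof.
move=> hh am mb [f1 b1] [f2 b2]; split; first exact: fflow_cat f1 f2.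
by apply: (fflow_cat (rev_arc_family hh) _ _ b2 b1); rewrite lerN2.
Qed.

Lemma fflow_arc h e : arc_family h -> fflow h 0 1 (fun t => h e (clampI t)).
Proof.
move=> hh s e' r s0 s1 r01 /(arc_family_inj hh r01)[<- rE].
exists 1, (fun t => val (clampI t)); split=> //; first exact: ramp_clamp.
  by move=> t _ _; rewrite clampI_val.
by left.
Qed.

Lemma flow_arc h e : arc_family h -> flow h 0 1 (fun t => h e (clampI t)).
Proof.
move=> hh; split; first exact: fflow_arc.
(* The reversed arc is followed on [0,1] while the backward condition lives on [-1,0], whence the
   translation by 1. *)
have m1 : mono_cont (fun t : R => 1 * t + 1) by exact: mono_cont_affine.
have := fflow_reparam (a' := -1) (b' := -0) m1 _ _ (@fflow_arc _ e (rev_arc_family hh)).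
rewrite oppr0 mulr0 add0r mul1r addNr => /(_ (lexx _) (lexx _)).
apply: fflow_ext => t tm1 t0; rewrite /rev_arc; congr (h e); apply: val_inj.
by rewrite val_revI !clampIK; lra.
Qed.

Lemma fflow_const h a b x : fflow h a b (fun=> x).
Proof.
move=> s e r as_ sb r01 xE; exists b, (fun=> val r); split=> //; last by left.
  split; last by move=> t; rewrite unitI_ge0 unitI_le1.
  by split=> //; exact: contC.
by move=> t _ _; rewrite clampI_val.
Qed.

Lemma flow_const h a b x : flow h a b (fun=> x).
Proof. by split; exact: fflow_const. Qed.

End Flows.

Section ExecFlow.
Variables (R : realType) (X : mpdspace R) (E : Type) (h : E -> unitI R -> X).
Hypothesis hX : arc_structure h.

Lemma arc_structure_family : arc_family (states X) h.
Proof.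
split; [move=> e; exact: exec_states (arc_exec hX e)|exact: arc_interior hX|].
exact: arc_inj hX.
Qed.
Let hh := arc_structure_family.

Lemma exec_flow g : exec X g -> flow h 0 1 (fun t => g (clampI t)).
Proof.
move: g; apply: (arc_ind hX (Q := [set g : unitI R -> X | flow h 0 1 (fun t => g (clampI t))])).
- by move=> e; exact: flow_arc hh.
- move=> g phi /= fg /calM_calI/calI_ramp[cphi p01].
  apply: (@flow_ext _ _ _ _ _ _ (fun t => g (clampI (val (phi (clampI t)))))).
    by move=> t _ _; rewrite clampI_val.
  by apply: (flow_reparam cphi _ _ fg); [case/andP: (p01 0)|case/andP: (p01 1)].
- move=> g1 g2 /= f1 f2 g12; have h0 : 0 <= 2^-1 :> R by rewrite invr_ge0.
  have h1 : 2^-1 <= 1 :> R by rewrite invf_le1// ler1n.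
  apply: (@flow_cat _ _ _ _ h 0 2^-1 1 _ hh) => //.
  + have m2 : mono_cont (fun t : R => 2 * t + 0) by exact: mono_cont_affine.
    have := flow_reparam (a' := 0) (b' := 2^-1) m2 _ _ f1.
    rewrite mulr0 !addr0 mulfV ?pnatr_eq0// => /(_ (lexx _) (lexx _)).
    by apply: flow_ext => t t0 t2; rewrite /ncomp clampIK ?t2// ?addr0//; lra.
  + have m2 : mono_cont (fun t : R => 2 * t + -1) by exact: mono_cont_affine.
    have := flow_reparam (a' := 2^-1) (b' := 1) m2 _ _ f2.
    rewrite mulfV ?pnatr_eq0// subrr => /(_ (lexx _)).
    have -> : 2 * 1 - 1 = 1 :> R by lra.
    move=> /(_ (lexx _)); apply: flow_ext => t t2 t1.
    rewrite /ncomp clampIK//; last by lra.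
    case: ifPn => // t2'; have -> : t = 2^-1 by apply/le_anti/andP.
    by rewrite mulfV ?pnatr_eq0// subrr -/(I0 R) -/(I1 R).
Qed.

Lemma moore_dpath_flow l p : moore_dpath l p -> 0 < l /\ flow h 0 l p.
Proof.
elim=> {l p} [l g phi l0 eg Iphi|l1 l2 p1 p2 _ [l10 f1] _ [l20 f2] p12].
  split=> //; have [cphi p01] := calI_ramp Iphi.
  have ml : mono_cont (fun t : R => l^-1 * t + 0) by apply: mono_cont_affine; rewrite invr_ge0 ltW.
  have /andP[q0 _] := p01 (l^-1 * 0 + 0); have /andP[_ q1] := p01 (l^-1 * l + 0).
  have := flow_reparam (a' := 0) (b' := l) (mono_cont_comp ml cphi) q0 q1 (exec_flow eg).
  by apply: flow_ext => t _ _; rewrite /= clampI_val /mu addr0 mulrC.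
have l12 : l1 <= l1 + l2 by rewrite lerDl ltW.
split; first exact: addr_gt0.
apply: (@flow_cat _ _ _ _ h 0 l1 (l1 + l2) _ hh) => //; first exact: ltW.
  by apply: flow_ext f1 => t _ tl; rewrite /moore_comp tl.
have ml : mono_cont (fun t : R => 1 * t + - l1) by exact: mono_cont_affine.
have := flow_reparam (a' := l1) (b' := l1 + l2) ml _ _ f2.
rewrite !mul1r subrr => /(_ (lexx _)); rewrite addrAC subrr add0r => /(_ (lexx _)).
apply: flow_ext => t l1t _; rewrite mul1r /moore_comp; case: ifPn => // tl1.
by have -> : t = l1; [apply/le_anti/andP|rewrite subrr].
Qed.

Lemma dpath_flow g : dpath g -> flow h 0 1 (fun t => g (clampI t)).
Proof.
case=> [[x ->]|[p /moore_dpath_flow[_ fp] gp]]; first exact: flow_const.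
by apply: flow_ext fp => t t0 t1; rewrite gp clampIK.
Qed.

End ExecFlow.

(** * Directed paths *)

Lemma calI_comp (R : realType) (phi psi : unitI R -> unitI R) :
  calI phi -> calI psi -> calI (phi \o psi).
Proof.
move=> [m1 c1] [m2 c2]; split; first by move=> s t st; exact/m1/m2.
exact: contcomp.
Qed.

Section DirectedPaths.
Variables (R : realType) (X : mpdspace R).

(* Directed paths of length [l], seen on [0, l] only. *)
Definition dir_path (l : R) (p : R -> X) :=
  (exists x, forall t, 0 <= t -> t <= l -> p t = x) \/
  exists2 p', moore_dpath l p' & forall t, 0 <= t -> t <= l -> p t = p' t.

Lemma dir_path_ext l p q : (forall t, 0 <= t -> t <= l -> p t = q t) ->
  dir_path l p -> dir_path l q.
Proof.
move=> pq [[x px]|[p' mp pp']]; [left; exists x|right; exists p'] => // t t0 tl.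
  by rewrite -pq ?px.
by rewrite -pq ?pp'.
Qed.

Lemma dpath_dir_path (g : unitI R -> X) : dpath g <-> dir_path 1 (fun t => g (clampI t)).
Proof.
split=> [[[x ->]|[p mp gp]]|[[x gx]|[p mp gp]]].
- by left; exists x.
- by right; exists p => // t t0 t1; rewrite gp clampIK.
- by left; exists x; apply/funext => t; rewrite -(gx (val t)) ?clampI_val ?unitI_ge0 ?unitI_le1.
- right; exists p => // t; rewrite -gp ?clampI_val ?unitI_ge0 ?unitI_le1//.
Qed.

Lemma moore_dpath_gt0 l p : @moore_dpath R X l p -> 0 < l.
Proof. by elim=> // *; exact: addr_gt0. Qed.

(** On a single execution path [phi] is absorbed in the map of [calI]. For a composite, the range of
    [phi] may lie before the junction [l1], after it, or across it; in the last case time is cut at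
    some [m] with [phi m = l1]. As [phi] need not be onto, segments and truncations of directed
    paths are directed. *)
Lemma moore_dpath_reparam l p : @moore_dpath R X l p -> forall l' phi, 0 < l' ->
  mono_cont phi -> 0 <= phi 0 -> phi l' <= l ->
  exists2 p', moore_dpath l' p' & forall t, 0 <= t -> t <= l' -> p (phi t) = p' t.
Proof.
elim=> {l p} [l g psi l0 eg Ipsi|l1 l2 p1 p2 m1 IH1 m2 IH2 p12] l' phi l'0 cphi phi0 phil.
  have c1 : mono_cont (fun t : R => l' * t + 0) by apply: mono_cont_affine; exact: ltW.
  have c2 : mono_cont (fun t : R => l^-1 * t + 0).
    by apply: mono_cont_affine; rewrite invr_ge0 ltW.
  have r := ramp_comp (mono_cont_comp (mono_cont_comp c1 cphi) c2) (@ramp_clamp R).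
  exists (g \o (psi \o (fun u => clampI (val (clampI (l^-1 * phi (l' * val u + 0) + 0))))) \o mu l').
    by apply: MooreExec => //; apply: calI_comp => //; exact: (ramp_calI r).
  move=> t t0 tl'.
  rewrite -[RHS]/(g (psi (clampI (val (clampI (l^-1 * phi (l' * val (clampI (t / l')) + 0) + 0)))))).
  rewrite clampI_val clampIK; first last.
  - by rewrite ler_pdivrMr ?mul1r.
  - by rewrite divr_ge0// ltW.
  by rewrite !addr0 mulrCA mulfV ?gt_eqF// mulr1 [l^-1 * _]mulrC.
have l10 := moore_dpath_gt0 m1; have l20 := moore_dpath_gt0 m2.
have [cp mp] := cphi.
have [pl1|l1p] := leP (phi l') l1.
  have [p' mp' pE] := IH1 l' phi l'0 cphi phi0 pl1; exists p' => // t t0 tl'.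
  by rewrite -pE// /moore_comp (le_trans (mp _ _ tl') pl1).
have ca : mono_cont (fun t : R => 1 * t + - l1) by exact: mono_cont_affine.
have [l1p0|p0l1] := leP l1 (phi 0).
  have [||p' mp' pE] := IH2 l' _ l'0 (mono_cont_comp cphi ca); rewrite ?mul1r; [lra|lra|].
  exists p' => // t t0 tl'; rewrite -pE// /moore_comp mul1r.
  case: ifPn => // pt; have -> : phi t = l1; last by rewrite subrr.
  by apply/le_anti; rewrite pt (le_trans l1p0 (mp _ _ t0)).
have [|m /andP[m0 ml'] mE] := mono_cont_ivt (ltW l'0) cphi (v := l1); first by rewrite !ltW.
have m0' : 0 < m by rewrite lt_neqAle m0 andbT; apply/eqP => m0E; move: p0l1; rewrite m0E mE ltxx.
have ml'' : m < l' by rewrite lt_neqAle ml' andbT; apply/eqP => mE'; move: l1p; rewrite -mE' mE ltxx.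
have [|p1' mp1 E1] := IH1 m phi m0' cphi phi0; first by rewrite mE.
have cm : mono_cont (fun t : R => 1 * t + m) by exact: mono_cont_affine.
have [|||p2' mp2 E2] := IH2 (l' - m) _ _ (mono_cont_comp (mono_cont_comp cm cphi) ca).
- by rewrite subr_gt0.
- by rewrite mulr0 add0r mE mul1r subrr.
- rewrite !mul1r subrK; lra.
have m0l : 0 <= l' - m by rewrite subr_ge0.
have pm : p1' m = p2' 0 by rewrite -E1// -E2// mulr0 add0r mul1r mE subrr p12.
exists (moore_comp m p1' p2'); first by rewrite -[l'](subrKC m); exact: MooreComp.
move=> t t0 tl'; rewrite /moore_comp; have [tm|mt] := leP t m.
  by rewrite -E1// -mE mp.
rewrite -E2; [|by rewrite subr_ge0 ltW|by rewrite lerD2r].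
rewrite !mul1r subrK; case: ifPn => // pt.
have -> : phi t = l1 by apply/le_anti; rewrite pt -mE mp// ltW.
by rewrite subrr.
Qed.

Lemma dir_path_reparam l p l' phi : 0 < l' -> mono_cont phi -> 0 <= phi 0 ->
  phi l' <= l -> dir_path l p -> dir_path l' (fun t => p (phi t)).
Proof.
move=> l'0 cphi phi0 phil [[x px]|[p' mp pp']]; have [_ mphi] := cphi.
  left; exists x => t t0 tl'; apply: px; first exact: le_trans (mphi _ _ t0).
  exact: le_trans (mphi _ _ tl') phil.
have [p'' mp'' E] := moore_dpath_reparam mp l'0 cphi phi0 phil.
right; exists p'' => // t t0 tl'; rewrite -E//; apply: pp'; first exact: le_trans (mphi _ _ t0).
exact: le_trans (mphi _ _ tl') phil.
Qed.

(** A constant path at an arbitrary point need not be a Moore path, so a constant side is treated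
    apart: the composite is the other side with a pause, that is, its reparametrization by a [max]
    or a [min]. *)
Lemma dir_path_comp l1 l2 p1 p2 : 0 < l1 -> 0 < l2 -> dir_path l1 p1 ->
  dir_path l2 p2 -> p1 l1 = p2 0 -> dir_path (l1 + l2) (moore_comp l1 p1 p2).
Proof.
move=> l10 l20 d1 d2 p12; have l12 : 0 < l1 + l2 by exact: addr_gt0.
case: (d1) => [[x px]|[p1' m1 E1]].
  have ca : mono_cont (fun t : R => 1 * t + - l1) by exact: mono_cont_affine.
  have := dir_path_reparam l12 (mono_cont_comp ca (mono_cont_max 0)) _ _ d2.
  rewrite !mul1r le_max lexx orbT => /(_ isT); rewrite ge_max [X in X <= l2]addrAC subrr add0r lexx ltW//.
  move=> /(_ isT); apply: dir_path_ext => t t0 tl; rewrite mul1r /moore_comp.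
  have [tl1|lt1] := leP t l1; last by rewrite max_l// subr_ge0 ltW.
  by rewrite max_r ?subr_le0// -p12 !px// ltW.
case: (d2) => [[x px]|[p2' m2 E2]].
  have := dir_path_reparam l12 (mono_cont_min l1) _ _ d1.
  rewrite le_min lexx ltW// ge_min lexx orbT => /(_ isT isT).
  apply: dir_path_ext => t t0 tl; rewrite /moore_comp.
  have [tl1|lt1] := leP t l1; first by [].
  by rewrite p12 !px ?subr_ge0 ?lerBlDl ?(ltW l20) ?(ltW lt1).
right; exists (moore_comp l1 p1' p2'); first by apply: MooreComp => //; rewrite -(E1 l1 (ltW l10) (lexx _)) -(E2 0 (lexx _) (ltW l20)).
move=> t t0 tl; rewrite /moore_comp; have [tl1|lt1] := leP t l1; first exact: E1.
by apply: E2; [rewrite subr_ge0 ltW|rewrite lerBlDl].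
Qed.

Lemma exec_dpath (g : unitI R -> X) : exec X g -> dpath g.
Proof.
move=> eg; right; exists (g \o id \o mu 1); last by move=> t; rewrite /= /mu divr1 clampI_val.
by apply: MooreExec => //; apply: calM_calI; exact: calM_id.
Qed.

Lemma dpath_reparam (g : unitI R -> X) phi : dpath g -> calI phi -> dpath (g \o phi).
Proof.
move=> /dpath_dir_path dg /calI_ramp[cphi p01]; apply/dpath_dir_path.
have := dir_path_reparam (@ltr01 R) cphi _ _ dg.
move=> /(_ (andP (p01 0)).1 (andP (p01 1)).2); apply: dir_path_ext => t _ _.
by rewrite clampI_val.
Qed.

Lemma dpath_ncomp (g1 g2 : unitI R -> X) : dpath g1 -> dpath g2 -> g1 (I1 R) = g2 (I0 R) ->
  dpath (ncomp g1 g2).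
Proof.
move=> /dpath_dir_path d1 /dpath_dir_path d2 g12; apply/dpath_dir_path.
have h0 : 0 < 2^-1 :> R by rewrite invr_gt0.
have ca : mono_cont (fun t : R => 2 * t + 0) by exact: mono_cont_affine.
have {d1} := dir_path_reparam h0 ca _ _ d1; rewrite mulr0 addr0 mulfV ?pnatr_eq0// addr0.
move=> /(_ (lexx _) (lexx _)) d1; have {d2} := dir_path_reparam h0 ca _ _ d2.
rewrite mulr0 addr0 mulfV ?pnatr_eq0// addr0 => /(_ (lexx _) (lexx _)) d2.
have := dir_path_comp h0 h0 d1 d2; rewrite !addr0 mulfV ?pnatr_eq0// mulr0 => /(_ g12).
have -> : 2^-1 + 2^-1 = 1 :> R by lra.
apply: dir_path_ext => t t0 t1; rewrite /moore_comp /ncomp clampIK//.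
case: ifP => _; rewrite addr0//; congr (g2 (clampI _)); lra.
Qed.

Lemma dpath_cst x : dpath (fun _ : unitI R => x : X).
Proof. by left; exists x. Qed.

(** Outside [0, l] the values of a Moore path are an artefact of the encoding, whence the clamping
    of time. *)
Lemma moore_dpath_continuous l p : @moore_dpath R X l p ->
  continuous (fun t => p (Num.max 0 (Num.min t l))).
Proof.
elim=> {l p} [l g phi l0 eg Iphi|l1 l2 p1 p2 m1 c1 m2 c2 p12].
  have cm : continuous (fun t : R => Num.max 0 (Num.min t l)).
    apply: contmax; first exact: contC.
    by apply: contmin; [exact: contid|exact: contC].
  apply: (contcomp (f := fun t => phi (mu l (Num.max 0 (Num.min t l))))); last exact: exec_continuous.
  apply: contcomp; last by case: Iphi.
  have cml : continuous (fun t : R => Num.max 0 (Num.min t l) / l).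
    by apply: contM; [exact: cm|exact: contC].
  exact: (contcomp cml (@clampI_continuous R)).
have l10 := moore_dpath_gt0 m1; have l20 := moore_dpath_gt0 m2.
have cs : continuous (fun t : R => t - l1) by apply: contB; [exact: contid|exact: contC].
apply: (continuous_glue (@contid R) c1 (contcomp cs c2) (m := l1)) => t tl.
  rewrite /moore_comp (min_l (y := l1 + l2)) ?(min_l (y := l1))//; last by lra.
  by rewrite ge_max tl ltW.
rewrite /moore_comp ge_max ge_min [l1 + l2 <= l1]leNgt ltrDl l20 orbF [0 <= l1]ltW//=.
have -> : Num.max 0 (Num.min t (l1 + l2)) = Num.min t (l1 + l2).
  by rewrite max_r// le_min; apply/andP; split; lra.
have -> : Num.max 0 (Num.min (t - l1) l2) = Num.min t (l1 + l2) - l1.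
  rewrite max_r; first by case: (leP t (l1 + l2)) => ?; case: leP => ?; lra.
  by rewrite le_min; apply/andP; split; lra.
case: ifPn => // tl1; have -> : t = l1 by apply/le_anti/andP.
by rewrite min_l ?subrr// ltW// ltrDl.
Qed.

Lemma dpath_continuous (g : unitI R -> X) : dpath g -> continuous g.
Proof.
case=> [[x ->]|[p mp gp]]; first exact: cst_continuous.
rewrite (_ : g = fun t => p (Num.max 0 (Num.min (val t) 1))).
  exact: (contcomp (@unitI_val_continuous R) (moore_dpath_continuous mp)).
by apply/funext => t; rewrite gp min_l ?unitI_le1// max_r ?unitI_ge0.
Qed.

End DirectedPaths.

(** Meant in particular for the inverse of a subdivision, which in general sends an execution path
    only to a directed path. *)
Lemma dpath_map (R : realType) (X Y : mpdspace R) (f : X -> Y) :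
  (forall g, exec X g -> dpath (f \o g)) -> forall g, dpath g -> dpath (f \o g).
Proof.
move=> fe g [[x ->]|[p mp gp]]; first by left; exists (f x).
apply/dpath_dir_path; suff : dir_path 1 (f \o p).
  by apply: dir_path_ext => t t0 t1; rewrite /= gp clampIK.
elim: mp => {g p gp} [l g phi l0 eg Iphi|l1 l2 p1 p2 m1 d1 m2 d2 p12].
  have /dpath_dir_path d := dpath_reparam (fe g eg) Iphi.
  have ca : mono_cont (fun t : R => l^-1 * t + 0).
    by apply: mono_cont_affine; rewrite invr_ge0 ltW.
  have := dir_path_reparam l0 ca _ _ d; rewrite mulr0 addr0 mulVf ?gt_eqF// addr0.
  move=> /(_ (lexx _) (lexx _)); apply: dir_path_ext => t _ _.
  by rewrite /= addr0 /mu mulrC.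
have := dir_path_comp (moore_dpath_gt0 m1) (moore_dpath_gt0 m2) d1 d2.
rewrite /= p12 => /(_ erefl); apply: dir_path_ext => t _ _.
by rewrite /moore_comp /=; case: ifP.
Qed.

(** * Directed paths under a globular subdivision *)

Section Subdivision.
Variables (R : realType) (X Y : mpdspace R) (f : mpdmap X Y) (fi : Y -> X).
Hypotheses (fK : cancel f fi) (fiK : cancel fi f).
Variables (E E' : Type) (h : E -> unitI R -> X) (k : E' -> unitI R -> Y).
Hypotheses (hX : arc_structure h) (kY : arc_structure k).

Let hh := arc_structure_family hX.
Let kk := arc_structure_family kY.

(* The midpoint of an arc of [Y] lies on an arc of [X], whose image is an
   execution path of [Y] and hence runs through the whole arc of [Y]. *)
Lemma arc_covered e' : exists e a b psi, [/\ [/\ 0 <= a, a < b & b <= 1], ramp psi,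
  psi a = 0, psi b = 1 &
  forall t, a <= t -> t <= b -> f (h e (clampI t)) = k e' (clampI (psi t))].
Proof.
pose m : unitI R := clampI 2^-1.
have mE : val m = 2^-1 by rewrite clampIK ?invr_ge0// invf_le1// ler1n.
have m01 : 0 < val m < 1 by rewrite mE invr_gt0 ltr0n/= invf_lt1// ltr1n.
have [sx|[e [s [s01 sE]]]] := arc_cover hX (fi (k e' m)).
  by case: (arc_interior kY (e := e') m01); rewrite -[k e' m]fiK; exact: mfun_states.
have fs : f (h e (clampI (val s))) = k e' m by rewrite clampI_val -sE fiK.
have [fl bl] := exec_flow kY (mfun_exec f (arc_exec hX e)).
have sts b : states Y (f (h e (if b then I1 R else I0 R))).
  by apply: mfun_states; case: hh => /(_ e)[? ?] _ _; case: b.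
have [s' [psi [ss' s'1 rpsi psiE pend]]] := fl _ _ m (unitI_ge0 s) (unitI_le1 s) m01 fs.
have psis : psi (val s) = 2^-1.
  have [_] := arc_family_inj kk m01 (esym (etrans (esym fs) (psiE _ (lexx _) ss'))).
  by move=> /(congr1 val); rewrite ramp_clampK// mE.
have h0 : 0 < 2^-1 :> R by rewrite invr_gt0.
(* If the arc of Y is followed until the arc of X ends, the point reached there is a state, hence
   the end of the arc of Y. *)
have psi1 : psi s' = 1.
  case: pend => // s'E; have [[_ mpsi] _] := rpsi.
  have st : states Y (k e' (clampI (psi s'))) by rewrite -psiE//= s'E -/(I1 R); exact: (sts true).
  apply: (arc_family_end kk rpsi _ st); apply: lt_le_trans (mpsi _ _ ss').
  by rewrite psis.
have bs : f (h e (clampI (- - val s))) = rev_arc k e' (revI m).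
  by rewrite opprK /rev_arc revIK.
have [||u [chi [su u0 rchi chiE cend]]] := bl (- val s) e' (revI m) _ _ (revI_interior m01) bs.
- by rewrite lerN2 unitI_le1.
- by rewrite lerN2 unitI_ge0.
have revm : revI m = m by apply: val_inj; rewrite val_revI mE; lra.
have chis : chi (- val s) = 2^-1.
  have [_] := arc_family_inj (rev_arc_family kk) (revI_interior m01) (esym (etrans (esym bs) (chiE _ (lexx _) su))).
  by move=> /(congr1 val); rewrite ramp_clampK// revm mE.
have chi1 : chi u = 1.
  case: cend => // uE; rewrite oppr0 in uE.
  have st : states Y (rev_arc k e' (clampI (chi u))).
    by rewrite -chiE//= uE oppr0 -/(I0 R); exact: (sts false).
  have [[_ mc] _] := rchi.
  apply: (arc_family_end (rev_arc_family kk) rchi _ st).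
  by apply: lt_le_trans (mc _ _ su); rewrite chis.
(* The backward parametrization read forwards; at the starting time both pieces take the value 1/2,
   the parameter of the midpoint. *)
have rchi' : ramp (fun t => 1 + - chi (- t)).
  have [cc c01] := rchi; have [c1 c2] := mono_cont_opp cc.
  split; last by move=> t; have /andP[? ?] := c01 (- t); apply/andP; split; lra.
  split; last by move=> x y xy; rewrite lerD2l c2.
  by apply: contD => //; exact: contC.
have [|Psi [rPsi P1 P2]] := ramp_glue rchi' rpsi (m := val s).
  by rewrite chis psis; lra.
have us : - u <= val s by rewrite lerNl.
exists e, (- u), s', Psi; split=> //.
- split; [by rewrite lerNr| |by []].
  have [[_ mP] _] := rPsi; rewrite ltNge; apply/negP => /mP.
  by rewrite (P1 _ us) P2// psi1 opprK chi1 subrr ler10.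
- by rewrite (P1 _ us) opprK chi1 subrr.
- by rewrite P2.
- move=> t ut ts'; have [ts|/ltW st] := leP t (val s).
    rewrite P1//; have := chiE (- t); rewrite opprK lerN2 lerNl => /(_ ts ut)/= ->.
    rewrite /rev_arc; congr (k e' _); apply: val_inj.
    by rewrite val_revI (ramp_clampK (- t) rchi) (ramp_clampK t rchi').
  by rewrite P2// -psiE.
Qed.

(** The parametrization [psi] given by [arc_covered] is inverted. Its inverse yields a map [phi] of
    [calM], onto because [psi] is injective on [a, b]: times with the same value of [psi] give the
    same point of the arc of X. *)
Lemma arc_subdivision e' : dpath (fi \o k e').
Proof.
have [e [a [b [psi [[a0 ab b1] rpsi psia psib psiE]]]]] := arc_covered e'.
have [cpsi _] := rpsi; have [_ mpsi] := cpsi; have ba0 : 0 < b - a by rewrite subr_gt0.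
have ex (u : unitI R) : exists t, (a <= t <= b) /\ psi t = val u.
  have [|t tab tE] := mono_cont_ivt (ltW ab) cpsi (v := val u); last by exists t.
  by rewrite psia psib unitI_ge0 unitI_le1.
pose chi u := projT1 (cid (ex u)).
have chiab u : a <= chi u <= b by have [] := projT2 (cid (ex u)).
have chiE u : psi (chi u) = val u by have [] := projT2 (cid (ex u)).
pose phi u : unitI R := clampI ((chi u - a) / (b - a)).
have phiE u : a + (b - a) * val (phi u) = chi u.
  have /andP[au ub] := chiab u; rewrite /phi clampIK.
  - by rewrite mulrCA mulfV ?gt_eqF// mulr1 addrC subrK.
  - by rewrite divr_ge0 ?subr_ge0// ltW.
  - by rewrite ler_pdivrMr// mul1r lerD2r.
have Mphi : calM phi.
  split=> [u v uv|t].
    suff : chi u <= chi v by rewrite -!phiE lerD2l ler_pM2l.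
    rewrite leNgt; apply/negP => vu; have := mpsi _ _ (ltW vu); rewrite !chiE => vu'.
    have uvE : u = v by apply/val_inj/le_anti/andP.
    by move: vu; rewrite uvE ltxx.
  pose tau := a + (b - a) * val t.
  have atau : a <= tau by rewrite lerDl mulr_ge0 ?unitI_ge0// ltW.
  have taub : tau <= b by rewrite -lerBrDl ler_piMr ?unitI_le1// ltW.
  exists (clampI (psi tau)); have := chiE (clampI (psi tau)); rewrite ramp_clampK// => cE.
  suff ctau : chi (clampI (psi tau)) = tau.
    have ba1 : b - a != 0 by rewrite gt_eqF.
    by apply: val_inj; apply: (mulfI ba1); apply: (addrI a); rewrite phiE.
  have /andP[ac cb] := chiab (clampI (psi tau)).
  move: (chi (clampI (psi tau))) cE ac cb => c cE ac cb.
  have hc : h e (clampI c) = h e (clampI tau) by apply: (can_inj fK); rewrite !psiE// cE.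
  have c01 : 0 <= c <= 1 by rewrite (le_trans a0 ac) (le_trans cb b1).
  have t01 : 0 <= tau <= 1 by rewrite (le_trans a0 atau) (le_trans taub b1).
  have vE d : 0 <= d <= 1 -> val (clampI d) = d :> R by move=> /andP[? ?]; rewrite clampIK.
  (* Injectivity of the arc of X can fail only at the two ends of a loop; then [a, b] is [0, 1], and
     [psi] takes the values 0 and 1 at these ends. *)
  have [tE|tE|ti] := unitI_cases (clampI tau); last first.
  - have [_ /(congr1 val)] := arc_family_inj hh ti hc; by rewrite !vE.
  - have [cE'|cE'|ci] := unitI_cases (clampI c); last first.
    + have [_ /(congr1 val)] := arc_family_inj hh ci (esym hc); by rewrite !vE.
    + by rewrite -(vE _ c01) -(vE _ t01) cE' tE.
    + have c0 : c = 0 by rewrite -(vE _ c01) cE' val_I0.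
      have tau1 : tau = 1 by rewrite -(vE _ t01) tE val_I1.
      have aE : a = c by apply/le_anti; rewrite ac c0 a0.
      have bE : b = tau by apply/le_anti; rewrite taub tau1 b1.
      by move: cE; rewrite -aE -bE psia psib => /eqP; rewrite eq_sym oner_eq0.
  - have [cE'|cE'|ci] := unitI_cases (clampI c); last first.
    + have [_ /(congr1 val)] := arc_family_inj hh ci (esym hc); by rewrite !vE.
    + have c1 : c = 1 by rewrite -(vE _ c01) cE' val_I1.
      have tau0 : tau = 0 by rewrite -(vE _ t01) tE val_I0.
      have aE : a = tau by apply/le_anti; rewrite atau tau0 a0.
      have bE : b = c by apply/le_anti; rewrite cb c1 b1.
      by move: cE; rewrite -aE -bE psia psib => /eqP; rewrite oner_eq0.
    + by rewrite -(vE _ c01) -(vE _ t01) cE' tE.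
rewrite (_ : fi \o k e' = h e \o ((fun u => clampI (val (clampI ((b - a) * val u + a)))) \o phi)).
  apply: dpath_reparam; first exact: exec_dpath (arc_exec hX e).
  apply: calI_comp; last exact: calM_calI.
  apply: (@ramp_calI _ (fun t => val (clampI ((b - a) * t + a)))).
  exact: (ramp_comp (mono_cont_affine a (ltW ba0)) (@ramp_clamp R)).
apply/funext => u.
change (fi (k e' u) = h e (clampI (val (clampI ((b - a) * val (phi u) + a))))).
rewrite clampI_val addrC phiE -[RHS]fK; congr fi; have /andP[au ub] := chiab u.
by rewrite psiE// chiE clampI_val.
Qed.

Lemma dpath_subdivision g : dpath g -> dpath (fi \o g).
Proof.
apply: dpath_map => {}g.
apply: (arc_ind kY (Q := [set g : unitI R -> Y | dpath (fi \o g)])).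
- exact: arc_subdivision.
- by move=> g' phi dg /calM_calI Iphi; exact: dpath_reparam dg Iphi.
- by move=> g1 g2 d1 d2 g12; rewrite /= ncomp_comp; apply: dpath_ncomp => //=; rewrite g12.
Qed.

End Subdivision.

(** * Truncation in the compact-open topology *)

Section CompactOpen.
Variables (R : realType) (T : topologicalType).
Notation I := (unitI R).
Notation CO := {compact-open, I -> T}.

Lemma closed_unitI_compact (K : set I) : closed K -> compact K.
Proof. by move=> cK; apply: (subclosed_compact cK (@unitI_compact R)). Qed.

Lemma co_precomp (sigma : I -> I) (F : set_system CO) (g0 : CO) : continuous sigma ->
  Filter F -> F --> g0 -> (fun g : CO => (g \o sigma : CO)) @ F --> (g0 \o sigma : CO).
Proof.
move=> cs FF /compact_open_cvgP Fg; apply/compact_open_cvgP => K O cK oO gO.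
have cK' : compact (sigma @` K).
  by apply: continuous_compact => //; exact: continuous_subspaceT.
have : F [set g : CO | g @` (sigma @` K) `<=` O].
  by apply: Fg => // _ [_ [t Kt <-] <-]; apply: gO; exists t.
move=> H; change (F [set g : CO | (g \o sigma) @` K `<=` O]); apply: filterS H.
by move=> g gs _ [t Kt <-]; apply: gs; exists (sigma t) => //; exists t.
Qed.

Lemma co_ncomp_right (p : I -> T) (F : set_system CO) (g0 : CO) : p (I1 R) = g0 (I0 R) ->
  Filter F -> F --> g0 -> (fun g : CO => (ncomp p g : CO)) @ F --> (ncomp p g0 : CO).
Proof.
move=> pg FF /compact_open_cvgP Fg; apply/compact_open_cvgP => K O cK oO gO.
pose s (t : I) : I := clampI (2 * val t - 1).
have cs : continuous s.
  apply: contcomp; last exact: clampI_continuous.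
  by apply: contB; [apply: contM; [exact: contC|exact: unitI_val_continuous]|exact: contC].
have cK' : compact (s @` (K `&` [set t : I | 2^-1 <= val t])).
  apply: continuous_compact; first exact: continuous_subspaceT.
  apply: compact_closedI => //.
  exact: (continuous_closed (@unitI_val_continuous R) (@closed_ge R 2^-1)).
have : F [set g : CO | g @` (s @` (K `&` [set t : I | 2^-1 <= val t])) `<=` O].
  apply: Fg => // _ [_ [t [Kt t2] <-] <-].
  have : O (ncomp p g0 t) by apply: gO; exists t.
  rewrite /ncomp; case: ifPn => // t2'.
  (* At time 1/2 [ncomp] reads the end of [p], while the compact set used for [g] contains time 0;
     for [g0] the two values agree. *)
  have tE : val t = 2^-1 by apply/le_anti/andP.
  have -> : s t = I0 R by rewrite /s tE mulfV ?pnatr_eq0// subrr.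
  by rewrite -pg tE mulfV ?pnatr_eq0.
move=> H; change (F [set g : CO | ncomp p g @` K `<=` O]); apply: filterS H.
move=> g gs _ [t Kt <-]; rewrite /ncomp; case: ifPn => [t2|].
  have : O (ncomp p g0 t) by apply: gO; exists t.
  by rewrite /ncomp [X in if X then _ else _]t2.
rewrite -ltNge => /ltW t2; apply: gs; exists (s t) => //.
by exists t.
Qed.

Lemma co_ncomp_left (p : I -> T) (F : set_system CO) (g0 : CO) :
  Filter F -> F --> g0 -> (fun g : CO => (ncomp g p : CO)) @ F --> (ncomp g0 p : CO).
Proof.
move=> FF /compact_open_cvgP Fg; apply/compact_open_cvgP => K O cK oO gO.
pose s (t : I) : I := clampI (2 * val t).
have cs : continuous s.
  apply: contcomp; last exact: clampI_continuous.
  by apply: contM; [exact: contC|exact: unitI_val_continuous].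
have cK' : compact (s @` (K `&` [set t : I | val t <= 2^-1])).
  apply: continuous_compact; first exact: continuous_subspaceT.
  apply: compact_closedI => //.
  exact: (continuous_closed (@unitI_val_continuous R) (@closed_le R 2^-1)).
have : F [set g : CO | g @` (s @` (K `&` [set t : I | val t <= 2^-1])) `<=` O].
  apply: Fg => // _ [_ [t [Kt t2] <-] <-].
  have : O (ncomp g0 p t) by apply: gO; exists t.
  by rewrite /ncomp [X in if X then _ else _]t2.
move=> H; change (F [set g : CO | ncomp g p @` K `<=` O]); apply: filterS H.
move=> g gs _ [t Kt <-]; rewrite /ncomp; case: ifPn => [t2|t2].
  by apply: gs; exists (s t) => //; exists t.
have : O (ncomp g0 p t) by apply: gO; exists t.
by rewrite /ncomp (negbTE t2).
Qed.

Lemma co_postcomp (U : topologicalType) (f : T -> U) (F : set_system CO) (g0 : CO) :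
  continuous f -> Filter F -> F --> g0 ->
  (fun g : CO => (f \o g : {compact-open, I -> U})) @ F --> (f \o g0 : {compact-open, I -> U}).
Proof.
move=> cf FF /compact_open_cvgP Fg; apply/compact_open_cvgP => K O cK oO gO.
have : F [set g : CO | g @` K `<=` f @^-1` O].
  apply: Fg => //; first by move/continuousP: cf; apply.
  by move=> _ [t Kt <-]; apply: gO; exists t.
move=> H; change (F [set g : CO | (f \o g) @` K `<=` O]); apply: filterS H.
by move=> g gs _ [t Kt <-]; apply: gs; exists t.
Qed.

Lemma co_open (K : set I) (O : set T) : compact K -> open O ->
  open [set g : CO | g @` K `<=` O].
Proof. exact: compact_open_open. Qed.

End CompactOpen.

Section Truncation.
Variables (R : realType) (T : topologicalType) (Sg : set T).
Notation I := (unitI R).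
Notation CO := {compact-open, I -> T}.
Hypotheses (T2 : hausdorff_space T) (Sg_closed : closed Sg).
Implicit Types (g : I -> T) (s t : I).

Definition maxI t s : I := if val t <= val s then s else t.
Definition minI t s : I := if val t <= val s then t else s.

Lemma val_maxI t s : val (maxI t s) = Num.max (val t) (val s).
Proof. by rewrite /maxI; case: leP. Qed.

Lemma val_minI t s : val (minI t s) = Num.min (val t) (val s).
Proof. by rewrite /minI; case: leP. Qed.

Definition is_hit g t := Sg (g t) /\ forall s, val s < val t -> ~ Sg (g s).

(* The first time at which [g] meets [Sg]; a junk value if there is none. *)
Definition hit g : I := xget (I0 R) [set t | is_hit g t].

(* The part of [g] before its first meeting with [Sg] is replaced by a pause. *)
Definition trunc g : I -> T := fun t => g (maxI t (hit g)).

Lemma is_hit_unique g t s : is_hit g t -> is_hit g s -> t = s.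
Proof.
move=> [gt lt] [gs ls]; apply: val_inj; apply/le_anti/andP; split.
  by rewrite leNgt; apply/negP => /lt.
by rewrite leNgt; apply/negP => /ls.
Qed.

Lemma hitE g t : is_hit g t -> hit g = t.
Proof. by move=> ht; apply: xget_unique => // s hs; exact: is_hit_unique hs ht. Qed.

(** The times at which [g] meets the closed set [Sg] form a compact set, which has a least
    element. *)
Lemma hitP g : continuous g -> (exists t, Sg (g t)) -> is_hit g (hit g).
Proof.
move=> cg [t0 gt0]; apply: (@xgetPex _ (I0 R) [set t | is_hit g t]).
have cA : compact (g @^-1` Sg) by apply: closed_unitI_compact; exact: continuous_closed.
have A0 : g @^-1` Sg !=set0 by exists t0.
have [t] := compact_EVT_min A0 cA (continuous_subspaceT (@unitI_val_continuous R)).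
rewrite inE => gt tmin; exists t; split=> // s st gs.
by have := tmin s; rewrite inE => /(_ gs); rewrite leNgt st.
Qed.

Lemma hit_le g t : continuous g -> Sg (g t) -> val (hit g) <= val t.
Proof.
move=> cg gt; rewrite leNgt; apply/negP => th.
have [|_ /(_ t th)] := hitP cg; first by exists t.
exact.
Qed.

(** The second alternative is the constant path, for an end point that is already a state. *)
Definition is_arc (A : I -> T) := [/\ continuous A, Sg (A (I1 R)) &
  (forall t, val t < 1 -> ~ Sg (A t)) \/ (forall t, A t = A (I1 R))].

Definition follows (A : I -> T) g := [/\ continuous g, exists t, Sg (g t) &
  exists2 psi, calM psi & forall t, g (minI t (hit g)) = A (psi t)].

Lemma minI_1 s : minI (I1 R) s = s.
Proof.
apply: val_inj; rewrite val_minI min_r// val_I1; exact: unitI_le1.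
Qed.

Lemma minI_r t s : val s <= val t -> minI t s = s.
Proof. by move=> st; apply: val_inj; rewrite val_minI min_r. Qed.

Lemma minI_l t s : val t <= val s -> minI t s = t.
Proof. by move=> st; apply: val_inj; rewrite val_minI min_l. Qed.

Lemma maxI_r t s : val t <= val s -> maxI t s = s.
Proof. by move=> st; apply: val_inj; rewrite val_maxI max_r. Qed.

Lemma maxI_l t s : val s <= val t -> maxI t s = t.
Proof. by move=> st; apply: val_inj; rewrite val_maxI max_l. Qed.

Lemma follows_hit A g : follows A g -> g (hit g) = A (I1 R).
Proof.
by move=> [_ _ [psi Mpsi /(_ (I1 R))]]; rewrite minI_1 (calM_I1 Mpsi).
Qed.

Lemma follows_start A g : follows A g -> g (I0 R) = A (I0 R).
Proof.
move=> [_ _ [psi Mpsi /(_ (I0 R))]]; rewrite (calM_I0 Mpsi) minI_l//.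
by rewrite val_I0 unitI_ge0.
Qed.

(* The hitting time is only lower semicontinuous, but if it jumps from [hit g0]
   to some later [m] then [g] is still on the arc at [m], close to its end, so
   that [g0] pauses between the two times. *)
Lemma trunc_cvg A (F : set_system CO) (g0 : CO) : is_arc A -> Filter F ->
  F --> g0 -> F [set g : CO | follows A g] -> follows A g0 ->
  (fun g : CO => (trunc g : CO)) @ F --> (trunc g0 : CO).
Proof.
move=> [cA A1 Aint] FF /compact_open_cvgP Fg FA fg0.
have [cg0 hg0 _] := fg0; have [hit0 before0] := hitP cg0 hg0.
have cv := @unitI_val_continuous R.
pose tau := hit g0; have g0tau : g0 tau = A (I1 R) by exact: follows_hit fg0.
have cpt_itv a b : compact [set t : I | a <= val t /\ val t <= b].
  apply: closed_unitI_compact; apply: closedI; first exact: (continuous_closed cv (@closed_ge R a)).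
  exact: (continuous_closed cv (@closed_le R b)).
have cpt_le b : compact [set t : I | val t <= b].
  by apply: closed_unitI_compact; exact: (continuous_closed cv (@closed_le R b)).
have cpt1 t : compact [set t] by exact: compact_set1.
apply/compact_open_cvgP => K O cK oO gO.
have {}gO t : K t -> O (trunc g0 t) by move=> Kt; apply: gO; exists t.
change (F [set g : CO | trunc g @` K `<=` O]).
(* [A (I1 R)] is the value during the pause. If it lies in [O], a late hitting time is harmless and
   only an early one has to be controlled. Otherwise [K] lies after [tau], and the hitting time of
   [g] must be shown not to exceed the times in [K]. *)
have [Oa|nOa] := pselect (O (A (I1 R))).
  have [e /= e0 eO] : exists2 e, 0 < e & forall t : I, val tau - e <= val t -> val t <= val tau -> O (g0 t).
    have cgc : continuous (fun x => g0 (clampI x)) by exact: (contcomp (@clampI_continuous R) cg0).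
    have /nbhs_ballP[e /= e0 eO] : nbhs (val tau) [set x | O (g0 (clampI x))].
      apply: cgc; apply: open_nbhs_nbhs; split => //.
      by rewrite clampI_val g0tau.
    exists (e / 2); first by rewrite divr_gt0.
    move=> t te tt; rewrite -[t]clampI_val; apply: eO.
    by rewrite /ball /= ger0_norm ?subr_ge0//; lra.
  have F1 : F [set g : CO | g @` [set t : I | val t <= val tau - e] `<=` ~` Sg].
    apply: Fg => //; first by rewrite openC.
    move=> _ [t tt <-]; apply: before0; have {}tt : val t <= val tau - e by [].
    by rewrite -/tau; lra.
  have F2 : F [set g : CO | g @` [set t : I | val tau - e <= val t /\ val t <= val tau] `<=` O].
    by apply: Fg => // _ [t [? ?] <-]; exact: eO.
  have F3 : F [set g : CO | g @` (K `&` [set t : I | val tau <= val t]) `<=` O].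
    apply: Fg => //.
      by apply: compact_closedI => //; exact: (continuous_closed cv (@closed_ge R (val tau))).
    by move=> _ [t [Kt tt] <-]; have := gO t Kt; rewrite /trunc maxI_l.
  apply: filterS (filterI (filterI F1 F2) (filterI F3 FA)) => g [[G1 G2] [G3 fg]] _ [t Kt <-]; rewrite /trunc.
  have [th|/ltW ht] := leP (val t) (val (hit g)); first by rewrite maxI_r// (follows_hit fg).
  rewrite maxI_l//; have [tt|/ltW tt] := leP (val tau) (val t).
    by apply: G3; exists t.
  apply: G2; exists t => //; split=> //; apply: le_trans ht; rewrite leNgt.
  apply/negP => /ltW hs; have [cg eg _] := fg.
  by have [gh _] := hitP cg eg; apply: (G1 (g (hit g))) => //; exists (hit g).
have Ktau t : K t -> val tau < val t.
  move=> Kt; rewrite ltNge; apply/negP => tt; apply: nOa.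
  by have := gO t Kt; rewrite /trunc maxI_r// -/tau g0tau.
have F3 : F [set g : CO | g @` K `<=` O].
  apply: Fg => // _ [t Kt <-]; have := gO t Kt.
  by rewrite /trunc maxI_l//; apply/ltW; exact: Ktau.
have [K0|/set0P K0] := eqVneq K set0.
  by apply: filterS F3 => g _ y [t Kt _]; move: Kt; rewrite K0.
suff Fhit : F [set g : CO | forall t, K t -> val (hit g) <= val t].
  apply: filterS2 F3 Fhit => g g3 gh _ [t Kt <-].
  by rewrite /trunc maxI_l ?gh//; apply: g3; exists t.
case: Aint => [Aint|Acst]; last first.
  apply: filterS FA => g fg t _; have [cg _ _] := fg.
  have : val (hit g) <= val (I0 R) by apply: hit_le => //; rewrite (follows_start fg) Acst.
  by move=> /le_trans; apply; rewrite val_I0 unitI_ge0.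
have [m] := compact_EVT_min K0 cK (continuous_subspaceT cv).
rewrite inE => Km mmin; have taum := Ktau m Km.
have g0m : g0 m <> A (I1 R).
  move=> g0m; apply: nOa; have := gO m Km; rewrite /trunc maxI_l ?g0m//.
  by rewrite ltW.
(* For [g] close to [g0], the point [g tau] is off the compact image by [A] of [0, 1 - e]. If [g]
   were still on the arc at time [m], its parameter there would exceed 1 - e, so that [g m] would be
   in [V]; but it is in [U]. *)
have := T2; rewrite open_hausdorff => /(_ _ _ (introN eqP g0m)).
move=> [[U V] /= [mU aV] [oU oV UV]]; rewrite !inE in mU aV.
have [e e0 eV] : exists2 e, 0 < e & forall t : I, 1 - e < val t -> V (A t).
  have cAc : continuous (fun x => A (clampI x)) by exact: (contcomp (@clampI_continuous R) cA).
  have /nbhs_ballP[e /= e0 eV] : nbhs (1 : R) [set x | V (A (clampI x))].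
    by apply: cAc; apply: open_nbhs_nbhs; split.
  exists e => // t te; rewrite -[t]clampI_val; apply: eV.
  by rewrite /ball /= ger0_norm ?subr_ge0 ?unitI_le1//; lra.
have cAe : closed (A @` [set t : I | val t <= 1 - e]).
  apply: compact_closed => //; apply: continuous_compact => //.
  exact: continuous_subspaceT.
have F1 : F [set g : CO | g @` [set tau] `<=` ~` (A @` [set t : I | val t <= 1 - e])].
  apply: Fg => //; first by rewrite openC.
  move=> _ [t -> <-] [u ue]; rewrite g0tau => uE.
  have {}ue : val u <= 1 - e by [].
  by apply: (Aint u); [lra|rewrite uE].
have F2 : F [set g : CO | g @` [set m] `<=` U] by apply: Fg => // _ [t -> <-].
apply: filterS3 F1 F2 FA => g G1 G2 fg t Kt.
have mt : val m <= val t by apply: mmin; rewrite inE.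
apply: le_trans mt; rewrite leNgt; apply/negP => mh.
have [cg eg [psi [mpsi spsi] psiE]] := fg.
have := psiE tau; rewrite minI_l; last by rewrite ltW// (lt_trans taum).
have := psiE m; rewrite minI_l; last exact: ltW.
move=> gm gtau; have : 1 - e < val (psi tau).
  rewrite ltNge; apply/negP => pe; apply: (G1 (g tau)); first by exists tau.
  by exists (psi tau).
move=> pe; have {}pe : 1 - e < val (psi m) by apply: lt_le_trans pe _; apply: mpsi; exact: ltW.
have : (U `&` V) (g m) by split; [apply: G2; exists m|rewrite gm; exact: eV].
by rewrite (eqP UV).
Qed.

(** A nondecreasing surjection takes the first meeting time of the reparametrized path to that of
    [g]. *)
Lemma trunc_reparam g phi : continuous g -> (exists t, Sg (g t)) -> calM phi ->
  trunc (g \o phi) = trunc g \o phi.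
Proof.
move=> cg hg Mphi; have [mphi sphi] := Mphi.
have cgp : continuous (g \o phi).
  exact: (contcomp (calM_continuous Mphi) cg).
have [gh _] := hitP cg hg; have [s sE] := sphi (hit g).
have [|gph _] := hitP cgp; first by exists s; rewrite /= sE.
have hE : phi (hit (g \o phi)) = hit g.
  apply: val_inj; apply/le_anti/andP; split; last exact: hit_le.
  by rewrite -sE; apply: mphi; apply: hit_le => //=; rewrite sE.
apply/funext => t; rewrite /trunc /=; congr g.
have [th|/ltW ht] := leP (val t) (val (hit (g \o phi))).
  by rewrite !maxI_r// -hE; exact: mphi.
by rewrite !maxI_l// -hE; exact: mphi.
Qed.

(** The hitting time may precede [s], but unless [A] is constant, [chi] has then reached 1 and stays
    there: [g] rests at the end of [A] until [s]. The truncation is thus computed without knowing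
    the hitting time. *)
Lemma trunc_arc A g s (chi : I -> I) : is_arc A -> follows A g ->
  (forall t, val t <= val s -> g t = A (chi t)) -> nondecreasingI chi ->
  Sg (g s) ->
  forall t, trunc g t = if val t <= val s then A (I1 R) else g t.
Proof.
move=> [cA A1 Aint] fg gA mchi gs t; have [cg hg _] := fg.
have hs : val (hit g) <= val s by exact: hit_le.
have ghit := follows_hit fg; rewrite /trunc; case: ifPn => [ts|]; last first.
  by rewrite -ltNge => st; rewrite maxI_l// ltW// (le_lt_trans hs st).
have [th|/ltW ht] := leP (val t) (val (hit g)); first by rewrite maxI_r.
rewrite maxI_l// gA//; case: Aint => [Aint|->//].
have chih : val (chi (hit g)) = 1.
  apply/eqP; rewrite eq_le unitI_le1 /= leNgt; apply/negP => /Aint; apply.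
  by rewrite -gA// ghit.
congr A; apply: val_inj; apply/le_anti; rewrite val_I1 unitI_le1 /=.
by have := mchi _ _ ht; rewrite chih.
Qed.

End Truncation.

Section SubArc.
Variable R : realType.
Notation I := (unitI R).

Definition segI (r s t : I) : I := clampI (val r + (val s - val r) * val t).

Lemma val_segI r s t : val (segI r s t) = val r + (val s - val r) * val t.
Proof.
have r0 := unitI_ge0 r; have s0 := unitI_ge0 s; have t0 := unitI_ge0 t.
have r1 := unitI_le1 r; have s1 := unitI_le1 s; have t1 := unitI_le1 t.
have E : val r + (val s - val r) * val t = (1 - val t) * val r + val t * val s by ring.
have A : 0 <= (1 - val t) * val r by rewrite mulr_ge0 ?subr_ge0.
have B : 0 <= val t * val s by rewrite mulr_ge0.
have A' : 0 <= (1 - val t) * (1 - val r) by rewrite mulr_ge0 ?subr_ge0.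
have B' : 0 <= val t * (1 - val s) by rewrite mulr_ge0 ?subr_ge0.
rewrite clampIK// E; lra.
Qed.

Lemma segI_I0 r s : segI r s (I0 R) = r.
Proof. by apply: val_inj; rewrite val_segI val_I0 mulr0 addr0. Qed.

Lemma segI_I1 r s : segI r s (I1 R) = s.
Proof. by apply: val_inj; rewrite val_segI val_I1 mulr1 subrKC. Qed.

Lemma segI_continuous r s : continuous (segI r s).
Proof.
apply: contcomp; last exact: clampI_continuous.
by apply: contD; [exact: contC|apply: contM; [exact: contC|exact: unitI_val_continuous]].
Qed.

Lemma segI_calI r s : val r <= val s -> calI (segI r s).
Proof.
move=> rs; split; last exact: segI_continuous.
by move=> t u tu; rewrite !val_segI lerD2l ler_wpM2l// subr_ge0.
Qed.

Lemma segI_factor (r s : I) psi : ramp psi -> psi 0 = val r -> psi 1 = val s ->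
  exists2 chi, calM chi & forall t : I, clampI (psi (val t)) = segI r s (chi t).
Proof.
move=> rp p0 p1; have [[cp mp] p01] := rp.
have rs : val r <= val s by rewrite -p0 -p1; apply: mp.
have [rsE|rNs] := eqVneq (val r) (val s).
  exists id => [|t]; first exact: calM_id.
  apply: val_inj; rewrite val_segI ramp_clampK// rsE subrr mul0r addr0.
  have t0 := mp _ _ (unitI_ge0 t); have t1 := mp _ _ (unitI_le1 t).
  by apply/le_anti; rewrite -{1}p1 t1 -rsE -p0.
have sr : 0 < val s - val r by rewrite subr_gt0 lt_neqAle rNs.
have ca : mono_cont (fun t : R => (val s - val r)^-1 * t + - ((val s - val r)^-1 * val r)).
  by apply: mono_cont_affine; rewrite invr_ge0 ltW.
have r' := ramp_comp (mono_cont_comp rp.1 ca) (@ramp_clamp R).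
have chiE (t : R) : (val s - val r)^-1 * psi t + - ((val s - val r)^-1 * val r) = (psi t - val r) / (val s - val r).
  by rewrite -mulrBr mulrC.
exists (fun t => clampI (val (clampI ((val s - val r)^-1 * psi (val t) + - ((val s - val r)^-1 * val r))))).
  apply: calI_calM; first exact: (ramp_calI r').
    by rewrite clampI_val chiE val_I0 p0 subrr mul0r.
  by rewrite clampI_val chiE val_I1 p1 mulfV// gt_eqF.
move=> t; apply: val_inj; rewrite clampI_val val_segI chiE.
rewrite ramp_clampK// clampIK.
- by rewrite mulrCA mulfV ?gt_eqF// mulr1 subrKC.
- by rewrite divr_ge0 ?subr_ge0 -?p0 ?mp ?unitI_ge0// p0 -subr_ge0 ltW.
- by rewrite ler_pdivrMr// mul1r lerD2r -p1 mp// unitI_le1.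
Qed.

End SubArc.

(** * Paths that start on a given arc *)

Section LeftArc.
Variables (R : realType) (T : topologicalType) (E : Type) (Sg : set T).
Variable h : E -> unitI R -> T.
Hypothesis Sg_closed : closed Sg.
Hypotheses (hh : arc_family Sg h) (ch : forall e, continuous (h e)).
Notation I := (unitI R).

(* [A] runs from [a] to the end of the arc through [a], and is constant if [a]
   is a state. *)
Definition is_left_arc (a : T) (A : I -> T) :=
  (Sg a /\ A = (fun=> a)) \/
  exists e r, [/\ 0 < val r < 1, a = h e r & A = h e \o segI r (I1 R)].

Lemma left_arc_I0 a A : is_left_arc a A -> A (I0 R) = a.
Proof. by move=> [[_ ->]//|[e [r [_ -> ->]]]]; rewrite /= segI_I0. Qed.

Lemma left_arc_is_arc a A : is_left_arc a A -> is_arc Sg A.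
Proof.
move=> [[sa ->]|[e [r [r01 _ ->]]]].
  by split; [exact: cst_continuous|by []|right].
have [he hi _] := hh; have /andP[r0 r1] := r01; split.
- exact: (@contcomp I I T _ (h e) (@segI_continuous R r (I1 R)) (ch (e := e))).
- by rewrite /= segI_I1; have [] := he e.
- left=> t t1; apply: hi; rewrite val_segI val_I1; apply/andP; split.
    by apply: ltr_pwDl => //; rewrite mulr_ge0 ?unitI_ge0// subr_ge0 ltW.
  by rewrite -ltrBrDl gtr_pMr// subr_gt0.
Qed.

(** The flow along the arc stops at a state or lasts until time 1, hence not before the hitting
    time; there its parameter is 1, since no interior point of the arc is a state. *)
Lemma left_arc_follows a A g : is_left_arc a A -> continuous g -> g (I0 R) = a ->
  (exists t, Sg (g t)) -> fflow h 0 1 (fun t => g (clampI t)) -> follows Sg A g.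
Proof.
move=> aA cg ga hg fg; split=> //; have [gtau before] := hitP Sg_closed cg hg.
case: aA => [[sa ->]|[e [r [r01 aE ->]]]].
  exists id => [|t]; first exact: calM_id.
  suff -> : hit Sg g = I0 R by rewrite minI_r ?val_I0 ?unitI_ge0.
  by apply: hitE; rewrite /is_hit ga; split=> // s; rewrite val_I0 ltNge unitI_ge0.
set tau := hit Sg g in gtau before *.
have [s' [psi [s'0 s'1 rpsi psiE pend]]] := fg 0 e r (lexx _) ler01 r01 (etrans ga aE).
have [[_ mpsi] _] := rpsi; have /andP[r0 r1] := r01.
have psi0 : psi 0 = val r.
  rewrite -(ramp_clampK 0 rpsi); congr val.
  by have [] := arc_family_inj hh r01 (etrans (esym (psiE 0 (lexx 0) s'0)) (etrans ga aE)).
have taus' : val tau <= s'.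
  rewrite leNgt; apply/negP => s'tau; apply: (before (clampI s')).
    by rewrite clampIK.
  rewrite psiE//; case: pend => [s'E|->]; last by case: hh => /(_ e)[].
  by move: s'tau; rewrite s'E ltNge unitI_le1.
have psitau : psi (val tau) = 1.
  apply: (arc_family_end hh rpsi (e := e)).
    by apply: lt_le_trans r0 _; rewrite -psi0 mpsi// unitI_ge0.
  by rewrite -psiE ?unitI_ge0// clampI_val.
have rm := ramp_comp (mono_cont_min (val tau)) rpsi.
have [||chi Mchi chiE] := segI_factor (r := r) (s := I1 R) rm.
- by rewrite min_l// unitI_ge0.
- by rewrite min_r ?unitI_le1// psitau val_I1.
exists chi => // t; rewrite /= -chiE -val_minI -psiE ?unitI_ge0 ?clampI_val//.
by apply: le_trans taus'; rewrite val_minI ge_min lexx orbT.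
Qed.

Definition avoiding (g : I -> T) := forall t, ~ Sg (g t).

Lemma avoiding_flow e r g : 0 < val r < 1 -> g (I0 R) = h e r -> avoiding g ->
  fflow h 0 1 (fun t => g (clampI t)) ->
  exists psi, [/\ ramp psi, psi 0 = val r, psi 1 < 1 &
    forall t, g t = h e (clampI (psi (val t)))].
Proof.
move=> r01 gr ag fg.
have [s' [psi [s'0 s'1 rpsi psiE pend]]] := fg 0 e r (lexx _) ler01 r01 gr.
have [he _ _] := hh.
have s'E : s' = 1.
  case: pend => // ps'; case: (ag (clampI s')).
  by rewrite psiE// ps'; have [] := he e.
subst s'; have psi1 : psi 1 != 1.
  apply/eqP => p1; case: (ag (I1 R)); rewrite -[g _]/(g (clampI 1)) psiE// p1.
  by have [] := he e.
exists psi; split=> //.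
- rewrite -(ramp_clampK 0 rpsi); congr val.
  by have [] := arc_family_inj hh r01 (etrans (esym (psiE 0 (lexx 0) s'0)) gr).
- by rewrite lt_neqAle psi1; case: rpsi => _ /(_ 1)/andP[].
- by move=> t; rewrite -psiE ?clampI_val ?unitI_ge0 ?unitI_le1.
Qed.

(** A path that avoids [Sg] never leaves the arc of its starting point, and injectivity of the arc
    turns its end point into a parameter [s]: all such paths with the same ends run through one
    segment. Hence the uniqueness of their trace. *)
Lemma avoiding_unique e r g0 : 0 < val r < 1 -> g0 (I0 R) = h e r -> avoiding g0 ->
  fflow h 0 1 (fun t => g0 (clampI t)) ->
  exists s, [/\ val r <= val s, avoiding (h e \o segI r s), g0 (I1 R) = h e s &
    forall g, g (I0 R) = h e r -> g (I1 R) = g0 (I1 R) -> avoiding g ->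
      fflow h 0 1 (fun t => g (clampI t)) ->
      exists2 chi, calM chi & g = (h e \o segI r s) \o chi].
Proof.
move=> r01 g0r ag0 fg0; have [_ hi _] := hh; have /andP[r0 r1] := r01.
have [psi [rpsi psi0 psi1 psiE]] := avoiding_flow r01 g0r ag0 fg0.
have [[_ mpsi] _] := rpsi.
pose s : I := clampI (psi 1); have sE : val s = psi 1 by rewrite ramp_clampK.
have rs : val r <= val s by rewrite sE -psi0 mpsi.
have s01 : 0 < val s < 1 by rewrite (lt_le_trans r0 rs) sE.
have g0s : g0 (I1 R) = h e s by rewrite psiE val_I1.
exists s; split=> //.
  move=> t; apply: hi; rewrite val_segI; apply/andP; split.
    by apply: ltr_pwDl => //; rewrite mulr_ge0 ?unitI_ge0// subr_ge0.
  have : (val s - val r) * val t <= val s - val r.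
    by rewrite ler_piMr ?unitI_le1// subr_ge0.
  by have /andP[_ s1] := s01; move=> ?; lra.
move=> g gr gs ag fg.
have [psi' [rpsi' psi'0 psi'1 psi'E]] := avoiding_flow r01 gr ag fg.
have psi'1s : psi' 1 = val s.
  rewrite -(ramp_clampK 1 rpsi'); congr val.
  have gs' : h e (clampI (psi' 1)) = h e s by rewrite -g0s -gs psi'E val_I1.
  by have [] := arc_family_inj hh s01 gs'.
have [chi Mchi chiE] := segI_factor rpsi' psi'0 psi'1s.
by exists chi => //; apply/funext => t; rewrite psi'E chiE.
Qed.

End LeftArc.

(** * Traces *)

Section Halves.
Variable R : realType.
Notation I := (unitI R).

Definition fst_half (t : I) : I := clampI (2^-1 * val t).
Definition snd_half (t : I) : I := clampI (2^-1 * val t + 2^-1).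

Lemma val_fst_half t : val (fst_half t) = 2^-1 * val t.
Proof. by have t0 : 0 <= val t := unitI_ge0 t; have t1 : val t <= 1 := unitI_le1 t; rewrite clampIK; lra. Qed.

Lemma val_snd_half t : val (snd_half t) = 2^-1 * val t + 2^-1.
Proof. by have t0 : 0 <= val t := unitI_ge0 t; have t1 : val t <= 1 := unitI_le1 t; rewrite clampIK; lra. Qed.

Lemma fst_half_calI : calI fst_half.
Proof.
split; first by move=> s t st; rewrite !val_fst_half; lra.
apply: contcomp; last exact: clampI_continuous.
by apply: contM; [exact: contC|exact: unitI_val_continuous].
Qed.

Lemma snd_half_calI : calI snd_half.
Proof.
split; first by move=> s t st; rewrite !val_snd_half; lra.
apply: contcomp; last exact: clampI_continuous.
apply: contD; last exact: contC.
by apply: contM; [exact: contC|exact: unitI_val_continuous].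
Qed.

Lemma ncomp_I0 (T : Type) (p q : I -> T) : ncomp p q (I0 R) = p (I0 R).
Proof. by rewrite /ncomp val_I0 invr_ge0 ler0n mulr0. Qed.

Lemma ncomp_I1 (T : Type) (p q : I -> T) : ncomp p q (I1 R) = q (I1 R).
Proof.
rewrite /ncomp val_I1 ifN; last by rewrite -ltNge invf_lt1// ltr1n.
by congr (q _); apply: val_inj; rewrite mulr1 val_I1 clampIK; lra.
Qed.

Lemma ncomp_half_fst (T : Type) (p q : I -> T) t : ncomp p q (fst_half t) = p t.
Proof.
rewrite /ncomp val_fst_half ifT; last by have t1 : val t <= 1 := unitI_le1 t; lra.
by congr p; rewrite mulrA mulfV ?pnatr_eq0// mul1r clampI_val.
Qed.

Lemma ncomp_half_snd (T : Type) (p q : I -> T) t : p (I1 R) = q (I0 R) ->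
  ncomp p q (snd_half t) = q t.
Proof.
move=> pq; have t0 : 0 <= val t := unitI_ge0 t; rewrite /ncomp val_snd_half; case: ifPn => [t2|_].
  have tE : t = I0 R by apply: val_inj; rewrite val_I0; lra.
  rewrite tE -pq; congr p; apply: val_inj; rewrite val_I0 val_I1 mulr0 add0r.
  by rewrite clampIK; lra.
by congr q; rewrite -[RHS]clampI_val; congr clampI; lra.
Qed.

(** Separate reparametrizations of the two halves amount to a single one of the composite. *)
Lemma ncomp_halves (T : Type) (p q : I -> T) (alpha beta : I -> I) : p (I1 R) = q (I0 R) ->
  ncomp p q \o ncomp (fst_half \o alpha) (snd_half \o beta) = ncomp (p \o alpha) (q \o beta).
Proof.
move=> pq; rewrite ncomp_comp; congr ncomp; apply/funext => t /=.
  exact: ncomp_half_fst.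
exact: ncomp_half_snd.
Qed.

Lemma ncomp_calI (x y : I -> I) : calI x -> calI y -> x (I1 R) = y (I0 R) ->
  calI (ncomp x y).
Proof.
move=> [mx cx] [my cy] xy; split; last exact: ncomp_continuous.
have clampI_le (u v : R) : u <= v -> val (clampI u) <= val (clampI v).
  by have [[_ m] _] := @ramp_clamp R; exact: m.
move=> s t st; rewrite /ncomp; case: ifPn => s2; case: ifPn => t2.
- by apply/mx/clampI_le; lra.
- apply: le_trans (_ : val (x (I1 R)) <= _); first by apply: mx; rewrite val_I1 unitI_le1.
  by rewrite xy; apply: my; rewrite val_I0 unitI_ge0.
- by move: s2; rewrite (le_trans st t2).
- by apply/my/clampI_le; lra.
Qed.

Lemma ncomp_calM (x y : I -> I) : calI x -> calI y -> x (I1 R) = y (I0 R) ->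
  x (I0 R) = I0 R -> y (I1 R) = I1 R -> calM (ncomp x y).
Proof.
move=> Ix Iy xy x0 y1; apply: calI_calM; first exact: ncomp_calI.
  by rewrite ncomp_I0.
by rewrite ncomp_I1.
Qed.

Lemma fst_half_I0 : fst_half (I0 R) = I0 R.
Proof. by apply: val_inj; rewrite val_fst_half val_I0 mulr0. Qed.

Lemma snd_half_I1 : snd_half (I1 R) = I1 R.
Proof. by apply: val_inj; rewrite val_snd_half val_I1; lra. Qed.

Lemma half_middle : fst_half (I1 R) = snd_half (I0 R).
Proof. by apply: val_inj; rewrite val_snd_half val_fst_half val_I0 val_I1; lra. Qed.

Lemma halves_calM (alpha beta : I -> I) : calM alpha -> calM beta ->
  calM (ncomp (fst_half \o alpha) (snd_half \o beta)).
Proof.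
move=> Ma Mb; apply: ncomp_calM => /=.
- by apply: calI_comp; [exact: fst_half_calI|exact: calM_calI].
- by apply: calI_comp; [exact: snd_half_calI|exact: calM_calI].
- by rewrite calM_I1// calM_I0// half_middle.
- by rewrite calM_I0// fst_half_I0.
- by rewrite calM_I1// snd_half_I1.
Qed.

Lemma cst_calI (t : I) : calI (fun _ : I => t).
Proof. by split=> // s; exact: cst_continuous. Qed.

Lemma maxI_calI (t : I) : calI (fun s => maxI s t).
Proof.
have [cm mm] := mono_cont_max (val t).
split; first by move=> s u su; rewrite !val_maxI; exact: mm.
rewrite (_ : (fun s => maxI s t) = fun s => clampI (Num.max (val s) (val t))).
  apply: contcomp; last exact: clampI_continuous.
  exact: (contcomp (@unitI_val_continuous R) cm).
by apply/funext => s; rewrite -val_maxI clampI_val.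
Qed.

Lemma minI_calI (t : I) : calI (fun s => minI s t).
Proof.
have [cm mm] := mono_cont_min (val t).
split; first by move=> s u su; rewrite !val_minI; exact: mm.
rewrite (_ : (fun s => minI s t) = fun s => clampI (Num.min (val s) (val t))).
  apply: contcomp; last exact: clampI_continuous.
  exact: (contcomp (@unitI_val_continuous R) cm).
by apply/funext => s; rewrite -val_minI clampI_val.
Qed.

Lemma rev_calI (phi : I -> I) : calI phi -> calI (@revI R \o phi \o @revI R).
Proof.
move=> [m c]; split.
  move=> s t st; have := m (revI t) (revI s); rewrite !val_revI lerD2l lerN2 => /(_ st) H.
  by rewrite lerD2l lerN2.
by apply: contcomp; [exact: revI_continuous|apply: contcomp; [exact: c|exact: revI_continuous]].
Qed.

Lemma rev_calM (phi : I -> I) : calM phi -> calM (@revI R \o phi \o @revI R).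
Proof.
move=> Mphi; apply: calI_calM; first exact/rev_calI/calM_calI.
  by rewrite /= revI_I0 calM_I1// revI_I1.
by rewrite /= revI_I1 calM_I0// revI_I0.
Qed.

Lemma ncomp_rev (T : Type) (p q : I -> T) : p (I1 R) = q (I0 R) ->
  ncomp p q \o @revI R = ncomp (q \o @revI R) (p \o @revI R).
Proof.
move=> pq; apply/funext => t; transitivity (ncomp p q (revI t)); first by [].
rewrite /ncomp val_revI.
have t0 : 0 <= val t := unitI_ge0 t; have t1 : val t <= 1 := unitI_le1 t.
have revE (x y : R) : 0 <= x <= 1 -> y = 1 - x -> clampI y = revI (clampI x).
  by move=> /andP[x0 x1] ->; apply: val_inj; rewrite val_revI !clampIK//; lra.
case: ifPn => [|/negP/negP]; rewrite -?ltNge => t2; case: ifPn => [|/negP/negP]; rewrite -?ltNge => t2'.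
- have tE : val t = 2^-1 by lra.
  have -> : clampI (2 * (1 - val t)) = I1 R by rewrite tE; congr clampI; lra.
  have -> : clampI (2 * val t) = I1 R by rewrite tE; congr clampI; lra.
  by rewrite /= revI_I1.
- by apply: (congr1 p); apply: revE; [apply/andP; split|]; lra.
- by apply: (congr1 q); apply: revE; [apply/andP; split|]; lra.
- by clear pq; exfalso; lra.
Qed.

End Halves.

Section Traces.
Variables (R : realType) (X : mpdspace R).
Notation I := (unitI R).
Implicit Types u v : X.

Definition mk_dpath u v (p : I -> X) (dp : dpath p) (p0 : p (I0 R) = u)
    (p1 : p (I1 R) = v) : dpath_space u v :=
  SigSub (mem_set (And3 dp p0 p1) : p \in dpath_set u v).

Lemma mk_dpathE u v p dp p0 p1 : dpath_fun (@mk_dpath u v p dp p0 p1) = p.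
Proof. by []. Qed.

Lemma dpath_funP u v (g : dpath_space u v) :
  [/\ dpath (dpath_fun g), dpath_fun g (I0 R) = u & dpath_fun g (I1 R) = v].
Proof. exact: (set_valP (g : set_type (dpath_set u v))). Qed.

Lemma dpath_fun_inj u v (g h : dpath_space u v) : dpath_fun g = dpath_fun h -> g = h.
Proof. by move=> gh; apply: val_inj. Qed.

Lemma traceP u v (g h : dpath_space u v) :
  trace g = trace h <-> clos_refl_sym_trans _ (@reparam R X u v) g h.
Proof. by split=> [/eqmodP/asboolP|gh]; last exact/eqmodP/asboolP. Qed.

Lemma trace_reparam u v (g h : dpath_space u v) phi : calM phi ->
  dpath_fun h = dpath_fun g \o phi -> trace g = trace h.
Proof. by move=> Mphi hg; apply/traceP; apply: rst_step; exists phi. Qed.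

Lemma trace_common u v (g h : dpath_space u v) phi psi : calM phi -> calM psi ->
  dpath_fun g \o phi = dpath_fun h \o psi -> trace g = trace h.
Proof.
move=> Mphi Mpsi gh; have [dg g0 g1] := dpath_funP g.
have k0 : (dpath_fun g \o phi) (I0 R) = u by rewrite /= calM_I0.
have k1 : (dpath_fun g \o phi) (I1 R) = v by rewrite /= calM_I1.
pose k := mk_dpath (dpath_reparam dg (calM_calI Mphi)) k0 k1.
by rewrite (trace_reparam (h := k) Mphi)//; apply/esym/(trace_reparam Mpsi).
Qed.

Lemma trace_surj u v (x : trace_space u v) : exists g : dpath_space u v, x = trace g.
Proof. by exists (repr (x : {eq_quot (trace_equiv u v)})); rewrite /trace reprK. Qed.

Lemma trace_lift u v (Z : topologicalType) (F : dpath_space u v -> Z) :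
  continuous F -> (forall g h, reparam g h -> F g = F h) ->
  exists2 G : trace_space u v -> Z, continuous G & forall g, G (trace g) = F g.
Proof.
move=> cF FE; pose G (x : trace_space u v) := F (repr (x : {eq_quot (trace_equiv u v)})).
have FC x y : clos_refl_sym_trans _ (@reparam R X u v) x y -> F x = F y.
  by elim=> {x y} // x y z _ -> _ ->.
have GE g : G (trace g) = F g.
  have /traceP : trace (repr (trace g : {eq_quot (trace_equiv u v)})) = trace g by exact: reprK.
  exact: FC.
exists G => //; apply/quotient_continuous; rewrite (_ : _ \o _ = F)//.
by apply/funext => g; exact: GE.
Qed.

Lemma trace_continuous u v : continuous (@trace R X u v).
Proof. exact: pi_continuous. Qed.

End Traces.

Lemma dpath_space_map_continuous (R : realType) (X Y : mpdspace R) (u v : X) (u' v' : Y)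
    (m : set_type (dpath_set u v) -> set_type (dpath_set u' v')) :
  (forall g, (fun k => val (m k)) @ g --> (val (m g) : {compact-open, unitI R -> Y})) ->
  continuous (m : dpath_space u v -> dpath_space u' v').
Proof.
move=> cm; apply: kelley_map_continuous; apply: into_subtype_continuous => g.
exact: cm.
Qed.

(** * Splitting the traces of one cellular space *)

Section Split.
Variables (R : realType) (X : mpdspace R) (E : Type) (h : E -> unitI R -> X).
Hypotheses (hX : arc_structure h) (T2 : hausdorff_space X) (Sg_closed : closed (states X)).
Notation I := (unitI R).
Notation CO := {compact-open, I -> X}.
Notation Sg := (states X).
Implicit Types g p q r C : I -> X.

Let hh := arc_structure_family hX.
Let hh' := rev_arc_family hh.
Let ch e : continuous (h e) := exec_continuous (arc_exec hX e).
Let ch' e : continuous (rev_arc h e) := contcomp (@revI_continuous R) (@ch e).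

Definition hits (g : I -> X) := exists t, Sg (g t).

Lemma rev_rev (T : Type) (g : I -> T) : (g \o @revI R) \o @revI R = g.
Proof. by apply/funext => t; rewrite /= revIK. Qed.

Lemma hits_rev g : hits g -> hits (g \o @revI R).
Proof. by move=> [t gt]; exists (revI t); rewrite /= revIK. Qed.

Lemma dpath_fflow g : dpath g -> fflow h 0 1 (fun t => g (clampI t)).
Proof. by move=> dg; have [] := dpath_flow hX dg. Qed.

Lemma dpath_bflow g : dpath g ->
  fflow (rev_arc h) 0 1 (fun t => (g \o @revI R) (clampI t)).
Proof.
move=> dg; have [_ bf] := dpath_flow hX dg.
have m1 : mono_cont (fun t : R => 1 * t + -1) by exact: mono_cont_affine.
have := fflow_reparam (a' := 0) (b' := 1) m1 _ _ bf.
rewrite mulr0 add0r mulr1 subrr oppr0 => /(_ (lexx _) (lexx _)).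
apply: fflow_ext => t t0 t1; congr (g _); rewrite mul1r /revI clampIK//.
by congr clampI; ring.
Qed.

Variables (a b : X) (A A' : I -> X).
Hypotheses (aA : is_left_arc Sg h a A) (bA' : is_left_arc Sg (rev_arc h) b A').

Let arcA := left_arc_is_arc hh (@ch) aA.
Let arcA' := left_arc_is_arc hh' (@ch') bA'.
Let A0 := left_arc_I0 aA.
Let A'0 := left_arc_I0 bA'.

Let a1 := A (I1 R).
Let b1 := A' (I1 R).
(** [A'] goes back in time from [b] to [b1]; [B] is the directed path from [b1] to [b]. *)
Let B := A' \o @revI R.

Let B0 : B (I0 R) = b1. Proof. by rewrite /B /= revI_I0. Qed.
Let B1 : B (I1 R) = b. Proof. by rewrite /B /= revI_I1. Qed.
Let Sa1 : Sg a1. Proof. by case: arcA. Qed.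
Let Sb1 : Sg b1. Proof. by case: arcA'. Qed.

Let dA : dpath A.
Proof.
case: aA => [[_ ->]|[e [r [_ _ ->]]]]; first exact: dpath_cst.
apply: dpath_reparam; first exact: exec_dpath (arc_exec hX e).
by apply: segI_calI; rewrite val_I1 unitI_le1.
Qed.

Let dB : dpath B.
Proof.
rewrite /B; case: bA' => [[_ ->]|[e [r [_ _ ->]]]]; first exact: dpath_cst.
have -> : (rev_arc h e \o segI r (I1 R)) \o @revI R =
   h e \o (@revI R \o segI r (I1 R) \o @revI R) by [].
apply: dpath_reparam; first exact: exec_dpath (arc_exec hX e).
by apply: rev_calI; apply: segI_calI; rewrite val_I1 unitI_le1.
Qed.

Lemma follows_left g : dpath g -> g (I0 R) = a -> hits g -> follows Sg A g.
Proof.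
move=> dg g0 hg; apply: (left_arc_follows Sg_closed hh aA) => //.
  exact: dpath_continuous.
exact: dpath_fflow.
Qed.

Lemma follows_right g : dpath g -> g (I1 R) = b -> hits g ->
  follows Sg A' (g \o @revI R).
Proof.
move=> dg g0 hg; apply: (left_arc_follows Sg_closed hh' bA') => //.
- by apply: contcomp; [exact: revI_continuous|exact: dpath_continuous].
- by rewrite /= revI_I0.
- exact: hits_rev.
- exact: dpath_bflow.
Qed.

Definition ltrunc (g : I -> X) : I -> X := trunc Sg g.
Definition rtrunc (g : I -> X) : I -> X := trunc Sg (g \o @revI R) \o @revI R.

Lemma trunc_start g : trunc Sg g (I0 R) = g (hit Sg g).
Proof. by rewrite /trunc maxI_r// val_I0 unitI_ge0. Qed.

Lemma trunc_end g : trunc Sg g (I1 R) = g (I1 R).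
Proof. by rewrite /trunc maxI_l// val_I1 unitI_le1. Qed.

(* [g] with a pause at its first state is a reparametrization of [g] and of the
   arc [C] followed by the truncation of [g]. *)
Lemma follows_trunc C g : follows Sg C g -> exists phi psi,
  [/\ calM phi, calM psi & g \o phi = ncomp C (trunc Sg g) \o psi].
Proof.
move=> fg; have [_ _ [chi Mchi chiE]] := fg; set tau := hit Sg g in chiE *.
exists (ncomp (fun t => minI t tau) (fun t => maxI t tau)).
exists (ncomp (@fst_half R \o chi) (@snd_half R \o id)); split.
- apply: ncomp_calM; [exact: minI_calI|exact: maxI_calI| | |].
  + by rewrite minI_1 maxI_r// val_I0 unitI_ge0.
  + by rewrite minI_l// val_I0 unitI_ge0.
  + by rewrite maxI_l// val_I1 unitI_le1.
- by apply: halves_calM => //; exact: calM_id.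
- rewrite ncomp_comp ncomp_halves; last by rewrite trunc_start (follows_hit fg).
  by congr ncomp; apply/funext => t; rewrite /= chiE.
Qed.

Lemma ltrunc_dpath g : dpath g -> dpath (ltrunc g).
Proof. by move=> dg; apply: (dpath_reparam dg); exact: maxI_calI. Qed.

Lemma rtrunc_dpath g : dpath g -> dpath (rtrunc g).
Proof.
move=> dg; have /(dpath_reparam dg) := rev_calI (maxI_calI (hit Sg (g \o @revI R))).
by [].
Qed.

Lemma ltrunc_I0 g : dpath g -> g (I0 R) = a -> hits g -> ltrunc g (I0 R) = a1.
Proof. by move=> dg g0 hg; rewrite /ltrunc trunc_start (follows_hit (follows_left dg g0 hg)). Qed.

Lemma ltrunc_I1 g : ltrunc g (I1 R) = g (I1 R).
Proof. exact: trunc_end. Qed.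

Lemma rtrunc_I1 g : dpath g -> g (I1 R) = b -> hits g -> rtrunc g (I1 R) = b1.
Proof.
move=> dg g0 hg; rewrite /rtrunc /= revI_I1 trunc_start.
by rewrite (follows_hit (follows_right dg g0 hg)).
Qed.

Lemma rtrunc_I0 g : rtrunc g (I0 R) = g (I0 R).
Proof. by rewrite /rtrunc /= revI_I0 trunc_end /= revI_I1. Qed.

Lemma ltrunc_common g : dpath g -> g (I0 R) = a -> hits g -> exists phi psi,
  [/\ calM phi, calM psi & g \o phi = ncomp A (ltrunc g) \o psi].
Proof. by move=> dg g0 hg; exact: follows_trunc (follows_left dg g0 hg). Qed.

Lemma rtrunc_common g : dpath g -> g (I1 R) = b -> hits g -> exists phi psi,
  [/\ calM phi, calM psi & g \o phi = ncomp (rtrunc g) B \o psi].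
Proof.
move=> dg g1 hg; have [phi [psi [Mphi Mpsi E1]]] := follows_trunc (follows_right dg g1 hg).
exists (@revI R \o phi \o @revI R), (@revI R \o psi \o @revI R).
split; [exact: rev_calM|exact: rev_calM|].
have E2 : ncomp (rtrunc g) B \o @revI R = ncomp A' (trunc Sg (g \o @revI R)).
  rewrite ncomp_rev; last by rewrite (rtrunc_I1 dg g1 hg) B0.
  by rewrite /B /rtrunc !rev_rev.
transitivity (((g \o @revI R) \o phi) \o @revI R) => //.
by rewrite E1 -E2.
Qed.

(** Once truncated on the left, the path starts at a state, so that the truncation on the right
    still has a state to stop at. *)
Definition trunc2 (g : I -> X) : I -> X := rtrunc (ltrunc g).

Lemma ltrunc_hits g : dpath g -> g (I0 R) = a -> hits g -> hits (ltrunc g).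
Proof. by move=> dg g0 hg; exists (I0 R); rewrite ltrunc_I0. Qed.

Lemma trunc2_dpath_set g : dpath_set a b g -> hits g -> dpath_set a1 b1 (trunc2 g).
Proof.
move=> [dg g0 g1] hg; have dl := ltrunc_dpath dg; split.
- exact: rtrunc_dpath.
- by rewrite /trunc2 rtrunc_I0 ltrunc_I0.
- by apply: rtrunc_I1 => //; [rewrite ltrunc_I1|exact: ltrunc_hits].
Qed.

Definition glue (q : I -> X) := ncomp A (ncomp q B).

Lemma glue_dpath_set q : dpath_set a1 b1 q -> dpath_set a b (glue q).
Proof.
move=> [dq q0 q1]; split.
- apply: dpath_ncomp => //; last by rewrite ncomp_I0.
  by apply: dpath_ncomp => //; rewrite q1 B0.
- by rewrite /glue ncomp_I0 A0.
- by rewrite /glue !ncomp_I1 B1.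
Qed.

Lemma glue_hits q : hits (glue q).
Proof. by exists (fst_half (I1 R)); rewrite /glue ncomp_half_fst. Qed.

Lemma double_nondecreasing : nondecreasingI (fun t : I => clampI (2 * val t)).
Proof.
move=> s t st; have [[_ m] _] := @ramp_clamp R; apply: m.
by rewrite ler_pM2l// ltr0n.
Qed.

Let half_val : val (fst_half (I1 R) : I) = 2^-1.
Proof. by rewrite val_fst_half val_I1 mulr1. Qed.

Lemma ncompl (p q : I -> X) t : val t <= 2^-1 -> ncomp p q t = p (clampI (2 * val t)).
Proof. by rewrite /ncomp => ->. Qed.

Lemma trunc_ncomp C p : is_arc Sg C -> follows Sg C (ncomp C p) ->
  trunc Sg (ncomp C p) = ncomp (fun=> C (I1 R)) p.
Proof.
move=> aC fC; have [_ SC _] := aC; pose s : I := fst_half (I1 R).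
have gs : Sg (ncomp C p s) by rewrite ncomp_half_fst.
have gC t : val t <= val s -> ncomp C p t = C (clampI (2 * val t)).
  by rewrite half_val; exact: ncompl.
have H := trunc_arc Sg_closed aC fC gC double_nondecreasing gs.
apply/funext => t; rewrite H (half_val : val s = 2^-1) /ncomp.
by case: ifPn => // /negbTE ->.
Qed.

(** Reversing the left truncation of [glue q] changes the bracketing and leaves the arc [A'] on the
    first quarter of the time interval. *)
Lemma trunc_ncomp2 C p r : is_arc Sg C -> follows Sg C (ncomp (ncomp C p) r) ->
  trunc Sg (ncomp (ncomp C p) r) = ncomp (ncomp (fun=> C (I1 R)) p) r.
Proof.
move=> aC fC; have [_ SC _] := aC; pose s : I := fst_half (fst_half (I1 R)).
have sE : val s = 4^-1 by rewrite !val_fst_half val_I1; lra.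
have gs : Sg (ncomp (ncomp C p) r s) by rewrite !ncomp_half_fst.
have dbl (t : I) : val t <= 4^-1 -> val (clampI (2 * val t)) <= 2^-1 :> R.
  by move=> t4; have t0 : 0 <= val t := unitI_ge0 t; rewrite clampIK; lra.
have gC t : val t <= val s -> ncomp (ncomp C p) r t =
    C (clampI (2 * val (clampI (2 * val t)))).
  rewrite sE => t4; rewrite ncompl; last by lra.
  by rewrite ncompl// dbl.
have mchi : nondecreasingI (fun t : I => clampI (2 * val (clampI (2 * val t)))).
  by move=> t u /double_nondecreasing/double_nondecreasing.
have H := trunc_arc Sg_closed aC fC gC mchi gs.
apply/funext => t; rewrite H sE; case: ifPn => [t4|].
  by rewrite ncompl; [rewrite ncompl// dbl|lra].
rewrite -ltNge => t4; rewrite /ncomp; case: ifPn => // t2.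
rewrite clampIK; [|by lra|by lra].
by rewrite ifN ?ifN// -ltNge; lra.
Qed.

(** Both arcs become pauses of the same duration, so that the result is an explicit
    reparametrization of [q]: this is one of the two inverse laws on traces. *)
Lemma trunc2_glue q : dpath_set a1 b1 q ->
  trunc2 (glue q) = ncomp (fun=> a1) (ncomp q (fun=> b1)).
Proof.
move=> [dq q0 q1]; have [dg g0 g1] := glue_dpath_set (And3 dq q0 q1).
have lE : ltrunc (glue q) = ncomp (fun=> a1) (ncomp q B).
  by apply: trunc_ncomp => //; apply: follows_left => //; exact: glue_hits.
have dl := ltrunc_dpath dg; have hl := ltrunc_hits dg g0 (glue_hits q).
have fr : follows Sg A' (ltrunc (glue q) \o @revI R).
  by apply: follows_right => //; rewrite ltrunc_I1.
have qB : q (I1 R) = B (I0 R) by rewrite q1 B0.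
have aqB : (fun _ : I => a1) (I1 R) = ncomp q B (I0 R) by rewrite ncomp_I0.
have E1 : ltrunc (glue q) \o @revI R =
    ncomp (ncomp A' (q \o @revI R)) (fun=> a1).
  by rewrite lE ncomp_rev// ncomp_rev// /B rev_rev.
rewrite /trunc2 /rtrunc E1 trunc_ncomp2//; last by rewrite -E1.
rewrite ncomp_rev; last by rewrite ncomp_I1 /= revI_I1.
congr ncomp; rewrite ncomp_rev; last by rewrite /= revI_I0.
by rewrite rev_rev.
Qed.

Lemma trunc2_reparam g phi : dpath g -> g (I0 R) = a -> g (I1 R) = b -> hits g ->
  calM phi -> trunc2 (g \o phi) = trunc2 g \o phi.
Proof.
move=> dg g0 g1 hg Mphi; have cg := dpath_continuous dg.
have -> : trunc2 (g \o phi) = rtrunc (ltrunc g \o phi).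
  by rewrite /trunc2 /ltrunc trunc_reparam.
have dl := ltrunc_dpath dg; have hl := ltrunc_hits dg g0 hg.
have cl : continuous (ltrunc g \o @revI R).
  by apply: contcomp; [exact: revI_continuous|exact: dpath_continuous].
have -> : rtrunc (ltrunc g \o phi) = trunc Sg ((ltrunc g \o @revI R) \o (@revI R \o phi \o @revI R)) \o @revI R.
  rewrite /rtrunc; congr (trunc Sg _ \o _); apply/funext => t /=.
  by rewrite revIK.
rewrite trunc_reparam//; [|exact: hits_rev|exact: rev_calM].
by apply/funext => t; rewrite /trunc2 /rtrunc /= !revIK.
Qed.

Lemma trunc2_cvg (F : set_system CO) (g0 : CO) : Filter F -> F --> g0 ->
  F [set g : CO | dpath_set a b g /\ hits g] -> dpath_set a b g0 -> hits g0 ->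
  (fun g : CO => (trunc2 g : CO)) @ F --> (trunc2 g0 : CO).
Proof.
move=> FF Fg FD [dg0 g00 g01] hg0.
have F1 : (fun g : CO => (ltrunc g : CO)) @ F --> (ltrunc g0 : CO).
  apply: (trunc_cvg T2 Sg_closed arcA FF Fg); last exact: follows_left.
  by apply: filterS FD => g [[dg g0' _] hg]; exact: follows_left.
pose F' : set_system CO := (fun g : CO => (ltrunc g \o @revI R : CO)) @ F.
have FF' : Filter F' by exact: fmap_filter.
have F2 : F' --> (ltrunc g0 \o @revI R : CO).
  exact: (co_precomp (@revI_continuous R) _ F1).
have right g : dpath_set a b g -> hits g -> follows Sg A' (ltrunc g \o @revI R).
  move=> [dg g0' g1] hg; apply: follows_right; first exact: ltrunc_dpath.
    by rewrite ltrunc_I1.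
  exact: ltrunc_hits.
have FD' : F' [set g : CO | follows Sg A' g].
  change (F [set g : CO | follows Sg A' (ltrunc g \o @revI R)]).
  by apply: filterS FD => g [dg hg]; exact: right.
have F3 := trunc_cvg T2 Sg_closed arcA' FF' F2 FD' (right _ (And3 dg0 g00 g01) hg0).
exact: (co_precomp (@revI_continuous R) _ F3).
Qed.

Lemma glue_cvg (F : set_system CO) (q0 : CO) : Filter F -> F --> q0 ->
  dpath_set a1 b1 q0 -> (fun q : CO => (glue q : CO)) @ F --> (glue q0 : CO).
Proof.
move=> FF Fq [dq0 q00 q01]; have F1 := co_ncomp_left (p := B) FF Fq.
have Aq : A (I1 R) = ncomp q0 B (I0 R) by rewrite ncomp_I0.
exact: (co_ncomp_right Aq _ F1).
Qed.

(** The arc [A] followed by the left truncation of [g] is the intermediate path: it has a common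
    reparametrization with [g], and another one with the glued path, obtained by treating the right
    end within its second half. *)
Lemma trace_trunc2 (g g' : dpath_space a b) : hits (dpath_fun g) ->
  dpath_fun g' = glue (trunc2 (dpath_fun g)) -> trace g = trace g'.
Proof.
move=> hg g'E; have [dg g0 g1] := dpath_funP g.
have dl := ltrunc_dpath dg; have l0 := ltrunc_I0 dg g0 hg.
have l1 : ltrunc (dpath_fun g) (I1 R) = b by rewrite ltrunc_I1.
have hl := ltrunc_hits dg g0 hg.
have [phi [psi [Mphi Mpsi E1]]] := ltrunc_common dg g0 hg.
have [phi' [psi' [Mphi' Mpsi' E2]]] := rtrunc_common dl l1 hl.
have dk : dpath (ncomp A (ltrunc (dpath_fun g))) by apply: dpath_ncomp.
have k0 : ncomp A (ltrunc (dpath_fun g)) (I0 R) = a by rewrite ncomp_I0 A0.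
have k1 : ncomp A (ltrunc (dpath_fun g)) (I1 R) = b by rewrite ncomp_I1.
pose k := mk_dpath dk k0 k1.
rewrite (trace_common (h := k) Mphi Mpsi)//.
have M1 := halves_calM (@calM_id R) Mphi'; have M2 := halves_calM (@calM_id R) Mpsi'.
apply: (trace_common M1 M2).
have jl : A (I1 R) = ltrunc (dpath_fun g) (I0 R) by rewrite l0.
have jg : A (I1 R) = ncomp (trunc2 (dpath_fun g)) B (I0 R).
  by rewrite ncomp_I0 /trunc2 rtrunc_I0 l0.
rewrite g'E mk_dpathE /glue (ncomp_halves _ _ jl) (ncomp_halves _ _ jg).
by congr ncomp; exact: E2.
Qed.

Lemma trace_glue_trunc2 (q q' : dpath_space a1 b1) :
  dpath_fun q' = trunc2 (glue (dpath_fun q)) -> trace q = trace q'.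
Proof.
have [dq q0 q1] := dpath_funP q.
(* [theta] rests at 0 on the first half, runs through [0,1] on the third quarter and rests at 1 on
   the last one. *)
pose theta := ncomp (fun _ : I => I0 R) (ncomp id (fun _ : I => I1 R)).
have Mt : calM theta.
  have Iid : calI (@id I) by apply: calM_calI; exact: calM_id.
  apply: ncomp_calM => //; first exact: cst_calI.
  - by apply: ncomp_calI => //; exact: cst_calI.
  - by rewrite ncomp_I0.
  - by rewrite ncomp_I1.
move=> q'E; apply: (trace_reparam Mt); rewrite q'E trunc2_glue//.
rewrite /theta !ncomp_comp; congr ncomp; first by apply/funext => t; rewrite /= q0.
by congr ncomp; apply/funext => t; rewrite /= q1.
Qed.

Definition trunc_path (g : dpath_space a b) (hg : hits (dpath_fun g)) : dpath_space a1 b1 :=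
  SigSub (mem_set (trunc2_dpath_set (dpath_funP g) hg) : trunc2 (dpath_fun g) \in dpath_set a1 b1).

Definition glue_path (q : dpath_space a1 b1) : dpath_space a b :=
  SigSub (mem_set (glue_dpath_set (dpath_funP q)) : glue (dpath_fun q) \in dpath_set a b).

Lemma glue_path_continuous : continuous glue_path.
Proof.
apply: (@dpath_space_map_continuous R X X a1 b1 a b glue_path) => q.
have Fq : Filter (nbhs (q : set_type (dpath_set a1 b1))) by exact: nbhs_filter.
have cv : (fun k : set_type (dpath_set a1 b1) => val k) @ q --> (val q : CO).
  exact: subtype_val_continuous.
exact: (glue_cvg _ cv (dpath_funP (q : dpath_space a1 b1))).
Qed.

Lemma glue_path_reparam (q q' : dpath_space a1 b1) : reparam q q' ->
  trace (glue_path q) = trace (glue_path q').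
Proof.
move=> [phi Mphi qE]; have [_ q0 q1] := dpath_funP q.
have M1 := halves_calM Mphi (@calM_id R); have M2 := halves_calM (@calM_id R) M1.
apply: (trace_reparam M2).
rewrite -[dpath_fun (glue_path q')]/(glue (dpath_fun q')) -[dpath_fun (glue_path q)]/(glue (dpath_fun q)).
rewrite /glue ncomp_halves ?ncomp_I0 ?q0// ncomp_halves ?q1 ?B0// qE.
by [].
Qed.

Lemma hits_reparam g phi : calM phi -> hits g -> hits (g \o phi).
Proof. by move=> [_ sphi] [t gt]; have [s sE] := sphi t; exists s; rewrite /= sE. Qed.

Lemma avoiding_open :
  open [set g : set_type (dpath_set a b) | ~ hits (val g : I -> X)].
Proof.
have cv : continuous (fun g : set_type (dpath_set a b) => val g : CO).
  exact: subtype_val_continuous.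
have oS : open (~` Sg) by rewrite openC.
have := co_open (@unitI_compact R) oS.
move/continuousP: cv => cv /cv; congr open; apply/seteqP; split=> g /=.
  by move=> gS [t gt]; apply: (gS (val g t)) => //; exists t.
by move=> nh _ [t _ <-] gt; apply: nh; exists t.
Qed.

Lemma avoiding_segment (g0 : dpath_space a b) : ~ hits (dpath_fun g0) ->
  exists C : dpath_space a b, ~ hits (dpath_fun C) /\
    forall g : dpath_space a b, ~ hits (dpath_fun g) ->
      exists2 chi, calM chi & dpath_fun g = dpath_fun C \o chi.
Proof.
move=> nh; have [d0 g00 g01] := dpath_funP g0.
have [sa|[e [r [r01 aE]]]] := arc_cover hX a.
  by case: nh; exists (I0 R); rewrite g00.
have av g : ~ hits g -> avoiding Sg g by move=> ng t gt; apply: ng; exists t.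
have [s [rs avC g0s Cu]] := avoiding_unique hh r01 (etrans g00 aE) (av _ nh) (dpath_fflow d0).
have dC : dpath (h e \o segI r s).
  by apply: dpath_reparam; [exact: exec_dpath (arc_exec hX e)|exact: segI_calI].
have C0 : (h e \o segI r s) (I0 R) = a by rewrite /= segI_I0 aE.
have C1 : (h e \o segI r s) (I1 R) = b by rewrite /= segI_I1 -g0s.
exists (mk_dpath dC C0 C1); split; first by move=> [t]; exact: avC.
move=> g ng; have [dg g0' g1'] := dpath_funP g.
by apply: Cu; rewrite ?g0' ?g1' ?g01//; [exact: av|exact: dpath_fflow].
Qed.

(** Meeting a closed set is not an open condition in general. Here all avoiding paths run inside the
    compact range of one segment [C] without states, so that a path meets the states exactly when it
    leaves this range at some time. *)
Lemma hits_open :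
  open [set g : set_type (dpath_set a b) | hits (val g : I -> X)].
Proof.
have [[g0 ng0]|all] := pselect (exists g0 : dpath_space a b, ~ hits (dpath_fun g0)); last first.
  rewrite (_ : [set _ | _] = setT); first exact: openT.
  apply/seteqP; split=> // g _ /=; apply: contrapT => ng.
  by apply: all; exists (g : dpath_space a b).
have [C [avC Cu]] := avoiding_segment ng0; have [dC _ _] := dpath_funP C.
have cC : closed (range (dpath_fun C)).
  apply: compact_closed => //; apply: continuous_compact; last exact: unitI_compact.
  by apply: continuous_subspaceT; exact: dpath_continuous.
rewrite (_ : [set _ | _] = \bigcup_t [set g : set_type (dpath_set a b) |
   (val g : I -> X) @` [set t] `<=` ~` range (dpath_fun C)]).
  apply: bigcup_open => t _.
  have cv : continuous (fun g : set_type (dpath_set a b) => val g : CO).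
    exact: subtype_val_continuous.
  have oC : open (~` range (dpath_fun C)) by rewrite openC.
  by have := co_open (@compact_set1 _ t) oC; move/continuousP: cv => cv /cv.
apply/seteqP; split=> g /=.
  move=> [t gt]; exists t => // _ [_ -> <-] [s _ sE].
  by apply: avC; exists s; rewrite sE.
move=> [t _ gt]; apply: contrapT => ng.
have [chi _ gE] := Cu (g : dpath_space a b) ng.
apply: (gt ((val g : I -> X) t)); first by exists t.
by exists (chi t) => //; rewrite -[RHS]/(dpath_fun (g : dpath_space a b) t) gE.
Qed.

(* [hits] is a clopen condition, so that the map can be prescribed separately on
   the paths which meet the states and on those which avoid them. *)
Lemma trunc_path_lift (Z : topologicalType) (iota : trace_space a1 b1 -> Z)
    (c0 : forall g : dpath_space a b, ~ hits (dpath_fun g) -> Z) :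
  continuous iota -> (forall (g g' : dpath_space a b) ng ng', c0 g ng = c0 g' ng') ->
  exists G : trace_space a b -> Z, [/\ continuous G,
    forall (g : dpath_space a b) hg, G (trace g) = iota (trace (trunc_path (g := g) hg)) &
    forall (g : dpath_space a b) ng, G (trace g) = c0 g ng].
Proof.
move=> ci c0E.
pose F (g : dpath_space a b) := match pselect (hits (dpath_fun g)) with
  | left hg => iota (trace (trunc_path hg)) | right ng => c0 g ng end.
have FL (g : dpath_space a b) hg : F g = iota (trace (trunc_path (g := g) hg)).
  by rewrite /F; case: pselect => // hg'; rewrite (Prop_irrelevance hg' hg).
have FR (g : dpath_space a b) ng : F g = c0 g ng.
  by rewrite /F; case: pselect => // ng'; exact: c0E.
have kid := @kelley_id_continuous R (set_type (dpath_set a b)).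
have F_reparam (g g' : dpath_space a b) : reparam g g' -> F g = F g'.
  move=> [phi Mphi gE]; have [dg g0 g1] := dpath_funP g.
  have [hg|ng] := pselect (hits (dpath_fun g)).
    have hg' : hits (dpath_fun g') by rewrite gE; exact: hits_reparam.
    rewrite (FL _ hg) (FL _ hg'); congr iota; apply: (trace_reparam Mphi).
    rewrite -[LHS]/(trunc2 (dpath_fun g')) gE.
    exact: trunc2_reparam.
  have ng' : ~ hits (dpath_fun g').
    by rewrite gE => -[t gt]; apply: ng; exists (phi t).
  by rewrite (FR _ ng) (FR _ ng').
have cF : continuous F.
  move=> g0; have [hg0|ng0] := pselect (hits (dpath_fun g0)).
    (* The truncation is made total by a constant value on the avoiding paths; both kinds of paths
       being open, it is continuous everywhere. *)
    pose m (g : set_type (dpath_set a b)) : set_type (dpath_set a1 b1) :=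
      match pselect (hits (dpath_fun (g : dpath_space a b))) with
      | left hg => trunc_path hg | right _ => trunc_path hg0 end.
    have mL (g : set_type (dpath_set a b)) (hg : hits (val g : I -> X)) : val (m g) = trunc2 (val g) by rewrite /m; case: pselect.
    have mR (g : set_type (dpath_set a b)) (ng : ~ hits (val g : I -> X)) : m g = trunc_path hg0 by rewrite /m; case: pselect.
    have cm : continuous (m : dpath_space a b -> dpath_space a1 b1).
      apply: (@dpath_space_map_continuous R X X a b a1 b1 m) => g.
      have Fg : Filter (nbhs (g : set_type (dpath_set a b))) by exact: nbhs_filter.
      have [hg|ng] := pselect (hits (val g : I -> X)).
        have near_hits : \forall k \near g, hits (val k : I -> X).
          exact: (open_nbhs_nbhs (conj hits_open hg)).
        have cv : (fun k : set_type (dpath_set a b) => val k) @ g --> (val g : CO).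
          exact: subtype_val_continuous.
        rewrite (mL g hg).
        have Fhit : ((fun k : set_type (dpath_set a b) => val k) @ g)
            [set k : CO | dpath_set a b k /\ hits k].
          change (nbhs g [set k : set_type (dpath_set a b) |
            dpath_set a b (val k) /\ hits (val k : I -> X)]).
          by apply: filterS near_hits => k hk; split=> //; exact: (dpath_funP (k : dpath_space a b)).
        have H := trunc2_cvg _ cv Fhit (dpath_funP (g : dpath_space a b)) hg.
        move=> P /H nP; change (nbhs g [set k : set_type (dpath_set a b) | P (val (m k))]).
        by apply: filterS2 near_hits nP => k hk; rewrite /= mL.
      have near_avoid : \forall k \near g, ~ hits (val k : I -> X).
        exact: (open_nbhs_nbhs (conj avoiding_open ng)).
      rewrite (mR g ng) => P /nbhs_singleton nP.
      change (nbhs g [set k : set_type (dpath_set a b) | P (val (m k))]).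
      by apply: filterS near_avoid => k nk; rewrite /= mR.
    apply: (@continuous_near_eq (dpath_space a b) Z F
      (fun g : dpath_space a b => iota (trace (m g : dpath_space a1 b1)))); last first.
      apply: (contcomp (f := fun g : dpath_space a b => trace (m g : dpath_space a1 b1))) => //.
      by apply: (contcomp cm); exact: trace_continuous.
    have : nbhs g0 [set g : dpath_space a b | hits (dpath_fun g)].
      exact: (kid g0 [set g | hits (val g : I -> X)] (open_nbhs_nbhs (conj hits_open hg0))).
    apply: filterS => g hg; rewrite (FL g hg); congr (iota (trace _)).
    by apply: dpath_fun_inj; exact: mL.
  apply: (@continuous_near_eq (dpath_space a b) Z F (fun=> c0 g0 ng0)); last exact: cst_continuous.
  have : nbhs g0 [set g : dpath_space a b | ~ hits (dpath_fun g)].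
    exact: (kid g0 [set g | ~ hits (val g : I -> X)] (open_nbhs_nbhs (conj avoiding_open ng0))).
  by apply: filterS => g ng; rewrite (FR g ng).
have [G cG GE] := trace_lift cF F_reparam.
by exists G; split=> // g hg; rewrite GE; [exact: FL|exact: FR].
Qed.

(** [U] is any one-point space, because the singleton wanted in the end is that of a trace of Y,
    while this result speaks of X only. *)
Theorem trace_split :
  ((exists g : dpath_space a b, ~ hits (dpath_fun g)) /\
   exists tau : trace_space a b,
     (forall g : dpath_space a b, ~ hits (dpath_fun g) -> trace g = tau) /\
     forall (U : topologicalType) (u : U), (forall v, v = u) ->
       homeomorphic (trace_space a b) (topsum U (trace_space a1 b1))) \/
  (~ (exists g : dpath_space a b, ~ hits (dpath_fun g)) /\
   homeomorphic (trace_space a b) (trace_space a1 b1)).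
Proof.
have cgl : continuous (fun q : dpath_space a1 b1 => trace (glue_path q)).
  by apply: (contcomp glue_path_continuous); exact: trace_continuous.
have [K cK KE] := trace_lift cgl glue_path_reparam.
have glK (g : dpath_space a b) hg : trace (glue_path (trunc_path (g := g) hg)) = trace g.
  by apply/esym/trace_trunc2.
have trK (q : dpath_space a1 b1) (hq : hits (dpath_fun (glue_path q))) : trace (trunc_path hq) = trace q.
  by apply/esym/trace_glue_trunc2.
have [[g0 ng0]|all] := pselect (exists g : dpath_space a b, ~ hits (dpath_fun g)).
  left; split; first by exists g0.
  have [C [avC Cu]] := avoiding_segment ng0; exists (trace C).
  have Ctau (g : dpath_space a b) : ~ hits (dpath_fun g) -> trace g = trace C.
    by move=> /Cu[chi Mchi gE]; apply/esym/(trace_reparam Mchi).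
  split=> // U u uU.
  pose fam (i : bool) : topologicalType := if i then U else trace_space a1 b1.
  have [G [cG GL GR]] := trunc_path_lift
    (iota := fun x => (existT fam false x : topsum U (trace_space a1 b1)))
    (c0 := fun _ _ => (existT fam true u : topsum U (trace_space a1 b1)))
    (@existT_continuous _ fam false) (fun _ _ _ _ => erefl).
  pose k (i : bool) : fam i -> trace_space a b :=
    match i with true => fun _ => trace C | false => K end.
  have ck : continuous (fun x : topsum U (trace_space a1 b1) => k (projT1 x) (projT2 x)).
    apply: (@sigT_continuous bool fam _ k) => -[]; last exact: cK.
    exact: cst_continuous.
  exists G, (fun x => k (projT1 x) (projT2 x)); split=> //.
    move=> x; have [g ->] := trace_surj x.
    have [hg|ng] := pselect (hits (dpath_fun g)).
      by rewrite (GL g hg) /= KE glK.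
    by rewrite (GR g ng) /= Ctau.
  move=> [[] x] /=; first by rewrite (GR C avC) (uU x).
  have [q ->] := trace_surj x; rewrite KE.
  by rewrite (GL _ (glue_hits (dpath_fun q) : hits (dpath_fun (glue_path q)))) trK.
right; split=> //.
have all_hit (g : dpath_space a b) : hits (dpath_fun g).
  by apply: contrapT => ng; apply: all; exists g.
have [G [cG GL _]] := trunc_path_lift (iota := id)
   (c0 := fun (g : dpath_space a b) ng => False_rect _ (ng (all_hit g)))
   (fun x => cvg_id) (fun (g _ : dpath_space a b) ng _ => False_ind _ (ng (all_hit g))).
exists G, K; split=> // x.
  by have [g ->] := trace_surj x; rewrite (GL g (all_hit g)) KE glK.
by have [q ->] := trace_surj x; rewrite KE (GL _ (all_hit _)) trK.
Qed.

End Split.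

(** Stated for functions [k] so as to cover a subdivision and its inverse alike, the latter being
    known only to preserve directed paths. *)
Lemma trace_push (R : realType) (X Y : mpdspace R) (k : X -> Y) (u v : X) (u' v' : Y) :
  continuous k -> (forall g, dpath g -> dpath (k \o g)) -> k u = u' -> k v = v' ->
  exists2 P : trace_space u v -> trace_space u' v', continuous P &
    forall g : dpath_space u v, exists2 g' : dpath_space u' v',
      P (trace g) = trace g' & dpath_fun g' = k \o dpath_fun g.
Proof.
move=> ck kd ku kv.
have kset g : dpath_set u v g -> dpath_set u' v' (k \o g).
  by move=> [dg g0 g1]; split; [exact: kd|rewrite /= g0|rewrite /= g1].
pose m (g : dpath_space u v) : dpath_space u' v' :=
  SigSub (mem_set (kset _ (dpath_funP g)) : (k \o dpath_fun g) \in dpath_set u' v').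
have cm : continuous m.
  apply: (@dpath_space_map_continuous R X Y u v u' v' m) => g.
  have Fg : Filter (nbhs (g : set_type (dpath_set u v))) by exact: nbhs_filter.
  have cv : (fun q : set_type (dpath_set u v) => val q) @ g --> (val g : {compact-open, unitI R -> X}).
    exact: subtype_val_continuous.
  exact: (co_postcomp ck _ cv).
have cF : continuous (fun g => trace (m g)) by apply: (contcomp cm); exact: trace_continuous.
have FE (g h : dpath_space u v) : reparam g h -> trace (m g) = trace (m h).
  move=> [phi Mphi hE]; apply: (trace_reparam Mphi).
  by rewrite -[LHS]/(k \o dpath_fun h) hE.
by have [P cP PE] := trace_lift cF FE; exists P => // g; exists (m g).
Qed.

Lemma homeomorphic_trans (S T U : topologicalType) :
  homeomorphic S T -> homeomorphic T U -> homeomorphic S U.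
Proof.
move=> [h [k [hk kh ch ck]]] [h' [k' [hk' kh' ch' ck']]].
exists (h' \o h), (k \o k'); split.
- by move=> x /=; rewrite hk' hk.
- by move=> x /=; rewrite kh kh'.
- exact: contcomp.
- exact: contcomp.
Qed.

Section Connection.
Variables (R : realType) (c : top_choice) (X : mpdspace R).
Hypothesis hX : in_Top R c X.
Variable D : cellular_decomposition c X.

Lemma left_arc_final x : exists2 A,
  is_left_arc (states X) (@arc_path _ _ _ D) x A & A (I1 R) = point_final D x.
Proof.
have [sx|[e [r [r01 xE]]]] := arc_path_cover hX D x.
  by exists (fun=> x); [left|rewrite (point_final_state hX)].
exists (arc_path e \o segI r (I1 R)); first by right; exists e, r.
by rewrite /= segI_I1 xE (point_final_arc hX).
Qed.

Lemma right_arc_init x : exists2 A,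
  is_left_arc (states X) (rev_arc (@arc_path _ _ _ D)) x A & A (I1 R) = point_init D x.
Proof.
have [sx|[e [r [r01 xE]]]] := arc_path_cover hX D x.
  by exists (fun=> x); [left|rewrite (point_init_state hX)].
exists (rev_arc (@arc_path _ _ _ D) e \o segI (revI r) (I1 R)).
  right; exists e, (revI r); split=> //; first exact: revI_interior.
  by rewrite /rev_arc revIK.
by rewrite /= segI_I1 /rev_arc revI_I1 xE (point_init_arc hX).
Qed.

End Connection.

Theorem theorem7p9 (R : realType) (c : top_choice) (X Y : mpdspace R)
    (hX : in_Top R c X) (hY : in_Top R c Y)
    (f : globular_subdivision c X Y) (D : cellular_decomposition c X)
    (a b : Y) (ha : states Y a) (hb : states Y b) :
  ((exists g : dpath_space a b, avoids f g) /\
   exists tau : trace_space a b, is_tau f tau /\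
     homeomorphic (trace_space a b)
       (topsum (set_type [set tau])
               (trace_space (conn_plus f D a) (conn_minus f D b))))
  \/
  (~ (exists g : dpath_space a b, avoids f g) /\
   homeomorphic (trace_space a b)
     (trace_space (conn_plus f D a) (conn_minus f D b))).
Proof.
(* The arcs of Y, absent from the conclusion, are what shows that directed paths of Y are directed
   in X. *)
have [D'] := gs_cellular_target f.
have hA := arc_path_arc_structure hX D; have kA := arc_path_arc_structure hY D'.
have fK := gs_mapK f; have fiK := gs_invK f.
have push g : dpath g -> dpath (f \o g).
  by apply: dpath_map => {}g eg; exact/exec_dpath/mfun_exec.
have pull g : dpath g -> dpath (gs_inv f \o g).
  exact: (dpath_subdivision fK fiK hA kA).
have [P cP PE] := trace_push (@gs_inv_continuous _ _ _ _ f) pull (erefl (gs_inv f a)) (erefl (gs_inv f b)).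
have [Q cQ QE] := trace_push (@mfun_continuous _ _ _ f) push (fiK a) (fiK b).
have PK : cancel P Q.
  move=> x; have [g ->] := trace_surj x; have [g' -> g'E] := PE g; have [g'' -> g''E] := QE g'.
  congr trace; apply: dpath_fun_inj; rewrite g''E g'E.
  by apply/funext => t; exact: fiK.
have QK : cancel Q P.
  move=> x; have [g ->] := trace_surj x; have [g' -> g'E] := QE g; have [g'' -> g''E] := PE g'.
  congr trace; apply: dpath_fun_inj; rewrite g''E g'E.
  by apply/funext => t; exact: fK.
have homeo : homeomorphic (trace_space a b) (trace_space (gs_inv f a) (gs_inv f b)).
  by exists P, Q.
have avoidsE (g : dpath_space a b) (g' : dpath_space (gs_inv f a) (gs_inv f b)) :
    (forall t, gs_inv f (dpath_fun g t) = dpath_fun g' t) ->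
    avoids f g <-> ~ hits (dpath_fun g').
  move=> gg'; split=> [ag [t]|nh _ [t _ <-] [x sx xE]].
    rewrite -gg' => st; apply: (ag (dpath_fun g t)); first by exists t.
    by exists (gs_inv f (dpath_fun g t)).
  by apply: nh; exists t; rewrite -gg' -xE fK.
have [A aA A1] := left_arc_final hX D (gs_inv f a).
have [A' bA' A'1] := right_arc_init hX D (gs_inv f b).
have := trace_split hA (cellular_hausdorff hX D) (cellular_states_closed hX D) aA bA'.
rewrite A1 A'1 -/(conn_plus f D a) -/(conn_minus f D b).
have down (g : dpath_space a b) : exists2 g' : dpath_space (gs_inv f a) (gs_inv f b),
    P (trace g) = trace g' & (avoids f g <-> ~ hits (dpath_fun g')).
  have [g' Pg g'E] := PE g; exists g' => //; apply: avoidsE => t.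
  by rewrite g'E.
have up (g' : dpath_space (gs_inv f a) (gs_inv f b)) : exists g : dpath_space a b,
    avoids f g <-> ~ hits (dpath_fun g').
  have [g _ gE] := QE g'; exists g; apply: avoidsE => t.
  by rewrite gE /= fK.
move=> [[[g' ng'] [tau [tauE split]]]|[nex hom]].
  have [g gg'] := up g'; have ag : avoids f g by exact/gg'.
  left; split; first by exists g.
  (* [tau] is a trace of X, carried to Y by [Q]. *)
  exists (Q tau); split.
    split; first by exists g.
    move=> q aq; have [q' qE qq'] := down q.
    by rewrite -[LHS]PK qE (tauE q')//; exact/qq'.
  apply: homeomorphic_trans homeo _.
  apply: (split (set_type [set Q tau]) (SigSub (mem_set (erefl (Q tau) : [set Q tau] (Q tau))))).
  by move=> v; apply: val_inj; exact: (set_valP v).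
right; split; last exact: homeomorphic_trans homeo hom.
move=> [g ag]; apply: nex; have [g' _ gg'] := down g.
by exists g'; exact/gg'.
Qed.
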